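(* Let $\beta>0$ and let $a,b\in C^\infty(\mathbb T;\mathbb R)$ satisfy $a,b\ge0$, $a\not\equiv0$, $b\not\equiv0$. Assume that there exists a nonempty open set $\mathcal O\Subset\mathbb T\setminus\operatorname{supp}(a)$. For $N\in\mathbb N^*=\{1,2,\dots\}$ let $\omega_N=\sqrt{N\tanh(\beta N)/\beta}$. Then the resolvent of $\mathcal A_d$ is not uniformly bounded on the imaginary axis. More precisely, there exists $c>0$ such that $$\|(i\omega_NI-\mathcal A_d)^{-1}\|_{\mathcal L(\mathcal H)}\ge c\sqrt N$$ for all sufficiently large $N$. Moreover, since $\omega_N\sim\frac1{\sqrt\beta}\sqrt N$, there exists $c_\beta>0$ such that $$\|(i\omega_NI-\mathcal A_d)^{-1}\|_{\mathcal L(\mathcal H)}\ge c_\beta\,\omega_N$$ for all sufficiently large $N$. In particular, $$\sup_{\tau\in\mathbb R}\|(i\tau I-\mathcal A_d)^{-1}\|_{\mathcal L(\mathcal H)}=+\infty.$$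
   Context: $\mathbb T=\mathbb R/(2\pi\mathbb Z)$; functions are complex valued. Fourier convention: $\widehat v(k)=\frac1{2\pi}\int_{\mathbb T}v(x)e^{-ikx}dx$, $k\in\mathbb Z$. $\langle k\rangle=(1+k^2)^{1/2}$ and $\|v\|_{H^s}^2=2\pi\sum_k\langle k\rangle^{2s}|\widehat v(k)|^2$. Fourier multipliers: $\widehat{T_\beta v}(k)=-im_\beta(k)\widehat v(k)$ with $m_\beta(k)=\tanh(\beta k)/\beta$; $\widehat{P_\beta v}(k)=p_\beta(k)\widehat v(k)$ with $p_\beta(k)=\frac{\tanh(\beta k)}{\beta k}$ for $k\ne0$ and $p_\beta(0)=1$. Energy space: $\mathcal H=L^2(\mathbb T)\times H^{-1/2}(\mathbb T)$ with inner product $\langle(h,u),(\varphi,\psi)\rangle_{\mathcal H}=\langle h,\varphi\rangle_{L^2}+\langle P_\beta u,\psi\rangle_{H^{1/2},H^{-1/2}}=2\pi\sum_k\widehat h(k)\overline{\widehat\varphi(k)}+2\pi\sum_kp_\beta(k)\widehat u(k)\overline{\widehat\psi(k)}$. Damped generator: $\mathcal A_d(h,u)=(T_\beta u-a^2h,\,-h_x-b^2P_\beta u)$ with domain $D(\mathcal A_d)=H^{1/2}(\mathbb T)\times L^2(\mathbb T)$. Under the assumptions on $a,b$ one has $i\mathbb R\subset\rho(\mathcal A_d)$, so the resolvents above exist. $\mathcal O\Subset U$ means that $\overline{\mathcal O}$ is a compact subset of $U$. *)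

(* Defs.v *)
From Stdlib Require Import Reals Rtopology ZArith Lra Lia Arith.
From Stdlib Require Import ClassicalEpsilon FunctionalExtensionality ProofIrrelevance.
From Coquelicot Require Import Coquelicot.

Open Scope R_scope.
#[local] Obligation Tactic := idtac.

(* Functions on T = R/(2 pi Z) are 2 pi-periodic functions on R; subsets of T
   are 2 pi-periodic subsets of R, with the induced closure and interior. *)
Definition periodic {X : Type} (f : R -> X) : Prop :=
  forall x, f (x + 2 * PI) = f x.

Definition smooth (f : R -> R) : Prop := forall n x, ex_derive_n f n x.

Lemma ex_derive_n_S f n :
  (forall x, ex_derive f x) -> (forall x, ex_derive_n (Derive f) n x) ->
  forall x, ex_derive_n f (S n) x.
Proof.
  intros H0 H x. destruct n as [|n]; [exact (H0 x)|].
  apply (ex_derive_ext (Derive_n (Derive f) n)); [|exact (H x)].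
  intros t. rewrite <- (Nat.add_1_r n). apply (Derive_n_comp f n 1).
Qed.

Lemma smooth_ex_derive f : smooth f -> forall x, ex_derive f x.
Proof. intros H x. exact (H 1%nat x). Qed.

Lemma smooth_Derive f : smooth f -> smooth (Derive f).
Proof.
  intros H [|n] x; [exact I|].
  apply (ex_derive_ext (Derive_n f (S n))); [|exact (H (S (S n)) x)].
  intros t. rewrite <- (Nat.add_1_r n). symmetry. apply (Derive_n_comp f n 1).
Qed.

Lemma smooth_const c : smooth (fun _ => c).
Proof. intros n x. apply ex_derive_n_const. Qed.

Lemma smooth_plus f g : smooth f -> smooth g -> smooth (fun x => f x + g x).
Proof.
  intros Hf Hg n x.
  apply ex_derive_n_plus; apply filter_forall; intros y k _; [apply Hf | apply Hg].
Qed.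

Lemma smooth_minus f g : smooth f -> smooth g -> smooth (fun x => f x - g x).
Proof.
  intros Hf Hg n x.
  apply ex_derive_n_minus; apply filter_forall; intros y k _; [apply Hf | apply Hg].
Qed.

Lemma smooth_mult f g : smooth f -> smooth g -> smooth (fun x => f x * g x).
Proof.
  assert (K : forall n f g, smooth f -> smooth g -> forall k, (k <= n)%nat ->
    forall x, ex_derive_n (fun x => f x * g x) k x).
  { clear f g. induction n as [|n IH]; intros f g Hf Hg k Hk.
    - replace k with 0%nat by lia. intros x. exact I.
    - destruct k as [|k]; [intros x; exact I|].
      apply ex_derive_n_S.
      + intros x. apply (ex_derive_mult f g); now apply smooth_ex_derive.
      + intros x.
        apply (ex_derive_n_ext (fun x => Derive f x * g x + f x * Derive g x)).
        { intros t. symmetry. apply Derive_mult; now apply smooth_ex_derive. }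
        apply ex_derive_n_plus; apply filter_forall; intros y j Hj;
          apply IH; auto using smooth_Derive; lia. }
  intros Hf Hg n. now apply (K n).
Qed.

Lemma smooth_trig (w : R) :
  smooth (fun x => cos (w * x)) /\ smooth (fun x => sin (w * x)).
Proof.
  assert (Dc : forall w x, is_derive (fun x => cos (w * x)) x (- w * sin (w * x))).
  { intros v x. auto_derive; [exact I | ring]. }
  assert (Ds : forall w x, is_derive (fun x => sin (w * x)) x (w * cos (w * x))).
  { intros v x. auto_derive; [exact I | ring]. }
  assert (K : forall n x, ex_derive_n (fun x => cos (w * x)) n x /\
                          ex_derive_n (fun x => sin (w * x)) n x).
  { induction n as [|n IH]; [now split|].
    intros x. split; revert x; apply ex_derive_n_S; intros x.
    - eexists; apply Dc.
    - apply (ex_derive_n_ext (fun x => - w * sin (w * x))).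
      { intros t. symmetry. apply is_derive_unique, Dc. }
      apply ex_derive_n_scal_l, IH.
    - eexists; apply Ds.
    - apply (ex_derive_n_ext (fun x => w * cos (w * x))).
      { intros t. symmetry. apply is_derive_unique, Ds. }
      apply ex_derive_n_scal_l, IH. }
  split; intros n x; apply K.
Qed.

Lemma periodic_Derive f : periodic f -> periodic (Derive f).
Proof.
  intros Hp x. unfold Derive. f_equal. apply Lim_ext. intros h.
  replace (x + 2 * PI + h) with (x + h + 2 * PI) by ring. now rewrite !Hp.
Qed.

(* C^oo(T; C). *)
Record test := mkTest {
  tfun :> R -> C;
  test_per : periodic tfun;
  test_re : smooth (fun x => Re (tfun x));
  test_im : smooth (fun x => Im (tfun x)) }.

Lemma test_ext (f g : test) : (forall x, f x = g x) -> f = g.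
Proof.
  destruct f as [f pf rf mf], g as [g pg rg mg]; simpl; intros E.
  apply functional_extensionality in E. subst g.
  f_equal; apply proof_irrelevance.
Qed.

(* C^oo(T; R). *)
Record rtest := mkRtest {
  rfun :> R -> R;
  rtest_per : periodic rfun;
  rtest_smooth : smooth rfun }.

Program Definition rsquare (a : rtest) : test := {| tfun := fun x => RtoC (a x ^ 2) |}.
Next Obligation. intros a x. now rewrite rtest_per. Qed.
Next Obligation.
  intros a.
  exact (smooth_mult _ _ (rtest_smooth a) (smooth_mult _ _ (rtest_smooth a) (smooth_const 1))).
Qed.
Next Obligation. intros a. exact (smooth_const 0). Qed.

Program Definition tadd (f g : test) : test := {| tfun := fun x => (f x + g x)%C |}.
Next Obligation. intros f g x. now rewrite !test_per. Qed.
Next Obligation. intros f g. exact (smooth_plus _ _ (test_re f) (test_re g)). Qed.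
Next Obligation. intros f g. exact (smooth_plus _ _ (test_im f) (test_im g)). Qed.

Program Definition tmul (f g : test) : test := {| tfun := fun x => (f x * g x)%C |}.
Next Obligation. intros f g x. now rewrite !test_per. Qed.
Next Obligation.
  intros f g.
  exact (smooth_minus _ _ (smooth_mult _ _ (test_re f) (test_re g))
                          (smooth_mult _ _ (test_im f) (test_im g))).
Qed.
Next Obligation.
  intros f g.
  exact (smooth_plus _ _ (smooth_mult _ _ (test_re f) (test_im g))
                         (smooth_mult _ _ (test_im f) (test_re g))).
Qed.

Program Definition tconst (c : C) : test := {| tfun := fun _ => c |}.
Next Obligation. intros c x. reflexivity. Qed.
Next Obligation. intros c. exact (smooth_const (Re c)). Qed.
Next Obligation. intros c. exact (smooth_const (Im c)). Qed.

Program Definition tderiv (f : test) : test :=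
  {| tfun := fun x => (Derive (fun y => Re (f y)) x, Derive (fun y => Im (f y)) x) |}.
Next Obligation.
  intros f x. f_equal; apply periodic_Derive; intros y; now rewrite test_per.
Qed.
Next Obligation. intros f. exact (smooth_Derive _ (test_re f)). Qed.
Next Obligation. intros f. exact (smooth_Derive _ (test_im f)). Qed.

(* x |-> e^{ikx} *)
Program Definition expi (k : Z) : test :=
  {| tfun := fun x => (cos (IZR k * x), sin (IZR k * x)) |}.
Next Obligation.
  assert (P : forall n y, cos (y + 2 * INR n * PI) = cos y /\
                          sin (y + 2 * INR n * PI) = sin y).
  { intros n y. split; [apply cos_period | apply sin_period]. }
  intros k x. destruct (Z_le_dec 0 k) as [Hk|Hk].
  - replace (IZR k * (x + 2 * PI)) with (IZR k * x + 2 * INR (Z.to_nat k) * PI)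
      by (rewrite INR_IZR_INZ, Z2Nat.id by lia; ring).
    f_equal; apply P.
  - replace (IZR k * x) with (IZR k * (x + 2 * PI) + 2 * INR (Z.to_nat (- k)) * PI)
      by (rewrite INR_IZR_INZ, Z2Nat.id, opp_IZR by lia; ring).
    f_equal; symmetry; apply P.
Qed.
Next Obligation. intros k. exact (proj1 (smooth_trig (IZR k))). Qed.
Next Obligation. intros k. exact (proj2 (smooth_trig (IZR k))). Qed.

Lemma tderiv_add f g : tderiv (tadd f g) = tadd (tderiv f) (tderiv g).
Proof.
  apply test_ext. intros x. apply injective_projections; simpl.
  - exact (Derive_plus _ _ x (smooth_ex_derive _ (test_re f) x)
                             (smooth_ex_derive _ (test_re g) x)).
  - exact (Derive_plus _ _ x (smooth_ex_derive _ (test_im f) x)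
                             (smooth_ex_derive _ (test_im g) x)).
Qed.

Lemma tderiv_mul f g :
  tderiv (tmul f g) = tadd (tmul (tderiv f) g) (tmul f (tderiv g)).
Proof.
  assert (E1 : forall F G H K x, smooth F -> smooth G -> smooth H -> smooth K ->
    Derive (fun y => F y * G y - H y * K y) x =
    Derive F x * G x - Derive H x * K x + (F x * Derive G x - H x * Derive K x)).
  { intros F G H K x HF HG HH HK.
    rewrite Derive_minus by (apply smooth_ex_derive, smooth_mult; assumption).
    rewrite !Derive_mult by (now apply smooth_ex_derive). ring. }
  assert (E2 : forall F G H K x, smooth F -> smooth G -> smooth H -> smooth K ->
    Derive (fun y => F y * G y + H y * K y) x =
    Derive F x * G x + Derive H x * K x + (F x * Derive G x + H x * Derive K x)).
  { intros F G H K x HF HG HH HK.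
    rewrite Derive_plus by (apply smooth_ex_derive, smooth_mult; assumption).
    rewrite !Derive_mult by (now apply smooth_ex_derive). ring. }
  apply test_ext. intros x. apply injective_projections.
  - exact (E1 _ _ _ _ x (test_re f) (test_re g) (test_im f) (test_im g)).
  - exact (E2 _ _ _ _ x (test_re f) (test_im g) (test_im f) (test_re g)).
Qed.

Lemma tderiv_const c : tderiv (tconst c) = tconst 0.
Proof. apply test_ext. intros x. apply injective_projections; simpl; apply Derive_const. Qed.

Lemma periodic_bounded (g : R -> R) :
  periodic g -> (forall x, ex_derive g x) -> exists K, forall x, Rabs (g x) <= K.
Proof.
  intros Hp Hd.
  assert (Hn : forall n x, g (x + 2 * PI * INR n) = g x).
  { induction n as [|n IH]; intros x; [f_equal; simpl; ring|].
    rewrite S_INR. replace (x + 2 * PI * (INR n + 1)) with (x + 2 * PI * INR n + 2 * PI)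
      by ring. now rewrite Hp. }
  assert (HI : forall x, exists y, 0 <= y <= 2 * PI /\ g x = g y).
  { intros x. pose proof PI_RGT_0 as Hpi.
    destruct (archimed (x / (2 * PI))) as [H1 H2].
    set (k := (up (x / (2 * PI)) - 1)%Z).
    assert (Hk : IZR k = IZR (up (x / (2 * PI))) - 1) by apply minus_IZR.
    assert (Hx : x = 2 * PI * (x / (2 * PI))) by (field; lra).
    exists (x - 2 * PI * IZR k). split.
    - rewrite Hk. split; nra.
    - destruct (Z_le_dec 0 k) as [Hk0|Hk0].
      + rewrite <- (Hn (Z.to_nat k) (x - _)). f_equal.
        rewrite INR_IZR_INZ, Z2Nat.id by lia. ring.
      + rewrite <- (Hn (Z.to_nat (- k)) x). f_equal.
        rewrite INR_IZR_INZ, Z2Nat.id, opp_IZR by lia. ring. }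
  destruct (continuity_ab_maj (fun x => Rabs (g x)) 0 (2 * PI)) as [M [HM _]].
  - pose proof PI_RGT_0; lra.
  - intros c _. apply continuity_pt_filterlim.
    apply (continuous_comp g Rabs); [apply (ex_derive_continuous g), Hd | apply continuous_Rabs].
  - exists (Rabs (g M)). intros x. destruct (HI x) as [y [Hy ->]]. now apply HM.
Qed.

Lemma test_bounded (f : test) : exists K, 0 <= K /\ forall x, Cmod (f x) <= K.
Proof.
  destruct (periodic_bounded (fun x => Re (f x))) as [K HK].
  { intros x. now rewrite test_per. }
  { apply smooth_ex_derive, test_re. }
  destruct (periodic_bounded (fun x => Im (f x))) as [L HL].
  { intros x. now rewrite test_per. }
  { apply smooth_ex_derive, test_im. }
  assert (B : forall x, Cmod (f x) <= K + L).
  { intros x. rewrite (surjective_pairing (f x)).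
    replace (fst (f x), snd (f x)) with (RtoC (Re (f x)) + Ci * RtoC (Im (f x)))%C
      by (apply injective_projections; simpl; unfold Re, Im; ring).
    eapply Rle_trans; [apply Cmod_triangle|].
    rewrite Cmod_mult, Cmod_Ci, !Cmod_R, Rmult_1_l.
    apply Rplus_le_compat; auto. }
  exists (K + L). split; [|exact B].
  eapply Rle_trans; [apply Cmod_ge_0 | exact (B 0)].
Qed.

(* The seminorms max_{j <= m} sup |f^(j)| define the topology of C^oo(T; C). *)
Definition tbound (m : nat) (f : test) (B : R) : Prop :=
  forall j x, (j <= m)%nat -> Cmod (Nat.iter j tderiv f x) <= B.

Lemma tbound_deriv m f B : tbound (S m) f B -> tbound m (tderiv f) B.
Proof.
  intros H j x Hj. rewrite <- Nat.iter_succ_r. apply H. lia.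
Qed.

Lemma iter_tderiv_add j f g :
  Nat.iter j tderiv (tadd f g) = tadd (Nat.iter j tderiv f) (Nat.iter j tderiv g).
Proof. induction j as [|j IH]; simpl; [easy|]. now rewrite IH, tderiv_add. Qed.

Lemma tbound_mul m : forall a : test, exists K, 0 <= K /\
  forall f B, tbound m f B -> tbound m (tmul a f) (K * B).
Proof.
  assert (P : forall j (a : test), exists K, 0 <= K /\ forall f B x,
    tbound j f B -> Cmod (Nat.iter j tderiv (tmul a f) x) <= K * B).
  { induction j as [|j IH]; intros a.
    - destruct (test_bounded a) as [K [HK H]]. exists K. split; [exact HK|].
      intros f B x Hf. simpl. rewrite Cmod_mult.
      apply Rmult_le_compat; auto using Cmod_ge_0. exact (Hf 0%nat x (le_n _)).
    - destruct (IH a) as [K [HK H]]. destruct (IH (tderiv a)) as [L [HL H']].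
      exists (L + K). split; [lra|]. intros f B x Hf.
      rewrite Nat.iter_succ_r, tderiv_mul, iter_tderiv_add. simpl.
      rewrite Rmult_plus_distr_r. eapply Rle_trans; [apply Cmod_triangle|].
      apply Rplus_le_compat.
      + apply H'. intros i y Hi. apply Hf. lia.
      + apply H. now apply tbound_deriv. }
  intros a. induction m as [|m [K [HK IH]]].
  - destruct (P 0%nat a) as [K [HK H]]. exists K. split; [exact HK|].
    intros f B Hf j x Hj. replace j with 0%nat by lia. now apply H.
  - destruct (P (S m) a) as [L [HL H]]. exists (K + L). split; [lra|].
    intros f B Hf j x Hj.
    assert (HB : 0 <= B).
    { eapply Rle_trans; [apply Cmod_ge_0 | apply (Hf 0%nat 0); lia]. }
    destruct (Nat.eq_dec j (S m)) as [->|Hne].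
    + eapply Rle_trans; [exact (H f B x Hf) | nra].
    + apply Rle_trans with (K * B); [|nra]. apply IH; [|lia].
      intros i y Hi. apply Hf. lia.
Qed.

(* D'(T): continuous C-linear forms on C^oo(T; C). A locally integrable function v
   is the form f |-> int_T v f. *)
Record distr := mkDistr {
  pair :> test -> C;
  pair_add : forall f g, pair (tadd f g) = (pair f + pair g)%C;
  pair_scal : forall c f, pair (tmul (tconst c) f) = (c * pair f)%C;
  pair_cont : exists m M, 0 <= M /\
    forall f B, tbound m f B -> Cmod (pair f) <= M * B }.

Program Definition dadd (v w : distr) : distr := {| pair := fun f => (v f + w f)%C |}.
Next Obligation. intros v w f g. simpl. rewrite !pair_add. ring. Qed.
Next Obligation. intros v w c f. simpl. rewrite !pair_scal. ring. Qed.
Next Obligation.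
  intros v w. destruct (pair_cont v) as [m [M [HM H]]].
  destruct (pair_cont w) as [n [N [HN H']]].
  exists (m + n)%nat, (M + N). split; [lra|]. intros f B Hf. simpl.
  eapply Rle_trans; [apply Cmod_triangle|]. rewrite Rmult_plus_distr_r.
  apply Rplus_le_compat; [apply H | apply H']; intros j x Hj; apply Hf; lia.
Qed.

Program Definition dscal (c : C) (v : distr) : distr := {| pair := fun f => (c * v f)%C |}.
Next Obligation. intros c v f g. simpl. rewrite !pair_add. ring. Qed.
Next Obligation. intros c v d f. simpl. rewrite !pair_scal. ring. Qed.
Next Obligation.
  intros c v. destruct (pair_cont v) as [m [M [HM H]]].
  exists m, (Cmod c * M). split; [apply Rmult_le_pos; auto using Cmod_ge_0|].
  intros f B Hf. simpl. rewrite Cmod_mult, Rmult_assoc.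
  apply Rmult_le_compat_l; auto using Cmod_ge_0.
Qed.

Definition dsub (v w : distr) : distr := dadd v (dscal (-1) w).

Program Definition dmul (a : test) (v : distr) : distr :=
  {| pair := fun f => v (tmul a f) |}.
Next Obligation.
  intros a v f g. simpl. rewrite <- pair_add. f_equal.
  apply test_ext. intros x. simpl. ring.
Qed.
Next Obligation.
  intros a v c f. simpl. rewrite <- pair_scal. f_equal.
  apply test_ext. intros x. simpl. ring.
Qed.
Next Obligation.
  intros a v. destruct (pair_cont v) as [m [M [HM H]]].
  destruct (tbound_mul m a) as [K [HK HK']]. exists m, (M * K).
  split; [nra|]. intros f B Hf. simpl. rewrite Rmult_assoc. auto.
Qed.

Program Definition dderiv (v : distr) : distr :=
  {| pair := fun f => (- v (tderiv f))%C |}.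
Next Obligation. intros v f g. simpl. rewrite tderiv_add, pair_add. ring. Qed.
Next Obligation.
  intros v c f. simpl. rewrite tderiv_mul, tderiv_const, pair_add, !pair_scal. ring.
Qed.
Next Obligation.
  intros v. destruct (pair_cont v) as [m [M [HM H]]].
  exists (S m), M. split; [exact HM|]. intros f B Hf. simpl.
  rewrite Cmod_opp. now apply H, tbound_deriv.
Qed.

Definition fourier (v : distr) (k : Z) : C := (v (expi (- k)) / RtoC (2 * PI))%C.

(* The distribution with Fourier coefficients s(k) v^(k). A distribution is determined
   by its Fourier coefficients, and this one exists if s has polynomial growth. *)
Definition multiplier (s : Z -> C) (v : distr) : distr :=
  epsilon (inhabits v) (fun w => forall k, fourier w k = (s k * fourier v k)%C).

(* Sums over Z, used for absolutely convergent series only. *)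
Definition fold_Z (f : Z -> R) (n : nat) : R :=
  f (Z.of_nat (S n)) + f (- Z.of_nat (S n))%Z.
Definition ex_Zseries (f : Z -> R) : Prop := ex_series (fold_Z f).
Definition Zseries (f : Z -> R) : R := f 0%Z + Series (fold_Z f).
Definition CZseries (f : Z -> C) : C :=
  (Zseries (fun k => Re (f k)), Zseries (fun k => Im (f k))).

Definition bracket (k : Z) : R := sqrt (1 + IZR k ^ 2).

(* v belongs to H^s(T); L^2(T) is H^0(T). *)
Definition Sobolev (s : R) (v : distr) : Prop :=
  ex_Zseries (fun k => Rpower (bracket k) (2 * s) * Cmod (fourier v k) ^ 2).

Definition m_ (beta : R) (k : Z) : R := tanh (beta * IZR k) / beta.

Definition p_ (beta : R) (k : Z) : R :=
  if Z.eq_dec k 0 then 1 else tanh (beta * IZR k) / (beta * IZR k).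

Definition Top (beta : R) : distr -> distr :=
  multiplier (fun k => - (Ci * RtoC (m_ beta k)))%C.

Definition Pop (beta : R) : distr -> distr := multiplier (fun k => RtoC (p_ beta k)).

Definition state : Type := distr * distr.

Definition sscal (c : C) (x : state) : state := (dscal c (fst x), dscal c (snd x)).
Definition ssub (x y : state) : state := (dsub (fst x) (fst y), dsub (snd x) (snd y)).

(* The energy space L^2(T) x H^{-1/2}(T). *)
Definition energy (x : state) : Prop :=
  Sobolev 0 (fst x) /\ Sobolev (- (1 / 2)) (snd x).

Definition energy_inner (beta : R) (x y : state) : C :=
  (RtoC (2 * PI) * CZseries (fun k => fourier (fst x) k * Cconj (fourier (fst y) k))
   + RtoC (2 * PI) * CZseries (fun k =>
       RtoC (p_ beta k) * (fourier (snd x) k * Cconj (fourier (snd y) k))))%C.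

Definition energy_norm (beta : R) (x : state) : R := sqrt (Re (energy_inner beta x x)).

Definition Ad_dom (x : state) : Prop := Sobolev (1 / 2) (fst x) /\ Sobolev 0 (snd x).

Definition Ad (beta : R) (a b : rtest) (x : state) : state :=
  let (h, u) := x in
  (dsub (Top beta u) (dmul (rsquare a) h),
   dsub (dscal (-1) (dderiv h)) (dmul (rsquare b) (Pop beta u))).

(* Rz is a bounded operator on the energy space inverting z I - A : dom -> energy;
   its linearity follows from that of A. *)
Definition is_resolvent (beta : R) (dom : state -> Prop) (A : state -> state)
    (z : C) (Rz : state -> state) : Prop :=
  (forall y, energy y -> dom (Rz y) /\ ssub (sscal z (Rz y)) (A (Rz y)) = y) /\
  (forall x, dom x -> energy (ssub (sscal z x) (A x)) /\
                      Rz (ssub (sscal z x) (A x)) = x) /\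
  (exists M, forall y, energy y -> energy_norm beta (Rz y) <= M * energy_norm beta y).

(* (z I - A)^{-1}; unspecified if z is not in the resolvent set of A. *)
Definition resolvent (beta : R) (dom : state -> Prop) (A : state -> state) (z : C) :
    state -> state :=
  epsilon (inhabits (fun y => y)) (is_resolvent beta dom A z).

Definition op_norm (beta : R) (Rz : state -> state) : Rbar :=
  Lub_Rbar (fun r => exists y, energy y /\ energy_norm beta y <= 1 /\
                               r = energy_norm beta (Rz y)).

(* The norm of (i tau I - A_d)^{-1} in L(H). *)
Definition res_norm (beta : R) (a b : rtest) (tau : R) : Rbar :=
  op_norm beta (resolvent beta Ad_dom (Ad beta a b) (Ci * RtoC tau)%C).

Definition omega (beta : R) (N : nat) : R := sqrt (INR N * tanh (beta * INR N) / beta).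

Definition supp (a : R -> R) : R -> Prop := adherence (fun x => a x <> 0).

(* A nonempty open subset O of T whose closure is a compact subset of the complement
   of supp a; the closure of O is compact because T is. *)
Definition open_off_supp (a : R -> R) (O : R -> Prop) : Prop :=
  (forall x, O (x + 2 * PI) <-> O x) /\ open_set O /\ (exists x, O x) /\
  (forall x, adherence O x -> ~ supp a x).

(* Main.v *)
Require Import Defs.
From Stdlib Require Import Reals ZArith Lra Lia.
From Stdlib Require Import ClassicalEpsilon FunctionalExtensionality ProofIrrelevance.
From Coquelicot Require Import Coquelicot.
Open Scope R_scope.

(** Two facts together give the lower bound: for large [N] the point [i omega_N] lies in the
    resolvent set of [A_d], and there [i omega_N - A_d] maps some state of norm at least
    [c sqrt N] to a state of norm at most one.

    The second fact ([quasimodes]) comes from waves that do not meet the support of [a]. Let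
    [chi] be a bump in [O] and put [h = chi e^{iNx}], [u = - (N / omega_N) h]. Then
    [a^2 h = 0]. Since [omega_N^2 = N m_N], the pair solves the undamped equation
    up to terms that contain [m_k - m_N] or [k - N] at the frequencies [k] of the wave, which are
    concentrated near [N] ([m_slow], [p_slow]). The damping of [u] is weak because [b^2 P_beta u]
    gains one derivative. All the errors are [O(N^{-1/2})] in the energy space, whereas the norm
    of [h] does not depend on [N].

    For the first fact ([resolvent_exists]) put [v = sqrt p u] on the Fourier side, so that the
    energy norm becomes an [l2] norm and the undamped generator becomes, at frequency [k], the
    skew matrix with off-diagonal entries [- i sigma_k], where
    [sigma_k = sign k sqrt (k tanh (beta k) / beta)] is increasing in [k]. A rotation diagonalises it.
    Hence [i omega_N - A_d] is [i D + B] with [D] real diagonal, with only two vanishing entries and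
    the other ones bounded away from zero, and with [B] bounded and dissipative, in the sense
    that [|Bx|^2 <= K <Bx, x>]. The kernel of [D] consists of the frequencies [N] and [- N]; there
    [B] is positive as soon as [(a^2)^(2N)] is small against the mean of [a^2], by the
    Riemann-Lebesgue lemma. Testing against [(1 + i theta sgn D) x] turns [i D + B] into a coercive
    form on a weighted [l2] space, and the Lax-Milgram lemma inverts it
    ([damped_diagonal_solvable]). No compactness is involved.

    The passage between distributions and sequences rests on two facts: a distribution is
    determined by its Fourier coefficients ([distr_ext]), which follows from the convergence of
    Fourier series in the smooth topology, and every sequence of polynomial growth is
    the sequence of coefficients of a distribution ([distr_exists]). *)

(** * Symmetric sums over the integers *)

(** [Zseries] is the limit of the sums over the windows [-n, n]. *)
Fixpoint W (f : Z -> R) (n : nat) : R :=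
  match n with
  | O => f 0%Z
  | S n' => W f n' + (f (Z.of_nat n) + f (- Z.of_nat n)%Z)
  end.

Lemma W_ext_in f g n :
  (forall k, (Z.abs k <= Z.of_nat n)%Z -> f k = g k) -> W f n = W g n.
Proof.
  induction n as [|n IH]; intros H; cbn [W]; [apply H; lia|].
  rewrite IH, !H; try reflexivity; try lia. intros k Hk. apply H. lia.
Qed.

Lemma W_ext f g n : (forall k, f k = g k) -> W f n = W g n.
Proof. intros H. apply W_ext_in. auto. Qed.

Lemma W_plus f g n : W (fun k => f k + g k) n = W f n + W g n.
Proof. induction n as [|n IH]; cbn [W]; [reflexivity|]. rewrite IH. ring. Qed.

Lemma W_scal c f n : W (fun k => c * f k) n = c * W f n.
Proof. induction n as [|n IH]; cbn [W]; [reflexivity|]. rewrite IH. ring. Qed.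

Lemma W_le f g n : (forall k, f k <= g k) -> W f n <= W g n.
Proof.
  intros H. induction n as [|n IH]; cbn [W]; [apply H|].
  pose proof (H (Z.of_nat (S n))); pose proof (H (- Z.of_nat (S n))%Z). lra.
Qed.

Lemma W_pos f n : (forall k, 0 <= f k) -> 0 <= W f n.
Proof.
  intros H. induction n as [|n IH]; cbn [W]; [apply H|].
  pose proof (H (Z.of_nat (S n))); pose proof (H (- Z.of_nat (S n))%Z). lra.
Qed.

Lemma W_mono f n m : (forall k, 0 <= f k) -> (n <= m)%nat -> W f n <= W f m.
Proof.
  intros H Hm. induction Hm as [|m Hm IH]; [apply Rle_refl|]. cbn [W].
  pose proof (H (Z.of_nat (S m))); pose proof (H (- Z.of_nat (S m))%Z). lra.
Qed.

Lemma W_term f n k : (forall k, 0 <= f k) -> (Z.abs k <= Z.of_nat n)%Z -> f k <= W f n.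
Proof.
  intros H. induction n as [|n IH]; intros Hk; cbn [W].
  - replace k with 0%Z by lia. apply Rle_refl.
  - pose proof (H (Z.of_nat (S n))) as H1; pose proof (H (- Z.of_nat (S n))%Z) as H2.
    destruct (Z_le_dec (Z.abs k) (Z.of_nat n)) as [L|L]; [specialize (IH L); lra|].
    pose proof (W_pos f n H) as H3.
    destruct (Z.abs_eq_or_opp k) as [E|E];
      [replace k with (Z.of_nat (S n)) by lia | replace k with (- Z.of_nat (S n))%Z by lia]; lra.
Qed.

Lemma W_flip f n : W (fun k => f (- k)%Z) n = W f n.
Proof.
  induction n as [|n IH]; cbn [W]; [reflexivity|].
  rewrite IH, Z.opp_involutive. f_equal. apply Rplus_comm.
Qed.

Lemma W_fold f n : W f (S n) = f 0%Z + sum_n (fold_Z f) n.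
Proof.
  induction n as [|n IH].
  - rewrite sum_O. reflexivity.
  - rewrite sum_Sn. change (W f (S (S n))) with
      (W f (S n) + (f (Z.of_nat (S (S n))) + f (- Z.of_nat (S (S n)))%Z)).
    rewrite IH. unfold fold_Z. apply Rplus_assoc.
Qed.

Lemma is_lim_W f : ex_Zseries f -> is_lim_seq (W f) (Zseries f).
Proof.
  intros H. apply is_lim_seq_incr_1.
  apply is_lim_seq_ext with (fun n => f 0%Z + sum_n (fold_Z f) n).
  { intros n. now rewrite W_fold. }
  apply (is_lim_seq_plus' (fun _ => f 0%Z)); [apply is_lim_seq_const|].
  exact (Series_correct _ H).
Qed.

Lemma is_lim_W_ex f (l : R) : is_lim_seq (W f) l -> ex_Zseries f.
Proof.
  intros H. exists (l - f 0%Z). apply is_lim_seq_incr_1 in H.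
  change (is_lim_seq (sum_n (fold_Z f)) (l - f 0%Z)).
  apply is_lim_seq_ext with (fun n => W f (S n) - f 0%Z).
  { intros n. rewrite W_fold. ring. }
  apply is_lim_seq_minus'; [exact H|apply is_lim_seq_const].
Qed.

Lemma Zseries_unique f (l : R) : is_lim_seq (W f) l -> Zseries f = l.
Proof.
  intros H. pose proof (is_lim_W f (is_lim_W_ex f l H)) as H'.
  apply is_lim_seq_unique in H. apply is_lim_seq_unique in H'.
  rewrite H in H'. now injection H'.
Qed.

Lemma Zseries_ext f g : (forall k, f k = g k) -> Zseries f = Zseries g.
Proof.
  intros H. replace g with f; [reflexivity|]. now apply functional_extensionality.
Qed.

Lemma ex_Zseries_ext f g : (forall k, f k = g k) -> ex_Zseries f -> ex_Zseries g.
Proof.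
  intros H. replace g with f; [easy|]. now apply functional_extensionality.
Qed.

Lemma ex_Zseries_bound f M : (forall k, 0 <= f k) -> (forall n, W f n <= M) -> ex_Zseries f.
Proof.
  intros H HM. destruct (ex_finite_lim_seq_incr (W f) M) as [l Hl].
  - intros n. apply W_mono; [exact H|lia].
  - exact HM.
  - now apply is_lim_W_ex with l.
Qed.

Lemma W_le_Zseries f n : (forall k, 0 <= f k) -> ex_Zseries f -> W f n <= Zseries f.
Proof.
  intros H He.
  apply (is_lim_seq_incr_compare (W f)); [now apply is_lim_W|].
  intros m. apply W_mono; [exact H|lia].
Qed.

Lemma Zseries_le_bound f M : ex_Zseries f -> (forall n, W f n <= M) -> Zseries f <= M.
Proof.
  intros He HM.
  exact (is_lim_seq_le (W f) (fun _ => M) (Zseries f) M HM (is_lim_W f He) (is_lim_seq_const M)).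
Qed.

Lemma Zseries_pos f : (forall k, 0 <= f k) -> ex_Zseries f -> 0 <= Zseries f.
Proof.
  intros H He. apply Rle_trans with (W f 0); [now apply W_pos|]. now apply W_le_Zseries.
Qed.

Lemma Zseries_term f k : (forall k, 0 <= f k) -> ex_Zseries f -> f k <= Zseries f.
Proof.
  intros H He. apply Rle_trans with (W f (Z.abs_nat k)); [|now apply W_le_Zseries].
  apply W_term; [exact H|lia].
Qed.

Lemma ex_Zseries_plus f g :
  ex_Zseries f -> ex_Zseries g -> ex_Zseries (fun k => f k + g k).
Proof.
  intros Hf Hg. apply is_lim_W_ex with (Zseries f + Zseries g).
  apply is_lim_seq_ext with (fun n => W f n + W g n); [intros n; now rewrite W_plus|].
  apply is_lim_seq_plus'; now apply is_lim_W.
Qed.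

Lemma Zseries_plus f g :
  ex_Zseries f -> ex_Zseries g -> Zseries (fun k => f k + g k) = Zseries f + Zseries g.
Proof.
  intros Hf Hg. apply Zseries_unique.
  apply is_lim_seq_ext with (fun n => W f n + W g n); [intros n; now rewrite W_plus|].
  apply is_lim_seq_plus'; now apply is_lim_W.
Qed.

Lemma ex_Zseries_scal c f : ex_Zseries f -> ex_Zseries (fun k => c * f k).
Proof.
  intros Hf. apply is_lim_W_ex with (c * Zseries f).
  apply is_lim_seq_ext with (fun n => c * W f n); [intros n; now rewrite W_scal|].
  apply (is_lim_seq_scal_l (W f) c (Zseries f)); now apply is_lim_W.
Qed.

Lemma Zseries_scal c f : ex_Zseries f -> Zseries (fun k => c * f k) = c * Zseries f.
Proof.
  intros Hf. apply Zseries_unique.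
  apply is_lim_seq_ext with (fun n => c * W f n); [intros n; now rewrite W_scal|].
  apply (is_lim_seq_scal_l (W f) c (Zseries f)); now apply is_lim_W.
Qed.

Lemma ex_Zseries_le f g :
  (forall k, Rabs (f k) <= g k) -> ex_Zseries g -> ex_Zseries f.
Proof.
  intros H Hg. apply (@ex_series_le R_AbsRing R_CompleteNormedModule (fold_Z f) (fold_Z g)); [|exact Hg].
  intros n. unfold fold_Z. eapply Rle_trans; [apply Rabs_triang|].
  apply Rplus_le_compat; apply H.
Qed.

Lemma Zseries_le f g :
  (forall k, f k <= g k) -> ex_Zseries f -> ex_Zseries g -> Zseries f <= Zseries g.
Proof.
  intros H Hf Hg.
  exact (is_lim_seq_le (W f) (W g) (Zseries f) (Zseries g)
           (fun n => W_le f g n H) (is_lim_W f Hf) (is_lim_W g Hg)).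
Qed.

(** The bound [1/j^2 <= 1/(j-1) - 1/j] makes the tail telescope. *)
Lemma W_inv_square_tail n m :
  W (fun k => / (1 + Rabs (IZR k)) ^ 2) (n + m) - W (fun k => / (1 + Rabs (IZR k)) ^ 2) n
  <= 2 / (INR n + 1).
Proof.
  assert (H : W (fun k => / (1 + Rabs (IZR k)) ^ 2) (n + m)
    - W (fun k => / (1 + Rabs (IZR k)) ^ 2) n <= 2 / (INR n + 1) - 2 / (INR (n + m) + 1)).
  { induction m as [|m IH].
    - rewrite Nat.add_0_r. lra.
    - rewrite Nat.add_succ_r. cbn [W].
      rewrite opp_IZR, Rabs_Ropp, <- INR_IZR_INZ, (Rabs_pos_eq (INR _)) by apply pos_INR.
      rewrite S_INR. pose proof (pos_INR (n + m)) as Hp. set (t := INR (n + m)) in *.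
      assert (K : / (1 + (t + 1)) ^ 2 <= / (t + 1) - / (t + 1 + 1)).
      { replace (/ (t + 1) - / (t + 1 + 1)) with (/ ((t + 1) * (t + 2))) by (field; lra).
        apply Rinv_le_contravar; nra. }
      unfold Rdiv in *. lra. }
  pose proof (pos_INR (n + m)) as Hp.
  assert (0 <= 2 / (INR (n + m) + 1)) by (apply Rdiv_le_0_compat; lra).
  lra.
Qed.

Lemma ex_Zseries_inv_square : ex_Zseries (fun k => / (1 + Rabs (IZR k)) ^ 2).
Proof.
  assert (P : forall k : Z, 0 < 1 + Rabs (IZR k)).
  { intros k. pose proof (Rabs_pos (IZR k)). lra. }
  apply ex_Zseries_bound with 3.
  - intros k. left. apply Rinv_0_lt_compat, pow_lt, P.
  - intros n. pose proof (W_inv_square_tail 0 n) as H. rewrite Nat.add_0_l in H.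
    change (W (fun k => / (1 + Rabs (IZR k)) ^ 2) 0) with (/ (1 + Rabs 0) ^ 2) in H.
    rewrite Rabs_R0 in H. change (INR 0) with 0 in H.
    replace (/ (1 + 0) ^ 2) with 1 in H by field. lra.
Qed.

(** * Complex sequences and sums *)

Definition Clim (u : nat -> C) (l : C) : Prop :=
  is_lim_seq (fun n => Re (u n)) (Re l) /\ is_lim_seq (fun n => Im (u n)) (Im l).

Definition CW (f : Z -> C) (n : nat) : C :=
  (W (fun k => Re (f k)) n, W (fun k => Im (f k)) n).

Lemma Ceq (z w : C) : Re z = Re w -> Im z = Im w -> z = w.
Proof. intros H1 H2. now apply injective_projections. Qed.


Lemma im_le_Cmod (z : C) : Rabs (Im z) <= Cmod z.
Proof. eapply Rle_trans; [apply Rmax_r|apply (Rmax_Cmod z)]. Qed.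

Lemma Clim_ext u v l : (forall n, u n = v n) -> Clim u l -> Clim v l.
Proof.
  intros H. replace v with u; [easy|]. now apply functional_extensionality.
Qed.

Lemma Clim_unique u l l' : Clim u l -> Clim u l' -> l = l'.
Proof.
  intros [H1 H2] [H3 H4]. apply is_lim_seq_unique in H1, H2, H3, H4.
  apply Ceq; congruence.
Qed.

Lemma Clim_const c : Clim (fun _ => c) c.
Proof. split; apply is_lim_seq_const. Qed.

Lemma Clim_plus u v l l' : Clim u l -> Clim v l' -> Clim (fun n => u n + v n)%C (l + l')%C.
Proof. intros [H1 H2] [H3 H4]. split; simpl; now apply is_lim_seq_plus'. Qed.

Lemma Clim_scal c u l : Clim u l -> Clim (fun n => c * u n)%C (c * l)%C.
Proof.
  intros [H1 H2]. split; simpl; [apply is_lim_seq_minus' | apply is_lim_seq_plus'].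
  - exact (is_lim_seq_scal_l _ (fst c) (Re l) H1).
  - exact (is_lim_seq_scal_l _ (snd c) (Im l) H2).
  - exact (is_lim_seq_scal_l _ (fst c) (Im l) H2).
  - exact (is_lim_seq_scal_l _ (snd c) (Re l) H1).
Qed.

Lemma Clim_Cmod2 u l :
  Clim u l -> is_lim_seq (fun n => Cmod (u n) ^ 2) (Cmod l ^ 2).
Proof.
  intros [H1 H2].
  apply is_lim_seq_ext with (fun n => Re (u n) * Re (u n) + Im (u n) * Im (u n)).
  { intros n. rewrite Cmod2_alt. ring. }
  rewrite Cmod2_alt.
  replace (Re l ^ 2 + Im l ^ 2) with (Re l * Re l + Im l * Im l) by ring.
  apply is_lim_seq_plus'; now apply is_lim_seq_mult'.
Qed.

Lemma Clim_le u l M : Clim u l -> (forall n, Cmod (u n) <= M) -> Cmod l <= M.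
Proof.
  intros H HM.
  assert (HM0 : 0 <= M) by (eapply Rle_trans; [apply Cmod_ge_0|apply (HM 0%nat)]).
  apply Rsqr_incr_0_var; [|exact HM0]. rewrite !Rsqr_pow2.
  refine (is_lim_seq_le (fun n => Cmod (u n) ^ 2) (fun _ => M ^ 2) (Cmod l ^ 2) (M ^ 2)
           _ (Clim_Cmod2 u l H) (is_lim_seq_const _)).
  intros n. apply pow_incr. split; [apply Cmod_ge_0|apply HM].
Qed.

Lemma Clim_of_close u l :
  (forall eps, 0 < eps -> exists N, forall n, (N <= n)%nat -> Cmod (u n - l)%C < eps) -> Clim u l.
Proof.
  intros H. split; apply is_lim_seq_spec; intros eps;
    destruct (H eps (cond_pos eps)) as [N HN]; exists N; intros n Hn;
    eapply Rle_lt_trans; try exact (HN n Hn).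
  - exact (re_le_Cmod (u n - l)%C).
  - exact (im_le_Cmod (u n - l)%C).
Qed.

Lemma Clim_of_dist u l (e : nat -> R) :
  (forall n, Cmod (u n - l)%C <= e n) -> is_lim_seq e 0 -> Clim u l.
Proof.
  intros H He. apply Clim_of_close. intros eps Heps. apply is_lim_seq_spec in He.
  destruct (He (mkposreal eps Heps)) as [N HN]. exists N. intros n Hn.
  apply Rle_lt_trans with (e n); [apply H|].
  specialize (HN n Hn). apply Rabs_def2 in HN. simpl in HN. lra.
Qed.

Lemma CW_S f n :
  CW f (S n) = (CW f n + (f (Z.of_nat (S n)) + f (- Z.of_nat (S n))%Z))%C.
Proof. apply Ceq; reflexivity. Qed.

Lemma CW_0 f : CW f 0 = f 0%Z.
Proof. now apply Ceq. Qed.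

Lemma CW_ext_in f g n :
  (forall k, (Z.abs k <= Z.of_nat n)%Z -> f k = g k) -> CW f n = CW g n.
Proof. intros H. unfold CW. f_equal; apply W_ext_in; intros k Hk; now rewrite H. Qed.

Lemma CW_ext f g n : (forall k, f k = g k) -> CW f n = CW g n.
Proof. intros H. apply CW_ext_in. auto. Qed.

Lemma CW_plus f g n : CW (fun k => f k + g k)%C n = (CW f n + CW g n)%C.
Proof. unfold CW. simpl. now rewrite !W_plus. Qed.

Lemma CW_scal c f n : CW (fun k => c * f k)%C n = (c * CW f n)%C.
Proof.
  induction n as [|n IH]; [now rewrite !CW_0|]. rewrite !CW_S, IH. ring.
Qed.

Lemma CW_flip f n : CW (fun k => f (- k)%Z) n = CW f n.
Proof.
  unfold CW. f_equal; [apply (W_flip (fun k => Re (f k)))|apply (W_flip (fun k => Im (f k)))].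
Qed.

Lemma CW_Cmod f n : Cmod (CW f n) <= W (fun k => Cmod (f k)) n.
Proof.
  induction n as [|n IH]; [rewrite CW_0; apply Rle_refl|]. rewrite CW_S. cbn [W].
  eapply Rle_trans; [apply Cmod_triangle|]. apply Rplus_le_compat; [exact IH|].
  apply Cmod_triangle.
Qed.

Lemma CW_Cmod_tail f n m :
  Cmod (CW f (n + m) - CW f n)%C <=
  W (fun k => Cmod (f k)) (n + m) - W (fun k => Cmod (f k)) n.
Proof.
  induction m as [|m IH].
  - rewrite Nat.add_0_r. replace (CW f n - CW f n)%C with (RtoC 0) by ring.
    rewrite Cmod_0. lra.
  - rewrite Nat.add_succ_r, CW_S. cbn [W].
    match goal with |- Cmod (?a + (?b + ?c) - ?d)%C <= _ =>
      replace (a + (b + c) - d)%C with ((a - d) + (b + c))%C by ring;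
      pose proof (Cmod_triangle (a - d)%C (b + c)%C); pose proof (Cmod_triangle b c) end.
    lra.
Qed.

Lemma Clim_CZseries f :
  ex_Zseries (fun k => Cmod (f k)) -> Clim (CW f) (CZseries f).
Proof.
  intros H. split; simpl; apply is_lim_W; apply ex_Zseries_le with (2 := H); intros k.
  - apply re_le_Cmod.
  - apply im_le_Cmod.
Qed.

Lemma W_tail_mono f g n m : (forall k, 0 <= f k <= g k) ->
  W f (n + m) - W f n <= W g (n + m) - W g n.
Proof.
  intros H. induction m as [|m IH]; [rewrite Nat.add_0_r; lra|].
  rewrite Nat.add_succ_r. cbn [W].
  pose proof (H (Z.of_nat (S (n + m)))); pose proof (H (- Z.of_nat (S (n + m)))%Z). lra.
Qed.

Lemma is_lim_inv_succ c : is_lim_seq (fun n => c / (INR n + 1)) 0.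
Proof.
  replace (Finite 0) with (Rbar_mult c 0) by (simpl; f_equal; ring).
  apply (is_lim_seq_scal_l (fun n => / (INR n + 1)) c 0).
  apply is_lim_seq_ext with (fun n => / INR (S n)).
  { intros n. now rewrite S_INR. }
  apply -> (is_lim_seq_incr_1 (fun n => / INR n)).
  apply is_lim_seq_inv with (l := p_infty); [apply is_lim_seq_INR|discriminate].
Qed.

(** The explicit tail of the dominating series gives a rate that does not depend on the phases of
    the terms; applied to Fourier series, it is uniform in the point. *)
Lemma CW_square_rate f l K :
  (forall k, Cmod (f k) <= K / (1 + Rabs (IZR k)) ^ 2) -> Clim (CW f) l ->
  forall n, Cmod (CW f n - l)%C <= 2 * K / (INR n + 1).
Proof.
  intros HK Hl n.
  assert (HK0 : 0 <= K).
  { eapply Rle_trans; [apply Cmod_ge_0|]. eapply Rle_trans; [apply (HK 0%Z)|].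
    rewrite Rabs_R0. right. field. }
  replace (Cmod (CW f n - l)%C) with (Cmod (l + - 1 * CW f n)%C)
    by (rewrite <- Cmod_opp; f_equal; ring).
  apply Clim_le with (fun m => CW f (n + m) + -1 * CW f n)%C.
  - apply Clim_plus; [|apply Clim_const]. destruct Hl as [H1 H2].
    split; [apply (is_lim_seq_incr_n (fun m => Re (CW f m)) n) in H1; revert H1
           |apply (is_lim_seq_incr_n (fun m => Im (CW f m)) n) in H2; revert H2];
      apply is_lim_seq_ext; intros m; now rewrite (Nat.add_comm m).
  - intros m. replace (CW f (n + m) + -1 * CW f n)%C with (CW f (n + m) - CW f n)%C by ring.
    eapply Rle_trans; [apply CW_Cmod_tail|].
    eapply Rle_trans; [apply (W_tail_mono _ (fun k => K * / (1 + Rabs (IZR k)) ^ 2))|].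
    { intros k. split; [apply Cmod_ge_0|apply HK]. }
    rewrite !W_scal, <- Rmult_minus_distr_l. pose proof (W_inv_square_tail n m).
    replace (2 * K / (INR n + 1)) with (K * (2 / (INR n + 1)))
      by (field; pose proof (pos_INR n); lra).
    now apply Rmult_le_compat_l.
Qed.

(** * Means over a period and Fourier coefficients *)

(** Only the closed period matters: the quotient in Chernoff's argument below is neither periodic
    nor continuous further out. *)
Definition rc (g : R -> R) : Prop := forall x, 0 <= x <= 2 * PI -> continuous g x.
Definition rmean (g : R -> R) : R := RInt g 0 (2 * PI) / (2 * PI).
Definition cc (f : R -> C) : Prop := rc (fun x => Re (f x)) /\ rc (fun x => Im (f x)).
Definition mean (f : R -> C) : C := (rmean (fun x => Re (f x)), rmean (fun x => Im (f x))).
Definition coef (f : R -> C) (k : Z) : C := mean (fun x => f x * expi (- k) x)%C.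

Lemma two_PI_pos : 0 < 2 * PI.
Proof. pose proof PI_RGT_0; lra. Qed.

Lemma rc_ex g : rc g -> ex_RInt g 0 (2 * PI).
Proof.
  intros H. apply (@ex_RInt_continuous R_CompleteNormedModule). intros x.
  rewrite Rmin_left, Rmax_right by (pose proof two_PI_pos; lra). apply H.
Qed.

Lemma rc_plus f g : rc f -> rc g -> rc (fun x => f x + g x).
Proof. intros Hf Hg x Hx. apply (continuous_plus f g); [now apply Hf|now apply Hg]. Qed.

Lemma rc_minus f g : rc f -> rc g -> rc (fun x => f x - g x).
Proof. intros Hf Hg x Hx. apply (continuous_minus f g); [now apply Hf|now apply Hg]. Qed.

Lemma rc_mult f g : rc f -> rc g -> rc (fun x => f x * g x).
Proof. intros Hf Hg x Hx. apply (continuous_mult f g); [now apply Hf|now apply Hg]. Qed.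

Lemma rc_const c : rc (fun _ => c).
Proof. intros x Hx. apply continuous_const. Qed.

Lemma rc_smooth f : smooth f -> rc f.
Proof. intros H x _. apply (ex_derive_continuous f). now apply smooth_ex_derive. Qed.

Lemma rmean_plus f g : rc f -> rc g -> rmean (fun x => f x + g x) = rmean f + rmean g.
Proof.
  intros Hf Hg. unfold rmean.
  rewrite (RInt_plus (V := R_CompleteNormedModule) f g) by now apply rc_ex.
  unfold plus; simpl. unfold Rdiv. ring.
Qed.

Lemma rmean_scal c f : rc f -> rmean (fun x => c * f x) = c * rmean f.
Proof.
  intros Hf. unfold rmean.
  rewrite (RInt_scal (V := R_CompleteNormedModule) f _ _ c) by now apply rc_ex.
  unfold scal; simpl; unfold mult; simpl. unfold Rdiv. ring.
Qed.

Lemma rmean_const c : rmean (fun _ => c) = c.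
Proof.
  unfold rmean. rewrite RInt_const. unfold scal; simpl; unfold mult; simpl.
  field. pose proof PI_RGT_0; lra.
Qed.

Lemma rmean_ext f g : (forall x, 0 <= x <= 2 * PI -> f x = g x) -> rmean f = rmean g.
Proof.
  intros H. unfold rmean. f_equal. apply RInt_ext. intros x.
  rewrite Rmin_left, Rmax_right by (pose proof two_PI_pos; lra). intros Hx. apply H. lra.
Qed.

Lemma rmean_le f g : rc f -> rc g -> (forall x, f x <= g x) -> rmean f <= rmean g.
Proof.
  intros Hf Hg H. unfold rmean. pose proof two_PI_pos as Hp.
  apply Rmult_le_compat_r; [left; now apply Rinv_0_lt_compat|].
  apply RInt_le; auto using rc_ex. lra.
Qed.

Lemma rmean_pos f : rc f -> (forall x, 0 <= f x) -> 0 <= rmean f.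
Proof. intros Hf H. rewrite <- (rmean_const 0). apply rmean_le; auto using rc_const. Qed.

Lemma rmean_shift g s : (forall x, continuous g x) -> (forall x, g (x + 2 * PI) = g x) ->
  rmean (fun y => g (y + s)) = rmean g.
Proof.
  intros Hc Hp. unfold rmean. f_equal.
  assert (He : forall a b, ex_RInt g a b).
  { intros a b. apply (@ex_RInt_continuous R_CompleteNormedModule). auto. }
  assert (Hs : forall a b v, RInt (fun y => g (y + v)) a b = RInt g (a + v) (b + v)).
  { intros a b v.
    pose proof (RInt_comp_lin (V := R_CompleteNormedModule) g 1 v a b) as E.
    rewrite !Rmult_1_l in E. rewrite <- E by apply He. apply RInt_ext.
    intros x _. unfold scal; simpl; unfold mult; simpl. now rewrite !Rmult_1_l. }
  rewrite Hs, Rplus_0_l.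
  rewrite <- (RInt_Chasles (V := R_CompleteNormedModule) g s 0 (2 * PI + s)) by apply He.
  rewrite <- (RInt_Chasles (V := R_CompleteNormedModule) g 0 (2 * PI) (2 * PI + s)) by apply He.
  assert (E : RInt g (2 * PI) (2 * PI + s) = RInt g 0 s).
  { replace (2 * PI) with (0 + 2 * PI) at 1 by ring. rewrite (Rplus_comm _ s).
    rewrite <- Hs. apply RInt_ext. intros x _. apply Hp. }
  rewrite E, <- (opp_RInt_swap (V := R_CompleteNormedModule) g s 0) by apply He.
  unfold plus, opp; simpl. ring.
Qed.

Lemma cc_plus f g : cc f -> cc g -> cc (fun x => f x + g x)%C.
Proof. intros [H1 H2] [H3 H4]. split; [now apply (rc_plus _ _ H1)|now apply (rc_plus _ _ H2)]. Qed.

Lemma cc_mult f g : cc f -> cc g -> cc (fun x => f x * g x)%C.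
Proof.
  intros [H1 H2] [H3 H4]. split.
  - exact (rc_minus _ _ (rc_mult _ _ H1 H3) (rc_mult _ _ H2 H4)).
  - exact (rc_plus _ _ (rc_mult _ _ H1 H4) (rc_mult _ _ H2 H3)).
Qed.

Lemma cc_const c : cc (fun _ => c).
Proof. split; apply rc_const. Qed.

Lemma cc_test (f : test) : cc f.
Proof. split; apply rc_smooth; apply f. Qed.

Lemma rc_Cmod2 f : cc f -> rc (fun x => Cmod (f x) ^ 2).
Proof.
  intros [H1 H2].
  replace (fun x => Cmod (f x) ^ 2) with
    (fun x => Re (f x) * Re (f x) + Im (f x) * Im (f x)).
  - apply rc_plus; now apply rc_mult.
  - apply functional_extensionality. intros x. rewrite Cmod2_alt. ring.
Qed.

Lemma mean_plus f g : cc f -> cc g -> mean (fun x => f x + g x)%C = (mean f + mean g)%C.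
Proof.
  intros [H1 H2] [H3 H4]. apply Ceq; simpl; [now apply rmean_plus|].
  now apply (rmean_plus (fun x => Im (f x)) (fun x => Im (g x))).
Qed.

Lemma mean_scal c f : cc f -> mean (fun x => c * f x)%C = (c * mean f)%C.
Proof.
  intros [H1 H2]. apply Ceq; simpl.
  - rewrite (rmean_ext _ (fun x => fst c * Re (f x) + - snd c * Im (f x)))
      by (intros x _; unfold Re, Im; ring).
    rewrite rmean_plus, !rmean_scal; try (apply rc_mult; auto using rc_const); auto. ring.
  - rewrite (rmean_ext _ (fun x => fst c * Im (f x) + snd c * Re (f x)))
      by (intros x _; unfold Re, Im; ring).
    rewrite rmean_plus, !rmean_scal; try (apply rc_mult; auto using rc_const); auto.
Qed.

Lemma mean_const c : mean (fun _ => c) = c.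
Proof. apply Ceq; simpl; apply rmean_const. Qed.

Lemma mean_ext f g : (forall x, 0 <= x <= 2 * PI -> f x = g x) -> mean f = mean g.
Proof.
  intros H. apply Ceq; simpl; apply rmean_ext; intros x Hx; now rewrite H.
Qed.

(** Rotating the mean to the positive real axis reduces the complex bound to the real one. *)
Lemma Cmod_mean_le f g : cc f -> rc g -> (forall x, Cmod (f x) <= g x) ->
  Cmod (mean f) <= rmean g.
Proof.
  intros Hf Hg H. destruct (Ceq_dec (mean f) 0) as [E|E].
  { rewrite E, Cmod_0. apply rmean_pos; [exact Hg|].
    intros x. eapply Rle_trans; [apply Cmod_ge_0|apply H]. }
  assert (Hm : Cmod (mean f) <> 0) by (intros E'; now apply Cmod_eq_0 in E').
  set (c := (Cconj (mean f) / Cmod (mean f))%C).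
  assert (Hc : Cmod c = 1).
  { unfold c. rewrite Cmod_div by (intros E'; apply Hm; now injection E').
    rewrite Cmod_conj, Cmod_R, Rabs_pos_eq by apply Cmod_ge_0. now field. }
  replace (Cmod (mean f)) with (Re (mean (fun x => c * f x)%C)).
  - simpl. apply rmean_le; [|exact Hg|].
    + apply (cc_mult (fun _ => c) f); [apply cc_const|exact Hf].
    + intros x. eapply Rle_trans; [|apply H].
      eapply Rle_trans; [apply Rle_abs|]. eapply Rle_trans; [apply (re_le_Cmod (c * f x)%C)|].
      rewrite Cmod_mult, Hc. lra.
  - rewrite mean_scal by exact Hf. unfold c.
    replace (Cconj (mean f) / Cmod (mean f) * mean f)%C with (RtoC (Cmod (mean f))).
    { reflexivity. }
    assert (E1 : RtoC (Cmod (mean f)) <> 0) by (intros E'; apply Hm; now injection E').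
    transitivity (mean f * Cconj (mean f) / Cmod (mean f))%C; [|field; exact E1].
    rewrite <- Cmod2_conj. change 2%nat with (1 + 1)%nat. rewrite pow_add, pow_1, RtoC_mult.
    field. exact E1.
Qed.

(** ** The exponentials *)

Lemma expi_add j k x : (expi j x * expi k x)%C = expi (j + k) x.
Proof.
  apply Ceq; simpl; rewrite plus_IZR, Rmult_plus_distr_r; [rewrite cos_plus|rewrite sin_plus]; ring.
Qed.

Lemma expi_0 x : expi 0 x = 1%C.
Proof. apply Ceq; simpl; rewrite Rmult_0_l; [apply cos_0|apply sin_0]. Qed.

Lemma Cmod_expi k x : Cmod (expi k x) = 1.
Proof.
  unfold Cmod. simpl fst; simpl snd.
  replace (cos _ ^ 2 + sin _ ^ 2) with 1; [apply sqrt_1|].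
  pose proof (sin2_cos2 (IZR k * x)) as H. unfold Rsqr in H. lra.
Qed.

Lemma expi_conj k x : Cconj (expi k x) = expi (- k) x.
Proof.
  apply Ceq; simpl; rewrite opp_IZR, Ropp_mult_distr_l_reverse; [now rewrite cos_neg|now rewrite sin_neg].
Qed.

Lemma expi_shift k x y : expi k (x + y) = (expi k x * expi k y)%C.
Proof.
  apply Ceq; simpl; rewrite Rmult_plus_distr_l; [rewrite cos_plus|rewrite sin_plus]; ring.
Qed.

Lemma tderiv_expi k : tderiv (expi k) = tmul (tconst (Ci * RtoC (IZR k))) (expi k).
Proof.
  apply test_ext. intros x. apply Ceq; simpl; apply is_derive_unique; auto_derive; trivial; ring.
Qed.

Lemma mean_tderiv (f : test) : mean (tderiv f) = 0.
Proof.
  assert (K : forall g, smooth g -> periodic g -> rmean (Derive g) = 0).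
  { intros g Hg Hp. unfold rmean. rewrite RInt_Derive.
    - replace (2 * PI) with (0 + 2 * PI) at 1 by ring. rewrite Hp. unfold Rdiv. ring.
    - intros x _. now apply smooth_ex_derive.
    - intros x _. apply (ex_derive_continuous (Derive g)).
      now apply smooth_ex_derive, smooth_Derive. }
  apply Ceq; simpl; apply K; try apply f; intros x; now rewrite test_per.
Qed.

Lemma mean_expi k : k <> 0%Z -> mean (expi k) = 0.
Proof.
  intros Hk. pose proof (mean_tderiv (expi k)) as H. rewrite tderiv_expi in H.
  change (tfun (tmul (tconst (Ci * RtoC (IZR k))) (expi k))) with
    (fun x => (Ci * RtoC (IZR k)) * expi k x)%C in H.
  rewrite mean_scal in H by apply cc_test.
  assert (E : (Ci * IZR k)%C <> 0).
  { intros E. apply (f_equal Cmod) in E.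
    rewrite Cmod_mult, Cmod_Ci, Cmod_R, Cmod_0, Rmult_1_l in E.
    apply Hk, eq_IZR. now apply Rabs_eq_0. }
  replace (mean (expi k)) with (/ (Ci * IZR k) * (Ci * IZR k * mean (expi k)))%C
    by (rewrite Cmult_assoc, Cinv_l, Cmult_1_l by exact E; reflexivity).
  rewrite H. ring.
Qed.

Lemma cc_coef f k : cc f -> cc (fun x => f x * expi k x)%C.
Proof. intros H. apply cc_mult; [exact H|apply cc_test]. Qed.

Lemma coef_plus f g k : cc f -> cc g -> coef (fun x => f x + g x)%C k = (coef f k + coef g k)%C.
Proof.
  intros Hf Hg. unfold coef. rewrite <- mean_plus by now apply cc_coef.
  apply mean_ext. intros x _. ring.
Qed.

Lemma coef_scal c f k : cc f -> coef (fun x => c * f x)%C k = (c * coef f k)%C.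
Proof.
  intros Hf. unfold coef. rewrite <- mean_scal by now apply cc_coef.
  apply mean_ext. intros x _. ring.
Qed.

Lemma coef_ext f g k : (forall x, 0 <= x <= 2 * PI -> f x = g x) -> coef f k = coef g k.
Proof. intros H. apply mean_ext. intros x Hx. now rewrite H. Qed.

Lemma coef_expi j k : coef (expi j) k = if Z.eq_dec j k then 1%C else 0%C.
Proof.
  unfold coef. rewrite (mean_ext _ (expi (j - k))).
  2:{ intros x _. now rewrite expi_add. }
  destruct (Z.eq_dec j k) as [->|H].
  - rewrite Z.sub_diag, (mean_ext _ (fun _ => 1%C)) by (intros x _; apply expi_0).
    apply mean_const.
  - apply mean_expi. lia.
Qed.

Lemma coef_mul_expi f j k : coef (fun x => f x * expi j x)%C k = coef f (k - j).
Proof.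
  apply mean_ext. intros x _. rewrite <- Cmult_assoc, expi_add.
  now replace (j + - k)%Z with (- (k - j))%Z by lia.
Qed.

Lemma coef_tderiv (f : test) k : coef (tderiv f) k = (Ci * RtoC (IZR k) * coef f k)%C.
Proof.
  pose proof (mean_tderiv (tmul f (expi (- k)))) as H. rewrite tderiv_mul, tderiv_expi in H.
  rewrite (mean_ext _ (fun x => tderiv f x * expi (- k) x
     + - (Ci * RtoC (IZR k)) * (f x * expi (- k) x))%C) in H.
  2:{ intros x _. cbn [tadd tmul tconst tfun]. rewrite opp_IZR, RtoC_opp. ring. }
  rewrite mean_plus, mean_scal in H.
  - change (coef (tderiv f) k + - (Ci * RtoC (IZR k)) * coef f k = 0)%C in H.
    replace (coef (tderiv f) k) with (coef (tderiv f) k + - (Ci * RtoC (IZR k)) * coef f k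
      + Ci * RtoC (IZR k) * coef f k)%C by ring. rewrite H. ring.
  - apply cc_coef, cc_test.
  - apply cc_coef, cc_test.
  - apply cc_mult; [apply cc_const|apply cc_coef, cc_test].
Qed.

(** ** Bessel's inequality *)

(** Pythagoras: the remainder is orthogonal to the mode [e^{ikx}], which has mean square one. *)
Lemma mean_square_sub_mode f k : cc f ->
  rmean (fun x => Cmod (f x - coef f k * expi k x)%C ^ 2)
  = rmean (fun x => Cmod (f x) ^ 2) - Cmod (coef f k) ^ 2.
Proof.
  intros Hf. set (c := coef f k).
  rewrite (rmean_ext _ (fun x => Cmod (f x) ^ 2 +
     (-2 * Re (Cconj c * (f x * expi (- k) x))%C + Cmod c ^ 2))).
  2:{ intros x _. rewrite <- expi_conj. rewrite !Cmod2_alt.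
      pose proof (Cmod_expi k x) as H. apply (f_equal (fun r => r ^ 2)) in H.
      rewrite Cmod2_alt in H. destruct (f x) as [p q], (expi k x) as [r s], c as [t u].
      unfold Re, Im in *. cbn -[pow] in *.
      replace ((t ^ 2 + u ^ 2)) with ((t ^ 2 + u ^ 2) * (r ^ 2 + s ^ 2))
        by (rewrite H; ring). ring. }
  assert (H1 : cc (fun x => Cconj c * (f x * expi (- k) x))%C).
  { apply cc_mult; [apply cc_const|now apply cc_coef]. }
  rewrite !rmean_plus, rmean_const.
  - rewrite rmean_scal by apply H1.
    change (rmean (fun x => Re (Cconj c * (f x * expi (- k) x))%C)) with
      (Re (mean (fun x => Cconj c * (f x * expi (- k) x))%C)).
    rewrite mean_scal by now apply cc_coef. fold (coef f k). fold c.
    rewrite (Cmult_comm (Cconj c)), <- Cmod2_conj. simpl Re. ring.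
  - apply rc_mult; [apply rc_const|apply H1].
  - apply rc_const.
  - now apply rc_Cmod2.
  - apply rc_plus; [|apply rc_const]. apply rc_mult; [apply rc_const|apply H1].
Qed.

Lemma cc_sub_mode f c k : cc f -> cc (fun x => f x - c * expi k x)%C.
Proof.
  intros Hf.
  apply (cc_plus f (fun x => - (c * expi k x))%C); [exact Hf|].
  destruct (cc_mult (fun _ => c) (expi k) (cc_const c) (cc_test _)) as [H1 H2].
  split; intros x Hx; [apply (continuous_opp (fun x => Re (c * expi k x)%C))
    |apply (continuous_opp (fun x => Im (c * expi k x)%C))]; auto.
Qed.

Lemma coef_sub_mode f c j k : cc f -> j <> k ->
  coef (fun x => f x - c * expi j x)%C k = coef f k.
Proof.
  intros Hf Hjk.
  rewrite (coef_ext _ (fun x => f x + - c * expi j x)%C) by (intros x _; ring).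
  rewrite coef_plus, coef_scal, coef_expi by (auto using cc_test; apply cc_mult; auto using cc_const, cc_test).
  destruct (Z.eq_dec j k); [easy|]. ring.
Qed.

(** Removing the modes one after the other leaves a nonnegative mean square, and removing one
    mode does not change the coefficients of the others. *)
Lemma bessel n : forall f, cc f ->
  W (fun k => Cmod (coef f k) ^ 2) n <= rmean (fun x => Cmod (f x) ^ 2).
Proof.
  induction n as [|n IH]; intros f Hf.
  - cbn [W]. pose proof (mean_square_sub_mode f 0 Hf) as H.
    assert (0 <= rmean (fun x => Cmod (f x - coef f 0 * expi 0 x)%C ^ 2)).
    { apply rmean_pos; [apply rc_Cmod2, cc_sub_mode, Hf|intros x; apply pow2_ge_0]. }
    lra.
  - cbn [W]. set (j := Z.of_nat (S n)).
    set (g := fun x => (f x - coef f j * expi j x)%C).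
    assert (Hg : cc g) by now apply cc_sub_mode.
    set (h := fun x => (g x - coef g (- j) * expi (- j) x)%C).
    assert (Hh : cc h) by now apply cc_sub_mode.
    pose proof (mean_square_sub_mode f j Hf) as E1. fold g in E1.
    pose proof (mean_square_sub_mode g (- j) Hg) as E2. fold h in E2.
    change (rmean (fun x => Cmod (g x) ^ 2) =
      rmean (fun x => Cmod (f x) ^ 2) - Cmod (coef f j) ^ 2) in E1.
    change (rmean (fun x => Cmod (h x) ^ 2) =
      rmean (fun x => Cmod (g x) ^ 2) - Cmod (coef g (- j)) ^ 2) in E2.
    assert (E3 : coef g (- j) = coef f (- j)) by (apply coef_sub_mode; [exact Hf|lia]).
    specialize (IH h Hh).
    rewrite (W_ext_in _ (fun k => Cmod (coef f k) ^ 2)) in IH.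
    2:{ intros k Hk. do 2 f_equal. unfold h. rewrite coef_sub_mode by (auto; lia).
        apply coef_sub_mode; [exact Hf|lia]. }
    rewrite E3 in E2. lra.
Qed.

Lemma bessel_ex f : cc f -> ex_Zseries (fun k => Cmod (coef f k) ^ 2).
Proof.
  intros Hf. apply ex_Zseries_bound with (rmean (fun x => Cmod (f x) ^ 2)).
  - intros k. apply pow2_ge_0.
  - intros n. now apply bessel.
Qed.

Lemma riemann_lebesgue f : cc f -> forall eps, 0 < eps ->
  exists n, forall k, (Z.of_nat n <= Z.abs k)%Z -> Cmod (coef f k) < eps.
Proof.
  intros Hf eps Heps. destruct (bessel_ex f Hf) as [l Hl].
  pose proof (ex_series_lim_0 _ (ex_intro _ l Hl)) as H.
  apply is_lim_seq_spec in H.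
  destruct (H (mkposreal (eps ^ 2) (pow_lt _ 2 Heps))) as [n Hn].
  exists (S n). intros k Hk.
  specialize (Hn (Nat.pred (Z.abs_nat k))). simpl pos in Hn.
  assert (Hk2 : (n <= Nat.pred (Z.abs_nat k))%nat) by lia. specialize (Hn Hk2).
  unfold fold_Z in Hn. rewrite Nat.succ_pred_pos, Rminus_0_r in Hn by lia.
  apply Rabs_def2 in Hn. destruct Hn as [Hn _].
  pose proof (pow2_ge_0 (Cmod (coef f (Z.of_nat (Z.abs_nat k))))).
  pose proof (pow2_ge_0 (Cmod (coef f (- Z.of_nat (Z.abs_nat k))))).
  assert (Cmod (coef f k) ^ 2 < eps ^ 2).
  { destruct (Z.abs_eq_or_opp k) as [E|E];
      [replace k with (Z.of_nat (Z.abs_nat k)) at 1 by lia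
      |replace k with (- Z.of_nat (Z.abs_nat k))%Z at 1 by lia]; lra. }
  apply Rnot_le_lt. intros L.
  pose proof (pow_incr eps (Cmod (coef f k)) 2 (conj (Rlt_le _ _ Heps) L)). lra.
Qed.

(** ** Fourier inversion *)

Definition slope (f : R -> R) (a x : R) : R :=
  if Req_EM_T x a then Derive f a else (f x - f a) / (x - a).

Lemma slope_spec f a x : f x - f a = (x - a) * slope f a x.
Proof. unfold slope. destruct (Req_EM_T x a) as [->|H]; [ring|field; lra]. Qed.

Lemma slope_continuous f a : (forall x, ex_derive f x) -> forall x, continuous (slope f a) x.
Proof.
  intros Hd x. destruct (Req_EM_T x a) as [->|H].
  - apply continuity_pt_filterlim. intros eps Heps.
    pose proof (proj1 (is_derive_Reals f a (Derive f a)) (Derive_correct _ _ (Hd a))) as D.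
    destruct (D eps Heps) as [delta Hdelta]. exists delta. split; [apply delta|].
    intros y [[_ Hy] Hd']. simpl in *. unfold Rdist in *.
    assert (Hya : y - a <> 0) by (intros E; apply Hy; lra).
    specialize (Hdelta (y - a) Hya Hd'). replace (a + (y - a)) with y in Hdelta by ring.
    unfold slope. destruct (Req_EM_T y a) as [E|_]; [lra|].
    destruct (Req_EM_T a a) as [_|E]; [exact Hdelta|lra].
  - apply (continuous_ext_loc _ (fun y => (f y - f a) * / (y - a))).
    + exists (mkposreal (Rabs (x - a)) (Rabs_pos_lt _ (Rminus_eq_contra _ _ H))).
      intros y Hy. unfold slope. destruct (Req_EM_T y a) as [E|_]; [|reflexivity].
      subst y. exfalso. apply Rlt_irrefl with (Rabs (x - a)).
      rewrite Rabs_minus_sym at 1. exact Hy.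
    + apply (continuous_mult (fun y => f y - f a) (fun y => / (y - a))).
      * apply (continuous_minus f (fun _ => f a)); [|apply continuous_const].
        apply (ex_derive_continuous f), Hd.
      * apply (ex_derive_continuous (fun y => / (y - a))). auto_derive. lra.
Qed.

(** [1 + e^{ix} = e^{ix} - e^{i PI}] has a simple zero at [PI], the only one in the period. *)
Lemma one_plus_expi_factor x :
  (1 + expi 1 x)%C = (RtoC (x - PI) * (slope cos PI x, slope sin PI x))%C.
Proof.
  pose proof (slope_spec cos PI x) as H1; pose proof (slope_spec sin PI x) as H2.
  rewrite cos_PI in H1. rewrite sin_PI in H2.
  apply Ceq; simpl; rewrite Rmult_1_l; lra.
Qed.

Lemma slope_exp_neq0 x : 0 <= x <= 2 * PI -> slope cos PI x ^ 2 + slope sin PI x ^ 2 <> 0.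
Proof.
  intros Hx E.
  assert (E1 : slope cos PI x = 0) by nra. assert (E2 : slope sin PI x = 0) by nra.
  destruct (Req_EM_T x PI) as [->|H].
  - unfold slope in E2. destruct (Req_EM_T PI PI) as [_|]; [|lra].
    assert (D : is_derive sin PI (cos PI)) by (auto_derive; [exact I|ring]).
    apply is_derive_unique in D. rewrite cos_PI in D. lra.
  - pose proof (slope_spec cos PI x) as S1. rewrite E1, cos_PI in S1.
    assert (C1 : cos x = -1) by lra.
    replace x with (2 * (x / 2)) in C1 by field. rewrite cos_2a_cos in C1.
    assert (C2 : cos (x / 2) = 0) by nra.
    destruct (Rlt_or_le x PI) as [L|L].
    + pose proof (cos_gt_0 (x / 2)). lra.
    + pose proof (cos_lt_0 (x / 2)). lra.
Qed.

Lemma expi_PI n : expi (Z.of_nat n) PI = RtoC ((-1) ^ n) /\ expi (- Z.of_nat n) PI = RtoC ((-1) ^ n).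
Proof.
  assert (E1 : expi 1 PI = RtoC (-1)).
  { apply Ceq; simpl; rewrite Rmult_1_l; [apply cos_PI|apply sin_PI]. }
  induction n as [|n [IH1 IH2]].
  - split; exact (expi_0 PI).
  - assert (P : expi (Z.of_nat (S n)) PI = RtoC ((-1) ^ S n)).
    { rewrite Nat2Z.inj_succ, <- Z.add_1_l, <- expi_add, IH1, E1, <- RtoC_mult. reflexivity. }
    split; [exact P|]. rewrite <- expi_conj, P. apply Ceq; simpl; ring.
Qed.

(** Chernoff's argument: [f - f(PI) = (1 + e^{ix}) g] turns the Fourier sum of [f] at [PI] into
    a telescoping sum of coefficients of [g], which tend to zero. *)
Lemma fourier_inversion_at_PI (F : R -> C) :
  (forall x, ex_derive (fun y => Re (F y)) x) -> (forall x, ex_derive (fun y => Im (F y)) x) ->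
  Clim (CW (fun k => coef F k * expi k PI)%C) (F PI).
Proof.
  intros H1 H2.
  set (s := fun x => (slope cos PI x, slope sin PI x) : C).
  set (q := fun x => (slope (fun y => Re (F y)) PI x, slope (fun y => Im (F y)) PI x) : C).
  set (g := fun x => (q x / s x)%C).
  assert (Hs : cc s).
  { split; intros x _; apply slope_continuous; intros y; auto_derive; trivial. }
  assert (Hq : cc q) by (split; intros x _; now apply slope_continuous).
  assert (Hg : cc g).
  { apply cc_mult; [exact Hq|]. destruct Hs as [Hs1 Hs2].
    assert (Hd : rc (fun x => Re (s x) ^ 2 + Im (s x) ^ 2)).
    { replace (fun x => Re (s x) ^ 2 + Im (s x) ^ 2) with (fun x => Cmod (s x) ^ 2)
        by (apply functional_extensionality; intros y; apply Cmod2_alt).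
      exact (rc_Cmod2 s (conj Hs1 Hs2)). }
    assert (Hi : rc (fun x => / (Re (s x) ^ 2 + Im (s x) ^ 2))).
    { intros x Hx. apply (continuous_comp (fun x => Re (s x) ^ 2 + Im (s x) ^ 2) Rinv).
      - exact (Hd x Hx).
      - apply continuous_Rinv. now apply slope_exp_neq0. }
    split; [exact (rc_mult _ _ Hs1 Hi)|].
    replace (fun x => Im (/ s x)%C) with
      (fun x => - 1 * Im (s x) * / (Re (s x) ^ 2 + Im (s x) ^ 2)).
    - exact (rc_mult _ _ (rc_mult _ _ (rc_const (-1)) Hs2) Hi).
    - apply functional_extensionality. intros y. unfold Cinv, Im, Re. simpl. unfold Rdiv. ring. }
  assert (E : forall x, 0 <= x <= 2 * PI -> F x = (F PI + (g x + g x * expi 1 x))%C).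
  { intros x Hx. replace (g x + g x * expi 1 x)%C with (g x * (1 + expi 1 x))%C by ring.
    rewrite one_plus_expi_factor. fold (s x). unfold g.
    assert (Hsx : s x <> 0).
    { intros E. apply (slope_exp_neq0 x Hx). injection E as E1 E2. rewrite E1, E2. ring. }
    replace (q x / s x * (RtoC (x - PI) * s x))%C with (RtoC (x - PI) * q x)%C by (now field).
    apply Ceq; unfold q; simpl; rewrite Rmult_0_l.
    - pose proof (slope_spec (fun y => Re (F y)) PI x). unfold Re in *. lra.
    - pose proof (slope_spec (fun y => Im (F y)) PI x). unfold Im in *. lra. }
  assert (Ec : forall k, coef F k =
    ((if Z.eq_dec 0 k then F PI else 0%C) + (coef g k + coef g (k - 1)))%C).
  { intros k. rewrite (coef_ext F (fun x => F PI * expi 0 x + (g x + g x * expi 1 x))%C).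
    2:{ intros x Hx. rewrite expi_0, Cmult_1_r. now apply E. }
    assert (Hge : cc (fun x => g x * expi 1 x)%C) by now apply cc_coef.
    assert (HF : cc (fun x => F PI * expi 0 x)%C).
    { apply cc_mult; [apply cc_const|apply cc_test]. }
    rewrite (coef_plus (fun x => F PI * expi 0 x)%C (fun x => g x + g x * expi 1 x)%C);
      [|exact HF|now apply cc_plus].
    rewrite (coef_plus g (fun x => g x * expi 1 x)%C) by assumption.
    rewrite coef_scal by apply cc_test. rewrite coef_expi, coef_mul_expi.
    destruct (Z.eq_dec 0 k); ring. }
  assert (T : forall n, CW (fun k => coef F k * expi k PI)%C n =
    (F PI + RtoC ((-1) ^ n) * (coef g (Z.of_nat n) + coef g (- Z.of_nat n - 1)))%C).
  { induction n as [|n IH].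
    - rewrite CW_0, expi_0, Ec. simpl. ring.
    - rewrite CW_S, IH. destruct (expi_PI (S n)) as [-> ->]. rewrite !Ec.
      destruct (Z.eq_dec 0 (Z.of_nat (S n))) as [?|_]; [lia|].
      destruct (Z.eq_dec 0 (- Z.of_nat (S n))) as [?|_]; [lia|].
      replace (Z.of_nat (S n) - 1)%Z with (Z.of_nat n) by lia.
      replace (- Z.of_nat n - 1)%Z with (- Z.of_nat (S n))%Z by lia.
      rewrite <- tech_pow_Rmult, RtoC_mult. ring. }
  apply Clim_of_close. intros eps Heps.
  destruct (riemann_lebesgue g Hg (eps / 2)) as [N HN]; [lra|]. exists N. intros n Hn.
  rewrite T. replace (F PI + _ - F PI)%C with
    (RtoC ((-1) ^ n) * (coef g (Z.of_nat n) + coef g (- Z.of_nat n - 1)))%C by ring.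
  rewrite Cmod_mult, Cmod_R, pow_1_abs, Rmult_1_l.
  eapply Rle_lt_trans; [apply Cmod_triangle|].
  assert (Cmod (coef g (Z.of_nat n)) < eps / 2) by (apply HN; lia).
  assert (Cmod (coef g (- Z.of_nat n - 1)) < eps / 2) by (apply HN; lia). lra.
Qed.

Lemma test_continuous (f : test) x :
  continuous (fun y => Re (f y)) x /\ continuous (fun y => Im (f y)) x.
Proof.
  split; [apply (ex_derive_continuous (fun y => Re (f y)))
    |apply (ex_derive_continuous (fun y => Im (f y)))]; apply smooth_ex_derive; apply f.
Qed.

Lemma mean_shift (f : test) s : mean (fun y => f (y + s)) = mean f.
Proof.
  apply Ceq; simpl.
  - apply (rmean_shift (fun y => Re (f y))); intros x; [apply test_continuous|now rewrite test_per].
  - apply (rmean_shift (fun y => Im (f y))); intros x; [apply test_continuous|now rewrite test_per].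
Qed.

Lemma coef_shift (f : test) s k : coef (fun y => f (y + s)) k = (coef f k * expi k s)%C.
Proof.
  unfold coef. change (fun x => f x * expi (- k) x)%C with (tfun (tmul f (expi (- k)))).
  rewrite <- (mean_shift (tmul f (expi (- k))) s).
  cbn [tmul tfun]. rewrite Cmult_comm, <- mean_scal.
  - apply mean_ext. intros x _. rewrite (expi_shift (- k) x s).
    replace (expi k s * (f (x + s)%R * (expi (- k) x * expi (- k) s)))%C
      with (f (x + s)%R * expi (- k) x * (expi k s * expi (- k) s))%C by ring.
    rewrite expi_add, Z.add_opp_diag_r, expi_0. ring.
  - split; intros x _.
    + apply (continuous_comp (fun x => x + s) (fun y => Re (tmul f (expi (- k)) y))).
      * apply (ex_derive_continuous (fun x => x + s)). auto_derive. trivial.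
      * apply test_continuous.
    + apply (continuous_comp (fun x => x + s) (fun y => Im (tmul f (expi (- k)) y))).
      * apply (ex_derive_continuous (fun x => x + s)). auto_derive. trivial.
      * apply test_continuous.
Qed.

Lemma fourier_inversion (f : test) x :
  Clim (CW (fun k => coef f k * expi k x)%C) (f x).
Proof.
  set (F := fun y => f (y + (x - PI))).
  assert (H : Clim (CW (fun k => coef F k * expi k PI)%C) (F PI)).
  { apply fourier_inversion_at_PI; intros y.
    - apply (ex_derive_comp (fun z => Re (f z)) (fun y => y + (x - PI))).
      + apply smooth_ex_derive, f.
      + auto_derive. trivial.
    - apply (ex_derive_comp (fun z => Im (f z)) (fun y => y + (x - PI))).
      + apply smooth_ex_derive, f.
      + auto_derive. trivial. }
  unfold F in H. replace (PI + (x - PI)) with x in H by ring.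
  revert H. apply Clim_ext. intros n. apply CW_ext. intros k.
  rewrite coef_shift, <- Cmult_assoc, <- expi_shift. do 2 f_equal. ring.
Qed.

(** ** Decay of the coefficients of smooth functions *)

Lemma Cmod_coef_le f B k : cc f -> (forall x, Cmod (f x) <= B) -> Cmod (coef f k) <= B.
Proof.
  intros Hf H. rewrite <- (rmean_const B). apply Cmod_mean_le.
  - now apply cc_coef.
  - apply rc_const.
  - intros x. rewrite Cmod_mult, Cmod_expi, Rmult_1_r. apply H.
Qed.

Lemma Cmod_coef_iter (f : test) j k :
  Cmod (coef (Nat.iter j tderiv f) k) = Rabs (IZR k) ^ j * Cmod (coef f k).
Proof.
  induction j as [|j IH]; [simpl; ring|].
  rewrite Nat.iter_succ, coef_tderiv, !Cmod_mult, IH, Cmod_Ci, Cmod_R. simpl. ring.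
Qed.

(** Up to a factor of modulus one, [k^j f^(k)] is the coefficient of the [j]-th derivative. *)
Lemma coef_decay m (f : test) B k : tbound m f B ->
  Cmod (coef f k) <= 2 ^ m * B / (1 + Rabs (IZR k)) ^ m.
Proof.
  intros H. assert (HB : 0 <= B).
  { eapply Rle_trans; [apply Cmod_ge_0|apply (H 0%nat 0); lia]. }
  assert (Hk : 0 <= Rabs (IZR k)) by apply Rabs_pos.
  assert (Hp : 0 < (1 + Rabs (IZR k)) ^ m) by (apply pow_lt; lra).
  apply Rmult_le_reg_r with ((1 + Rabs (IZR k)) ^ m); [exact Hp|].
  unfold Rdiv. rewrite Rmult_assoc, Rinv_l, Rmult_1_r by lra.
  assert (B0 : Cmod (coef f k) <= B).
  { apply Cmod_coef_le; [apply cc_test|]. intros x. apply (H 0%nat x). lia. }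
  destruct (Z.eq_dec k 0) as [->|Hk0].
  - rewrite Rabs_R0, Rplus_0_r, pow1, Rmult_1_r.
    pose proof (pow_R1_Rle 2 m). nra.
  - assert (Hk1 : 1 <= Rabs (IZR k)) by (rewrite <- abs_IZR; apply IZR_le; lia).
    assert (Bm : Rabs (IZR k) ^ m * Cmod (coef f k) <= B).
    { rewrite <- Cmod_coef_iter. apply Cmod_coef_le; [apply cc_test|].
      intros x. now apply H. }
    apply Rle_trans with (Cmod (coef f k) * (2 * Rabs (IZR k)) ^ m).
    + apply Rmult_le_compat_l; [apply Cmod_ge_0|]. apply pow_incr. lra.
    + rewrite Rpow_mult_distr. pose proof (pow_lt 2 m). nra.
Qed.

Lemma tbound_exists m (f : test) : exists B, 0 <= B /\ tbound m f B.
Proof.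
  induction m as [|m [B [HB H]]].
  - destruct (test_bounded f) as [B [HB H]]. exists B. split; [exact HB|].
    intros j x Hj. replace j with 0%nat by lia. apply H.
  - destruct (test_bounded (Nat.iter (S m) tderiv f)) as [B' [HB' H']].
    exists (B + B'). split; [lra|]. intros j x Hj.
    destruct (Nat.eq_dec j (S m)) as [->|Hne]; [specialize (H' x); lra|].
    assert (Hj' : (j <= m)%nat) by lia. specialize (H j x Hj'). lra.
Qed.

Fixpoint tsum (c : Z -> C) (n : nat) : test :=
  match n with
  | O => tmul (tconst (c 0%Z)) (expi 0)
  | S n' => tadd (tsum c n')
      (tadd (tmul (tconst (c (Z.of_nat n))) (expi (Z.of_nat n)))
            (tmul (tconst (c (- Z.of_nat n)%Z)) (expi (- Z.of_nat n))))
  end.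

Lemma tsum_CW c n x : tsum c n x = CW (fun k => c k * expi k x)%C n.
Proof.
  induction n as [|n IH]; [now rewrite CW_0|]. rewrite CW_S, <- IH. reflexivity.
Qed.

Lemma tderiv_tsum c n : tderiv (tsum c n) = tsum (fun k => c k * (Ci * RtoC (IZR k)))%C n.
Proof.
  assert (K : forall a k, tderiv (tmul (tconst a) (expi k)) =
    tmul (tconst (a * (Ci * RtoC (IZR k)))%C) (expi k)).
  { intros a k. rewrite tderiv_mul, tderiv_const, tderiv_expi. apply test_ext.
    intros x. cbn [tadd tmul tconst tfun]. ring. }
  induction n as [|n IH]; cbn [tsum]; [apply K|]. now rewrite !tderiv_add, IH, !K.
Qed.

Lemma tsum_ext c c' n : (forall k, c k = c' k) -> tsum c n = tsum c' n.
Proof. intros H. replace c' with c; [easy|]. now apply functional_extensionality. Qed.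

Definition tpartial (f : test) (n : nat) : test := tsum (coef f) n.

Lemma tderiv_partial f n : tderiv (tpartial f n) = tpartial (tderiv f) n.
Proof.
  unfold tpartial. rewrite tderiv_tsum. apply tsum_ext. intros k.
  rewrite coef_tderiv. ring.
Qed.

Lemma tpartial_rate (f : test) : exists K, 0 <= K /\ forall n x,
  Cmod (tpartial f n x - f x)%C <= K / (INR n + 1).
Proof.
  destruct (tbound_exists 2 f) as [B [HB H]].
  exists (2 * (2 ^ 2 * B)). split; [simpl; lra|]. intros n x.
  unfold tpartial. rewrite tsum_CW.
  apply (CW_square_rate (fun k => coef f k * expi k x)%C); [|apply fourier_inversion].
  intros k. rewrite Cmod_mult, Cmod_expi, Rmult_1_r. now apply coef_decay.
Qed.

Definition tsub (f g : test) : test := tadd f (tmul (tconst (-1)) g).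

Lemma tderiv_sub f g : tderiv (tsub f g) = tsub (tderiv f) (tderiv g).
Proof.
  unfold tsub. rewrite tderiv_add, tderiv_mul, tderiv_const. f_equal.
  apply test_ext. intros x. cbn [tadd tmul tconst tfun]. ring.
Qed.

(** Differentiation commutes with partial Fourier sums, so uniform convergence for every smooth
    function is convergence of all derivatives. *)
Lemma tpartial_tbound m : forall f : test, exists K, 0 <= K /\ forall n,
  tbound m (tsub (tpartial f n) f) (K / (INR n + 1)).
Proof.
  assert (P : forall j (f : test), exists K, 0 <= K /\ forall n x,
    Cmod (Nat.iter j tderiv (tsub (tpartial f n) f) x) <= K / (INR n + 1)).
  { induction j as [|j IH]; intros f.
    - destruct (tpartial_rate f) as [K [HK H]]. exists K. split; [exact HK|].
      intros n x. eapply Rle_trans; [|apply (H n x)]. right. f_equal.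
      cbn [Nat.iter nat_rect tsub tadd tmul tconst tfun]. ring.
    - destruct (IH (tderiv f)) as [K [HK H]]. exists K. split; [exact HK|].
      intros n x. rewrite Nat.iter_succ_r, tderiv_sub, tderiv_partial. apply H. }
  intros f. induction m as [|m [K [HK IH]]].
  - destruct (P 0%nat f) as [K [HK H]]. exists K. split; [exact HK|].
    intros n j x Hj. replace j with 0%nat by lia. apply H.
  - destruct (P (S m) f) as [L [HL H]]. exists (K + L). split; [lra|].
    intros n j x Hj. pose proof (pos_INR n) as Hn.
    assert (0 < / (INR n + 1)) by (apply Rinv_0_lt_compat; lra). unfold Rdiv in *.
    destruct (Nat.eq_dec j (S m)) as [->|Hne].
    + eapply Rle_trans; [apply H|]. nra.
    + eapply Rle_trans; [apply IH; lia|]. nra.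
Qed.

(** * Distributions and their Fourier coefficients *)

Lemma two_PI_C : RtoC (2 * PI) <> 0.
Proof. intros E. injection E as E. pose proof PI_RGT_0; lra. Qed.

Lemma pair_sub (v : distr) (f g : test) : v (tsub f g) = (v f - v g)%C.
Proof. unfold tsub. rewrite pair_add, pair_scal. ring. Qed.

Lemma pair_expi (v : distr) k : v (expi k) = (RtoC (2 * PI) * fourier v (- k))%C.
Proof.
  unfold fourier. rewrite Z.opp_involutive. field. apply two_PI_C.
Qed.

Lemma pair_tsum (v : distr) c n :
  v (tsum c n) = (RtoC (2 * PI) * CW (fun k => c k * fourier v (- k)) n)%C.
Proof.
  induction n as [|n IH]; cbn [tsum].
  - rewrite CW_0, pair_scal, pair_expi. ring.
  - rewrite CW_S, !pair_add, !pair_scal, IH, !pair_expi. ring.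
Qed.

Lemma pair_Clim (v : distr) (f : test) :
  Clim (fun n => RtoC (2 * PI) * CW (fun k => coef f k * fourier v (- k)) n)%C (v f).
Proof.
  destruct (pair_cont v) as [m [M [HM H]]].
  destruct (tpartial_tbound m f) as [K [HK HT]].
  apply Clim_of_dist with (fun n => (M * K) / (INR n + 1)).
  - intros n. rewrite <- pair_tsum. fold (tpartial f n). rewrite <- pair_sub.
    eapply Rle_trans; [apply H, HT|]. right. unfold Rdiv. ring.
  - apply is_lim_inv_succ.
Qed.

Lemma distr_eq (v w : distr) : (forall f, v f = w f) -> v = w.
Proof.
  destruct v as [v a1 s1 c1], w as [w a2 s2 c2]; simpl; intros E.
  apply functional_extensionality in E. subst w. f_equal; apply proof_irrelevance.
Qed.

(** A continuous form is determined on the partial Fourier sums, which converge in the topology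
    of test functions. *)
Lemma distr_ext (v w : distr) : (forall k, fourier v k = fourier w k) -> v = w.
Proof.
  intros H. apply distr_eq. intros f. apply (Clim_unique _ _ _ (pair_Clim v f)).
  eapply Clim_ext; [|apply (pair_Clim w f)]. intros n. cbn beta. f_equal.
  apply CW_ext. intros k. now rewrite H.
Qed.

Definition polygrowth (c : Z -> C) : Prop :=
  exists m K, forall k, Cmod (c k) <= K * (1 + Rabs (IZR k)) ^ m.

Lemma CW_single (c : Z -> C) n k : (Z.abs_nat k <= n)%nat ->
  CW (fun j => if Z.eq_dec j k then c k else 0)%C n = c k.
Proof.
  induction n as [|n IH]; intros Hn.
  - rewrite CW_0. destruct (Z.eq_dec 0 k); [reflexivity|lia].
  - rewrite CW_S. destruct (le_lt_dec (Z.abs_nat k) n) as [Hl|Hl].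
    + rewrite IH by exact Hl.
      destruct (Z.eq_dec (Z.of_nat (S n)) k), (Z.eq_dec (- Z.of_nat (S n)) k); try lia. ring.
    + rewrite (CW_ext_in _ (fun _ => 0 * 0)%C).
      2:{ intros j Hj. destruct (Z.eq_dec j k); [lia|ring]. }
      rewrite (CW_scal 0 (fun _ => RtoC 0)).
      destruct (Z.eq_dec (Z.of_nat (S n)) k), (Z.eq_dec (- Z.of_nat (S n)) k); try lia; ring.
Qed.

(** The pairing [2 pi sum_k c_k f^(-k)] converges because [f^] decays rapidly. *)
Lemma distr_exists c : polygrowth c -> exists v, forall k, fourier v k = c k.
Proof.
  intros [m [K H]].
  assert (HK : 0 <= K).
  { specialize (H 0%Z). rewrite Rabs_R0, Rplus_0_r, pow1, Rmult_1_r in H.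
    eapply Rle_trans; [apply Cmod_ge_0|exact H]. }
  assert (P : forall k, 0 < 1 + Rabs (IZR k)).
  { intros k. pose proof (Rabs_pos (IZR k)). lra. }
  assert (D : forall (f : test) B, tbound (m + 2) f B -> forall k,
    Cmod (c k * coef f (- k)) <= K * (2 ^ (m + 2) * B) / (1 + Rabs (IZR k)) ^ 2).
  { intros f B HB k. rewrite Cmod_mult.
    pose proof (coef_decay _ f B (- k) HB) as HD. rewrite opp_IZR, Rabs_Ropp in HD.
    eapply Rle_trans.
    { apply Rmult_le_compat; [apply Cmod_ge_0|apply Cmod_ge_0|apply H|apply HD]. }
    right. rewrite (pow_add (1 + Rabs (IZR k))). specialize (P k).
    pose proof (pow_lt _ m P). field. lra. }
  assert (A : forall f : test, ex_Zseries (fun k => Cmod (c k * coef f (- k)))).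
  { intros f. destruct (tbound_exists (m + 2) f) as [B [_ HB]].
    apply ex_Zseries_le with (fun k => K * (2 ^ (m + 2) * B) * / (1 + Rabs (IZR k)) ^ 2).
    - intros k. rewrite Rabs_pos_eq by apply Cmod_ge_0. now apply D.
    - apply ex_Zseries_scal, ex_Zseries_inv_square. }
  set (p := fun f : test => (RtoC (2 * PI) * CZseries (fun k => c k * coef f (- k)))%C).
  assert (L : forall f : test, Clim (fun n => RtoC (2 * PI) * CW (fun k => c k * coef f (- k)) n)%C (p f)).
  { intros f. now apply Clim_scal, Clim_CZseries. }
  assert (Padd : forall f g : test, p (tadd f g) = (p f + p g)%C).
  { intros f g. apply (Clim_unique _ _ _ (L (tadd f g))).
    eapply Clim_ext; [|apply (Clim_plus _ _ _ _ (L f) (L g))].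
    intros n. cbn beta. rewrite <- Cmult_plus_distr_l, <- CW_plus. f_equal. apply CW_ext.
    intros k. rewrite <- Cmult_plus_distr_l, <- coef_plus by apply cc_test. reflexivity. }
  assert (Pscal : forall z (f : test), p (tmul (tconst z) f) = (z * p f)%C).
  { intros z f. apply (Clim_unique _ _ _ (L (tmul (tconst z) f))).
    eapply Clim_ext; [|apply (Clim_scal z _ _ (L f))].
    intros n. cbn beta. rewrite Cmult_assoc, (Cmult_comm z), <- Cmult_assoc, <- CW_scal.
    f_equal. apply CW_ext. intros k.
    replace (coef (tmul (tconst z) f) (- k)) with (z * coef f (- k))%C
      by (rewrite <- coef_scal by apply cc_test; reflexivity). ring. }
  assert (Pcont : exists m M, 0 <= M /\ forall (f : test) B, tbound m f B -> Cmod (p f) <= M * B).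
  { exists (m + 2)%nat, (2 * PI * (3 * (K * 2 ^ (m + 2)))).
    assert (0 < 2 ^ (m + 2)) by (apply pow_lt; lra).
    assert (0 <= K * 2 ^ (m + 2)) by nra. pose proof two_PI_pos as HP.
    split; [nra|].
    intros f B HB. specialize (D f B HB).
    apply Clim_le with (1 := L f). intros n.
    rewrite Cmod_mult, Cmod_R, Rabs_pos_eq by lra. rewrite !Rmult_assoc.
    do 2 (apply Rmult_le_compat_l; [pose proof PI_RGT_0; lra|]).
    eapply Rle_trans; [apply CW_Cmod|].
    eapply Rle_trans; [apply W_le; exact D|].
    rewrite (W_ext _ (fun k => K * (2 ^ (m + 2) * B) * / (1 + Rabs (IZR k)) ^ 2)) by reflexivity.
    rewrite W_scal. pose proof (W_inv_square_tail 0 n) as T. rewrite Nat.add_0_l in T.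
    change (W (fun k => / (1 + Rabs (IZR k)) ^ 2) 0) with (/ (1 + Rabs 0) ^ 2) in T.
    rewrite Rabs_R0 in T. change (INR 0) with 0 in T.
    replace (/ (1 + 0) ^ 2) with 1 in T by field.
    assert (HB0 : 0 <= B).
    { eapply Rle_trans; [apply Cmod_ge_0|apply (HB 0%nat 0); lia]. }
    assert (0 <= K * (2 ^ (m + 2) * B)) by (apply Rmult_le_pos; [lra|nra]).
    nra. }
  exists (mkDistr p Padd Pscal Pcont). intros k. unfold fourier. simpl pair.
  apply (Clim_unique (fun n => (p (expi (- k)) / RtoC (2 * PI))%C)); [apply Clim_const|].
  pose proof (L (expi (- k))) as Lk.
  assert (Ek : p (expi (- k)) = (RtoC (2 * PI) * c k)%C).
  { apply (Clim_unique _ _ _ Lk). apply Clim_scal.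
    assert (E : forall n, (Z.abs_nat k <= n)%nat -> CW (fun j => c j * coef (expi (- k)) (- j))%C n = c k).
    { intros n Hn. rewrite (CW_ext _ (fun j => if Z.eq_dec j k then c k else 0)%C).
      2:{ intros j. rewrite coef_expi. destruct (Z.eq_dec (- k) (- j)), (Z.eq_dec j k); try lia.
          - subst j. ring.
          - ring. }
      now apply CW_single. }
    apply Clim_of_close. intros eps Heps. exists (Z.abs_nat k). intros n Hn.
    rewrite E by exact Hn. replace (c k - c k)%C with (RtoC 0) by ring. now rewrite Cmod_0. }
  rewrite Ek. unfold Cdiv. rewrite (Cmult_comm (RtoC (2 * PI))), <- Cmult_assoc.
  rewrite Cinv_r by apply two_PI_C. rewrite Cmult_1_r. apply Clim_const.
Qed.

(** * The real Hilbert space of square-summable sequences *)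

Definition vec : Type := Z -> bool -> C.

Definition cdot (z w : C) : R := Re z * Re w + Im z * Im w.
Definition ip (x y : vec) (k : Z) : R :=
  cdot (x k true) (y k true) + cdot (x k false) (y k false).
Definition l2 (x : vec) : Prop := ex_Zseries (ip x x).
Definition dot (x y : vec) : R := Zseries (ip x y).
Definition nrm (x : vec) : R := sqrt (dot x x).
(** [x + r y], so that one identity expresses real linearity. *)
Definition vlin (r : R) (x y : vec) : vec := fun k s => (x k s + RtoC r * y k s)%C.
Definition vzero : vec := fun _ _ => 0%C.

Lemma vec_ext (x y : vec) : (forall k s, x k s = y k s) -> x = y.
Proof.
  intros H. apply functional_extensionality; intros k. apply functional_extensionality; intros s.
  apply H.
Qed.

Lemma cdot_self z : cdot z z = Cmod z ^ 2.
Proof. rewrite Cmod2_alt. unfold cdot. ring. Qed.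

Lemma cdot_sym z w : cdot z w = cdot w z.
Proof. unfold cdot. ring. Qed.

Lemma ip_self x k : ip x x k = Cmod (x k true) ^ 2 + Cmod (x k false) ^ 2.
Proof. unfold ip. now rewrite !cdot_self. Qed.

Lemma ip_pos x k : 0 <= ip x x k.
Proof. rewrite ip_self. apply Rplus_le_le_0_compat; apply pow2_ge_0. Qed.

Lemma ip_abs x y k : Rabs (ip x y k) <= ip x x k + ip y y k.
Proof.
  assert (H : forall a b : R, Rabs (a * b) <= a * a + b * b).
  { intros a b. apply Rabs_le. split; nra. }
  assert (H2 : forall z w, Rabs (cdot z w) <= cdot z z + cdot w w).
  { intros z w. unfold cdot. eapply Rle_trans; [apply Rabs_triang|].
    pose proof (H (Re z) (Re w)); pose proof (H (Im z) (Im w)). lra. }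
  unfold ip. eapply Rle_trans; [apply Rabs_triang|].
  pose proof (H2 (x k true) (y k true)); pose proof (H2 (x k false) (y k false)). lra.
Qed.

Lemma ip_sym x y k : ip x y k = ip y x k.
Proof. unfold ip. now rewrite !(cdot_sym (x k _)). Qed.

Lemma ip_lin r x y z k : ip (vlin r x y) z k = ip x z k + r * ip y z k.
Proof. unfold ip, vlin, cdot, Re, Im. simpl. ring. Qed.

Lemma ex_ip x y : l2 x -> l2 y -> ex_Zseries (ip x y).
Proof.
  intros Hx Hy. apply ex_Zseries_le with (fun k => ip x x k + ip y y k).
  - apply ip_abs.
  - now apply ex_Zseries_plus.
Qed.

Lemma l2_le x (g : Z -> R) : (forall k, ip x x k <= g k) -> ex_Zseries g -> l2 x.
Proof.
  intros H. apply ex_Zseries_le. intros k. rewrite Rabs_pos_eq by apply ip_pos. apply H.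
Qed.

Lemma l2_lin r x y : l2 x -> l2 y -> l2 (vlin r x y).
Proof.
  intros Hx Hy. apply l2_le with (fun k => 2 * ip x x k + 2 * r ^ 2 * ip y y k).
  - intros k. unfold ip, vlin, cdot, Re, Im. simpl.
    pose proof (pow2_ge_0 (fst (x k true) - r * fst (y k true))).
    pose proof (pow2_ge_0 (snd (x k true) - r * snd (y k true))).
    pose proof (pow2_ge_0 (fst (x k false) - r * fst (y k false))).
    pose proof (pow2_ge_0 (snd (x k false) - r * snd (y k false))). nra.
  - now apply ex_Zseries_plus; apply ex_Zseries_scal.
Qed.

Lemma l2_zero : l2 vzero.
Proof.
  apply ex_Zseries_bound with 0; [apply ip_pos|]. intros n.
  rewrite (W_ext _ (fun k => 0 * 0)).
  - rewrite (W_scal 0). lra.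
  - intros k. unfold ip, vzero, cdot. simpl. ring.
Qed.

Lemma dot_sym x y : dot x y = dot y x.
Proof. apply Zseries_ext. apply ip_sym. Qed.

Lemma dot_lin_l r x y z : l2 x -> l2 y -> l2 z -> dot (vlin r x y) z = dot x z + r * dot y z.
Proof.
  intros Hx Hy Hz. unfold dot. rewrite (Zseries_ext _ _ (ip_lin r x y z)).
  rewrite Zseries_plus, Zseries_scal; auto using ex_ip, ex_Zseries_scal.
Qed.

Lemma dot_lin_r r x y z : l2 x -> l2 y -> l2 z -> dot z (vlin r x y) = dot z x + r * dot z y.
Proof.
  intros Hx Hy Hz. rewrite dot_sym, dot_lin_l by assumption. now rewrite !(dot_sym z).
Qed.

Lemma dot_pos x : l2 x -> 0 <= dot x x.
Proof. intros H. apply Zseries_pos; [apply ip_pos|exact H]. Qed.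

Lemma dot_def x : l2 x -> dot x x = 0 -> x = vzero.
Proof.
  intros H E. apply vec_ext. intros k s.
  pose proof (Zseries_term (ip x x) k (ip_pos x) H) as Hk. fold (dot x x) in Hk.
  rewrite E, ip_self in Hk.
  pose proof (pow2_ge_0 (Cmod (x k true))); pose proof (pow2_ge_0 (Cmod (x k false))).
  unfold vzero. apply Cmod_eq_0.
  destruct s; nra.
Qed.

Lemma dot_zero_r x : dot x vzero = 0.
Proof.
  apply Zseries_unique. apply is_lim_seq_ext with (fun _ => 0); [|apply is_lim_seq_const].
  intros n. rewrite (W_ext _ (fun k => 0 * 0)).
  - rewrite (W_scal 0 (fun _ => 0)). ring.
  - intros k. unfold ip, vzero, cdot. simpl. ring.
Qed.

Lemma nrm_zero : nrm vzero = 0.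
Proof. unfold nrm. rewrite dot_zero_r. apply sqrt_0. Qed.

Lemma dot_lin_self r x y : l2 x -> l2 y ->
  dot (vlin r x y) (vlin r x y) = dot x x + 2 * r * dot x y + r ^ 2 * dot y y.
Proof.
  intros Hx Hy. rewrite dot_lin_l, !dot_lin_r, (dot_sym y x) by auto using l2_lin. ring.
Qed.

Lemma nrm_pos x : 0 <= nrm x.
Proof. apply sqrt_pos. Qed.

Lemma nrm_sq x : l2 x -> nrm x ^ 2 = dot x x.
Proof. intros H. apply pow2_sqrt. now apply dot_pos. Qed.

Lemma cauchy_schwarz x y : l2 x -> l2 y -> Rabs (dot x y) <= nrm x * nrm y.
Proof.
  intros Hx Hy.
  assert (H : dot x y ^ 2 <= dot x x * dot y y).
  { destruct (Req_dec (dot y y) 0) as [E|E].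
    - apply dot_def in E; [|exact Hy]. rewrite E.
      rewrite dot_zero_r. pose proof (dot_pos _ Hx); pose proof (dot_pos _ l2_zero). nra.
    - pose proof (dot_pos _ Hy) as Py.
      pose proof (dot_pos _ (l2_lin (- dot x y / dot y y) x y Hx Hy)) as P.
      rewrite dot_lin_self in P by assumption.
      replace (dot x x + 2 * (- dot x y / dot y y) * dot x y
        + (- dot x y / dot y y) ^ 2 * dot y y) with (dot x x - dot x y ^ 2 / dot y y) in P
        by (field; exact E).
      apply Rmult_le_reg_r with (/ dot y y); [apply Rinv_0_lt_compat; lra|].
      replace (dot x x * dot y y * / dot y y) with (dot x x) by (field; exact E).
      unfold Rdiv in P. lra. }
  rewrite <- (Rabs_pos_eq (nrm x * nrm y)).
  - apply Rsqr_le_abs_0. rewrite !Rsqr_pow2, Rpow_mult_distr, !nrm_sq by assumption. exact H.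
  - apply Rmult_le_pos; apply nrm_pos.
Qed.

Lemma sq_le_le a b : 0 <= b -> a ^ 2 <= b ^ 2 -> a <= b.
Proof. intros Hb H. apply Rnot_lt_le. intros L. nra. Qed.

Lemma nrm_triangle r x y : l2 x -> l2 y -> nrm (vlin r x y) <= nrm x + Rabs r * nrm y.
Proof.
  intros Hx Hy. pose proof (nrm_pos x); pose proof (nrm_pos y); pose proof (Rabs_pos r).
  apply sq_le_le; [nra|]. rewrite nrm_sq by now apply l2_lin. rewrite dot_lin_self by assumption.
  rewrite <- !nrm_sq by assumption.
  pose proof (cauchy_schwarz x y Hx Hy) as CS.
  assert (H2 : r * dot x y <= Rabs r * (nrm x * nrm y)).
  { eapply Rle_trans; [apply Rle_abs|]. rewrite Rabs_mult. now apply Rmult_le_compat_l. }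
  rewrite <- (pow2_abs r). nra.
Qed.

Lemma Cmod_le_nrm x k s : l2 x -> Cmod (x k s) <= nrm x.
Proof.
  intros H. apply sq_le_le; [apply nrm_pos|]. rewrite nrm_sq by exact H.
  pose proof (Zseries_term (ip x x) k (ip_pos x) H) as Hk. fold (dot x x) in Hk.
  rewrite ip_self in Hk.
  pose proof (pow2_ge_0 (Cmod (x k true))); pose proof (pow2_ge_0 (Cmod (x k false))).
  destruct s; lra.
Qed.

Lemma nrm_le_of_dissipation K x y : 0 <= K -> l2 x -> l2 y ->
  dot y y <= K * dot y x -> nrm y <= K * nrm x.
Proof.
  intros HK Hx Hy H. pose proof (cauchy_schwarz _ _ Hy Hx) as CS. rewrite <- nrm_sq in H by exact Hy.
  pose proof (nrm_pos x); pose proof (nrm_pos y). pose proof (Rle_abs (dot y x)).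
  destruct (Req_dec (nrm y) 0) as [E|E]; [rewrite E; nra|].
  apply Rmult_le_reg_l with (nrm y); [lra|]. nra.
Qed.

Lemma nrm_le_of_coercive c x y : l2 x -> l2 y -> c * dot x x <= dot y x -> c * nrm x <= nrm y.
Proof.
  intros Hx Hy H. pose proof (cauchy_schwarz _ _ Hy Hx) as CS. rewrite <- nrm_sq in H by exact Hx.
  pose proof (nrm_pos x); pose proof (nrm_pos y). pose proof (Rle_abs (dot y x)).
  destruct (Req_dec (nrm x) 0) as [E|E]; [rewrite E; nra|].
  apply Rmult_le_reg_r with (nrm x); [lra|]. nra.
Qed.

Lemma is_lim_W_seq (f : nat -> Z -> R) (l : Z -> R) N :
  (forall k, is_lim_seq (fun n => f n k) (l k)) -> is_lim_seq (fun n => W (f n) N) (W l N).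
Proof.
  intros H. induction N as [|N IH]; cbn [W]; [apply H|].
  apply is_lim_seq_plus'; [exact IH|]. apply is_lim_seq_plus'; apply H.
Qed.

Lemma cauchy_geometric_lim (u : nat -> R) A q : 0 <= q < 1 ->
  (forall n m, Rabs (u (n + m)%nat - u n) <= A * q ^ n) -> exists l : R, is_lim_seq u l.
Proof.
  intros Hq H. apply ex_lim_seq_cauchy_corr. intros eps.
  assert (L : is_lim_seq (fun n => A * q ^ n) 0).
  { replace (Finite 0) with (Rbar_mult A 0) by (simpl; f_equal; ring).
    apply (is_lim_seq_scal_l (fun n => q ^ n) A 0), is_lim_seq_geom.
    rewrite Rabs_pos_eq; lra. }
  apply is_lim_seq_spec in L. destruct (L (pos_div_2 eps)) as [N HN].
  exists N. intros n m Hn Hm. simpl in HN.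
  pose proof (HN N (le_n _)) as HNN. rewrite Rminus_0_r in HNN. apply Rabs_def2 in HNN.
  pose proof (H N (n - N)%nat) as H1. pose proof (H N (m - N)%nat) as H2.
  replace (N + (n - N))%nat with n in H1 by lia. replace (N + (m - N))%nat with m in H2 by lia.
  apply Rabs_def1; apply Rabs_le_between in H1, H2; lra.
Qed.

Definition vsub (x y : vec) : vec := vlin (-1) x y.

Lemma RtoC_m1 : RtoC (-1) = (- RtoC 1)%C.
Proof. apply Ceq; simpl; ring. Qed.

Ltac vec_ring := apply vec_ext; intros k s; unfold vsub, vlin, vzero;
  rewrite ?RtoC_opp, ?RtoC_m1; ring.

(** Completeness, in the form that a geometric iteration needs. *)
Lemma l2_complete (u : nat -> vec) A q : 0 <= q < 1 -> 0 <= A ->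
  (forall n, l2 (u n)) -> (forall n m, nrm (vsub (u (n + m)%nat) (u n)) <= A * q ^ n) ->
  exists x, l2 x /\ forall n, nrm (vsub (u n) x) <= A * q ^ n.
Proof.
  intros Hq HA Hu H.
  assert (Hc : forall k s, exists l, Clim (fun n => u n k s) l).
  { intros k s.
    assert (D : forall n m, Cmod (u (n + m)%nat k s - u n k s)%C <= A * q ^ n).
    { intros n m. eapply Rle_trans; [|apply (H n m)].
      replace (u (n + m)%nat k s - u n k s)%C with (vsub (u (n + m)%nat) (u n) k s)
        by (unfold vsub, vlin; rewrite RtoC_m1; ring).
      apply Cmod_le_nrm. apply l2_lin; apply Hu. }
    destruct (cauchy_geometric_lim (fun n => Re (u n k s)) A q Hq) as [a Ha].
    { intros n m. eapply Rle_trans; [|apply (D n m)].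
      apply (re_le_Cmod (u (n + m)%nat k s - u n k s)%C). }
    destruct (cauchy_geometric_lim (fun n => Im (u n k s)) A q Hq) as [b Hb].
    { intros n m. eapply Rle_trans; [|apply (D n m)].
      apply (im_le_Cmod (u (n + m)%nat k s - u n k s)%C). }
    exists (a, b). now split. }
  set (x := fun k s => epsilon (inhabits (RtoC 0)) (Clim (fun n => u n k s))).
  assert (Hx : forall k s, Clim (fun n => u n k s) (x k s)).
  { intros k s. apply epsilon_spec, Hc. }
  assert (B : forall n N, W (ip (vsub (u n) x) (vsub (u n) x)) N <= (A * q ^ n) ^ 2).
  { intros n N.
    refine (is_lim_seq_le
      (fun m => W (ip (vsub (u (m + n)%nat) (u n)) (vsub (u (m + n)%nat) (u n))) N)
      (fun _ => (A * q ^ n) ^ 2) (W _ N) ((A * q ^ n) ^ 2) _ _ (is_lim_seq_const _)).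
    - intros m. rewrite Nat.add_comm.
      eapply Rle_trans; [apply W_le_Zseries; [apply ip_pos|apply l2_lin; apply Hu]|].
      fold (dot (vsub (u (n + m)%nat) (u n)) (vsub (u (n + m)%nat) (u n))).
      rewrite <- nrm_sq by (apply l2_lin; apply Hu). apply pow_incr.
      split; [apply nrm_pos|apply H].
    - apply (is_lim_W_seq
        (fun m => ip (vsub (u (m + n)%nat) (u n)) (vsub (u (m + n)%nat) (u n)))).
      intros k.
      assert (L : forall s, is_lim_seq (fun m => Cmod (vsub (u (m + n)%nat) (u n) k s) ^ 2)
        (Cmod (vsub (u n) x k s) ^ 2)).
      { intros s.
        replace (Cmod (vsub (u n) x k s)) with (Cmod (x k s + -1 * u n k s)%C)
          by (rewrite <- Cmod_opp; f_equal; unfold vsub, vlin; rewrite RtoC_m1; ring).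
        apply (Clim_Cmod2 (fun m => vsub (u (m + n)%nat) (u n) k s)).
        apply Clim_plus; [|apply Clim_const]. destruct (Hx k s) as [H1 H2].
        split; [exact (proj1 (is_lim_seq_incr_n _ n _) H1)
               |exact (proj1 (is_lim_seq_incr_n _ n _) H2)]. }
      apply is_lim_seq_ext with (fun m => Cmod (vsub (u (m + n)%nat) (u n) k true) ^ 2
        + Cmod (vsub (u (m + n)%nat) (u n) k false) ^ 2).
      { intros m. now rewrite ip_self. }
      rewrite ip_self. apply is_lim_seq_plus'; apply L. }
  assert (L : forall n, l2 (vsub (u n) x)).
  { intros n. apply ex_Zseries_bound with ((A * q ^ n) ^ 2); [apply ip_pos|apply B]. }
  exists x. split.
  - replace x with (vsub (u 0%nat) (vsub (u 0%nat) x)); [now apply l2_lin|].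
    vec_ring.
  - intros n. apply sq_le_le; [apply Rmult_le_pos; [exact HA|now apply pow_le]|].
    rewrite nrm_sq by apply L. apply Zseries_le_bound; [apply L|apply B].
Qed.

(** ** The Lax-Milgram lemma *)

(** For small [rho] the map [z |-> z + rho (y - T z)] is a contraction. *)
Lemma lax_milgram (T : vec -> vec) (c M : R) : 0 < c -> 0 < M ->
  (forall x, l2 x -> l2 (T x)) ->
  (forall r x y, l2 x -> l2 y -> T (vlin r x y) = vlin r (T x) (T y)) ->
  (forall x, l2 x -> dot (T x) (T x) <= M * dot x x) ->
  (forall x, l2 x -> c * dot x x <= dot (T x) x) ->
  forall y, l2 y -> exists x, l2 x /\ T x = y.
Proof.
  intros Hc HM HT Hlin HB Hco y Hy.
  set (M' := M + c ^ 2). assert (HM' : 0 < M') by (unfold M'; nra).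
  set (rho := c / M'). assert (Hr : 0 < rho) by now apply Rdiv_lt_0_compat.
  set (q2 := 1 - c ^ 2 / M').
  assert (Hq2 : 0 <= q2 < 1).
  { unfold q2. assert (0 < c ^ 2 / M') by (apply Rdiv_lt_0_compat; nra).
    assert (c ^ 2 / M' <= 1).
    { apply Rmult_le_reg_r with M'; [exact HM'|]. unfold Rdiv.
      rewrite Rmult_assoc, Rinv_l by lra. unfold M'. lra. }
    lra. }
  set (q := sqrt q2).
  assert (Hqq : q ^ 2 = q2) by (apply pow2_sqrt; lra).
  assert (Hq : 0 <= q < 1).
  { pose proof (sqrt_pos q2) as P. fold q in P. split; [exact P|]. nra. }
  set (S := fun z => vlin rho z (vsub y (T z))).
  assert (HS : forall z, l2 z -> l2 (S z)) by (intros z Hz; repeat apply l2_lin; auto).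
  assert (Contr : forall z z', l2 z -> l2 z' -> nrm (vsub (S z) (S z')) <= q * nrm (vsub z z')).
  { intros z z' Hz Hz'. assert (Hw : l2 (vsub z z')) by now apply l2_lin.
    replace (vsub (S z) (S z')) with (vlin (- rho) (vsub z z') (T (vsub z z'))).
    2:{ unfold vsub at 2. rewrite Hlin by assumption. unfold S. vec_ring. }
    set (w := vsub z z') in *. pose proof (nrm_pos w).
    apply sq_le_le; [nra|]. rewrite nrm_sq by (apply l2_lin; auto).
    rewrite dot_lin_self by auto. rewrite Rpow_mult_distr, Hqq, nrm_sq by exact Hw.
    rewrite (dot_sym w (T w)). specialize (HB w Hw). specialize (Hco w Hw).
    pose proof (dot_pos w Hw) as Pw.
    assert (E1 : q2 = 1 - 2 * rho * c + rho ^ 2 * M') by (unfold q2, rho; field; lra).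
    assert (B1 : dot (T w) (T w) <= M' * dot w w) by (unfold M'; nra).
    assert (rho ^ 2 * dot (T w) (T w) <= rho ^ 2 * (M' * dot w w))
      by (apply Rmult_le_compat_l; [nra|exact B1]).
    assert (rho * (c * dot w w) <= rho * dot (T w) w)
      by (apply Rmult_le_compat_l; lra).
    rewrite E1. nra. }
  set (u := fun n => Nat.iter n S vzero).
  assert (Hu : forall n, l2 (u n)).
  { induction n as [|n IH]; [apply l2_zero|]. now apply HS. }
  set (a := nrm (vsub (u 1%nat) (u 0%nat))).
  assert (Ha : 0 <= a) by apply nrm_pos.
  assert (D1 : forall n, nrm (vsub (u (n + 1)%nat) (u n)) <= a * q ^ n).
  { induction n as [|n IH]; [simpl; fold a; unfold a, u; simpl; lra|].
    change (u (Datatypes.S n + 1)%nat) with (S (u (n + 1)%nat)).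
    change (u (Datatypes.S n)) with (S (u n)).
    eapply Rle_trans; [apply Contr; apply Hu|]. simpl. nra. }
  set (A := a / (1 - q)).
  assert (HA : 0 <= A) by (apply Rdiv_le_0_compat; lra).
  assert (D : forall n m, nrm (vsub (u (n + m)%nat) (u n)) <= A * q ^ n * (1 - q ^ m)).
  { intros n m. induction m as [|m IH].
    - rewrite Nat.add_0_r. simpl. replace (vsub (u n) (u n)) with vzero.
      + rewrite nrm_zero. lra.
      + vec_ring.
    - replace (vsub (u (n + Datatypes.S m)%nat) (u n)) with
        (vlin 1 (vsub (u (n + m + 1)%nat) (u (n + m)%nat)) (vsub (u (n + m)%nat) (u n))).
      2:{ replace (n + Datatypes.S m)%nat with (n + m + 1)%nat by lia. vec_ring. }
      eapply Rle_trans; [apply nrm_triangle; apply l2_lin; apply Hu|].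
      rewrite Rabs_R1, Rmult_1_l. specialize (D1 (n + m)%nat). rewrite pow_add in D1.
      assert (E : a = A * (1 - q)) by (unfold A; field; lra). rewrite E in D1.
      simpl. nra. }
  destruct (l2_complete u A q Hq HA Hu) as [x [Hx Hlim]].
  { intros n m. eapply Rle_trans; [apply D|].
    assert (0 <= q ^ n) by now apply pow_le. assert (0 <= q ^ m) by now apply pow_le.
    assert (0 <= A * q ^ n) by nra. nra. }
  exists x. split; [exact Hx|].
  assert (F : nrm (vsub (S x) x) = 0).
  { apply Rle_antisym; [|apply nrm_pos].
    assert (Fn : forall n, nrm (vsub (S x) x) <= 2 * A * q ^ n).
    { intros n. replace (vsub (S x) x) with
        (vlin (-1) (vsub (u (Datatypes.S n)) x) (vsub (S (u n)) (S x))).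
      2:{ change (u (Datatypes.S n)) with (S (u n)). vec_ring. }
      eapply Rle_trans; [apply nrm_triangle; apply l2_lin; auto|].
      pose proof (Hlim (Datatypes.S n)) as L1. pose proof (Hlim n) as L2.
      pose proof (Contr (u n) x (Hu n) Hx) as L3.
      assert (Rabs (-1) = 1) as -> by (rewrite Rabs_left; lra).
      rewrite <- tech_pow_Rmult in L1.
      assert (P : 0 <= A * q ^ n) by (apply Rmult_le_pos; [|apply pow_le]; lra).
      pose proof (nrm_pos (vsub (u n) x)).
      set (t := A * q ^ n) in *. replace (A * (q * q ^ n)) with (q * t) in L1 by (unfold t; ring).
      replace (2 * A * q ^ n) with (2 * t) by (unfold t; ring). nra. }
    refine (is_lim_seq_le (fun _ => nrm (vsub (S x) x)) (fun n => 2 * A * q ^ n)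
      (nrm (vsub (S x) x)) 0 Fn (is_lim_seq_const _) _).
    replace (Finite 0) with (Rbar_mult (2 * A) 0) by (simpl; f_equal; ring).
    apply (is_lim_seq_scal_l (fun n => q ^ n) (2 * A) 0), is_lim_seq_geom.
    rewrite Rabs_pos_eq; lra. }
  assert (HSx : l2 (vsub (S x) x)) by (apply l2_lin; auto).
  assert (F2 : vsub (S x) x = vzero).
  { apply dot_def; [exact HSx|]. rewrite <- nrm_sq, F by exact HSx. ring. }
  apply vec_ext; intros k s.
  apply (f_equal (fun v => v k s)) in F2. unfold S, vsub, vlin, vzero in F2.
  assert (Hrc : RtoC rho <> 0) by (intros E; injection E as E; lra).
  replace (x k s + RtoC rho * (y k s + RtoC (-1) * T x k s) + RtoC (-1) * x k s)%C
    with (RtoC rho * (y k s - T x k s))%C in F2 by (rewrite RtoC_m1; ring).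
  replace (T x k s) with (y k s - / RtoC rho * (RtoC rho * (y k s - T x k s)))%C
    by (field; exact Hrc).
  rewrite F2. ring.
Qed.

(** * Skew diagonal operators with a bounded damping *)

(** Multiplication by a function with values in [[0, K]] has the last property; it contains both
    boundedness and positivity, and survives compression by a contraction and its adjoint. *)
Definition damping (K : R) (B : vec -> vec) : Prop :=
  (forall x, l2 x -> l2 (B x)) /\
  (forall r x y, l2 x -> l2 y -> B (vlin r x y) = vlin r (B x) (B y)) /\
  (forall x, l2 x -> dot (B x) (B x) <= K * dot (B x) x).

Lemma damping_bound K B x : 0 < K -> damping K B -> l2 x -> nrm (B x) <= K * nrm x.
Proof.
  intros HK [HB1 [_ HB3]] Hx. apply nrm_le_of_dissipation; auto. lra.
Qed.

Lemma l2_comparison (x y : vec) c : 0 <= c ->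
  (forall k s, Cmod (x k s) <= c * Cmod (y k s)) -> l2 y ->
  l2 x /\ dot x x <= c ^ 2 * dot y y.
Proof.
  intros Hc H Hy.
  assert (P : forall k, ip x x k <= c ^ 2 * ip y y k).
  { intros k. rewrite !ip_self.
    assert (Q : forall s, Cmod (x k s) ^ 2 <= c ^ 2 * Cmod (y k s) ^ 2).
    { intros s. rewrite <- Rpow_mult_distr. apply pow_incr. split; [apply Cmod_ge_0|apply H]. }
    pose proof (Q true); pose proof (Q false). lra. }
  assert (Hx : l2 x) by (apply l2_le with (1 := P); now apply ex_Zseries_scal).
  split; [exact Hx|]. unfold dot. rewrite <- Zseries_scal by exact Hy.
  apply Zseries_le; [exact P|exact Hx|now apply ex_Zseries_scal].
Qed.

Definition sgn (r : R) : R := if Rlt_dec r 0 then -1 else if Rlt_dec 0 r then 1 else 0.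

Lemma sgn_mult r : sgn r * r = Rabs r.
Proof.
  unfold sgn. destruct (Rlt_dec r 0); [rewrite Rabs_left; lra|].
  destruct (Rlt_dec 0 r); [rewrite Rabs_pos_eq; lra|]. replace r with 0 by lra.
  rewrite Rabs_R0. ring.
Qed.

Lemma sgn_abs_le r : Rabs (sgn r) <= 1.
Proof.
  unfold sgn. destruct (Rlt_dec r 0); [rewrite Rabs_left; lra|].
  destruct (Rlt_dec 0 r); [rewrite Rabs_R1|rewrite Rabs_R0]; lra.
Qed.

Lemma sgn_0 : sgn 0 = 0.
Proof. unfold sgn. destruct (Rlt_dec 0 0); lra. Qed.

Lemma nrm_comparison (x y : vec) c : 0 <= c ->
  (forall k s, Cmod (x k s) <= c * Cmod (y k s)) -> l2 y -> nrm x <= c * nrm y.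
Proof.
  intros Hc H Hy. destruct (l2_comparison x y c Hc H Hy) as [Hx Hd].
  apply sq_le_le; [apply Rmult_le_pos; [exact Hc|apply nrm_pos]|].
  now rewrite Rpow_mult_distr, !nrm_sq.
Qed.

Definition root_weight (d : Z -> bool -> R) k s : R := sqrt (1 + Rabs (d k s)).

Definition unweight (d : Z -> bool -> R) (z : vec) : vec :=
  fun k s => (RtoC (/ root_weight d k s) * z k s)%C.

(** Conjugated, because it moves from the test vector [(1 + i theta sgn d) x] to the equation. *)
Definition twist (d : Z -> bool -> R) (theta : R) k s : C :=
  (1 - Ci * RtoC (theta * sgn (d k s)))%C.

(** With [x] the unweighted [z], [<twisted z, z>] is [i d x + B x] tested against
    [(1 + i theta sgn d) x]. *)
Definition twisted (d : Z -> bool -> R) (theta : R) (B : vec -> vec) (z : vec) : vec := fun k s =>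
  (RtoC (/ root_weight d k s) * (twist d theta k s *
    (Ci * RtoC (d k s) * unweight d z k s + B (unweight d z) k s)))%C.

Lemma root_weight_spec d k s :
  root_weight d k s ^ 2 = 1 + Rabs (d k s) /\ 1 <= root_weight d k s /\
  0 < / root_weight d k s <= 1.
Proof.
  unfold root_weight. pose proof (Rabs_pos (d k s)). pose proof (sqrt_pos (1 + Rabs (d k s))) as P.
  assert (E : sqrt (1 + Rabs (d k s)) ^ 2 = 1 + Rabs (d k s)) by (apply pow2_sqrt; lra).
  set (w := sqrt (1 + Rabs (d k s))) in *. assert (W1 : 1 <= w) by nra.
  repeat split; try assumption; [apply Rinv_0_lt_compat; lra|].
  rewrite <- Rinv_1. apply Rinv_le_contravar; lra.
Qed.

Lemma Cmod_twist d theta k s : 0 < theta -> Cmod (twist d theta k s) <= 1 + theta.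
Proof.
  intros Hth. unfold twist. eapply Rle_trans; [apply Cmod_triangle|].
  rewrite Cmod_1, Cmod_opp, Cmod_mult, Cmod_Ci, Cmod_R, Rabs_mult, (Rabs_pos_eq theta) by lra.
  pose proof (sgn_abs_le (d k s)). nra.
Qed.

Lemma Cmod_twist_unweight d theta k s z : 0 < theta ->
  Cmod (RtoC (/ root_weight d k s) * (twist d theta k s * z)) <= (1 + theta) * Cmod z.
Proof.
  intros Hth. rewrite !Cmod_mult, Cmod_R. destruct (root_weight_spec d k s) as [_ [_ W]].
  rewrite Rabs_pos_eq by lra. pose proof (Cmod_twist d theta k s Hth).
  pose proof (Cmod_ge_0 z). pose proof (Cmod_ge_0 (twist d theta k s)).
  assert (0 <= Cmod (twist d theta k s) * Cmod z) by nra.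
  apply Rle_trans with (Cmod (twist d theta k s) * Cmod z); nra.
Qed.

Lemma unweight_lin d r x y : unweight d (vlin r x y) = vlin r (unweight d x) (unweight d y).
Proof. unfold unweight. vec_ring. Qed.

Lemma unweight_bound d z : l2 z -> l2 (unweight d z) /\ nrm (unweight d z) <= nrm z.
Proof.
  intros Hz.
  assert (P : forall k s, Cmod (unweight d z k s) <= 1 * Cmod (z k s)).
  { intros k s. unfold unweight. rewrite Cmod_mult, Cmod_R.
    destruct (root_weight_spec d k s) as [_ [_ W]].
    rewrite Rabs_pos_eq by lra. pose proof (Cmod_ge_0 (z k s)). nra. }
  split; [apply (l2_comparison _ z 1 Rle_0_1 P Hz)|].
  rewrite <- (Rmult_1_l (nrm z)). exact (nrm_comparison _ z 1 Rle_0_1 P Hz).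
Qed.

Lemma twisted_bounded d theta B K z : 0 < theta -> 0 < K -> damping K B -> l2 z ->
  l2 (twisted d theta B z) /\ nrm (twisted d theta B z) <= (1 + theta) * (1 + K) * nrm z.
Proof.
  intros Hth HK HB Hz. destruct (unweight_bound d z Hz) as [Hx Hxz]. set (x := unweight d z) in *.
  pose proof (proj1 HB x Hx) as HBx. pose proof (damping_bound K B x HK HB Hx) as Nb.
  set (T1 := (fun k s => RtoC (/ root_weight d k s) *
    (twist d theta k s * (Ci * RtoC (d k s) * x k s)))%C : vec).
  set (T2 := (fun k s => RtoC (/ root_weight d k s) * (twist d theta k s * B x k s))%C : vec).
  assert (E : twisted d theta B z = vlin 1 T1 T2).
  { unfold twisted, T1, T2. fold x. vec_ring. }
  (* one factor of the weight in x, the other one outside: together they balance d *)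
  assert (P1 : forall k s, Cmod (T1 k s) <= (1 + theta) * Cmod (z k s)).
  { intros k s. unfold T1, x, unweight.
    replace (RtoC (/ root_weight d k s) * (twist d theta k s *
      (Ci * RtoC (d k s) * (RtoC (/ root_weight d k s) * z k s))))%C with
      (twist d theta k s * (Ci * RtoC (d k s * / root_weight d k s ^ 2) * z k s))%C
      by (rewrite <- pow_inv; simpl pow; rewrite !RtoC_mult; ring).
    destruct (root_weight_spec d k s) as [W2 [W1 _]].
    pose proof (Cmod_twist d theta k s Hth). pose proof (Cmod_ge_0 (z k s)).
    rewrite !Cmod_mult, Cmod_Ci, Cmod_R, Rabs_mult, W2, Rmult_1_l.
    pose proof (Rabs_pos (d k s)) as Pd.
    rewrite (Rabs_pos_eq (/ _)) by (left; apply Rinv_0_lt_compat; lra).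
    assert (Rabs (d k s) * / (1 + Rabs (d k s)) <= 1).
    { apply Rmult_le_reg_r with (1 + Rabs (d k s)); [lra|].
      rewrite Rmult_assoc, Rinv_l by lra. lra. }
    apply Rmult_le_compat; [apply Cmod_ge_0| |assumption|nra].
    apply Rmult_le_pos; [|assumption]. apply Rmult_le_pos; [exact Pd|].
    left; apply Rinv_0_lt_compat; lra. }
  assert (P2 : forall k s, Cmod (T2 k s) <= (1 + theta) * Cmod (B x k s)).
  { intros k s. now apply Cmod_twist_unweight. }
  assert (Ht : 0 <= 1 + theta) by lra.
  destruct (l2_comparison T1 z _ Ht P1 Hz) as [H1 _].
  destruct (l2_comparison T2 (B x) _ Ht P2 HBx) as [H2 _].
  pose proof (nrm_comparison T1 z _ Ht P1 Hz) as N1.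
  pose proof (nrm_comparison T2 (B x) _ Ht P2 HBx) as N2.
  rewrite E. split; [now apply l2_lin|]. eapply Rle_trans; [now apply nrm_triangle|].
  rewrite Rabs_R1, Rmult_1_l.
  assert (K * nrm x <= K * nrm z) by (apply Rmult_le_compat_l; lra).
  assert ((1 + theta) * nrm (B x) <= (1 + theta) * (K * nrm z)) by (apply Rmult_le_compat_l; lra).
  lra.
Qed.

(** The test gives [theta |d| |x|^2 + <Bx, x> + theta <Bx, i sgn(d) x>]. For small [theta] the last
    term is absorbed by the dissipation and by the modes with [d <> 0], which [|d|] controls.
    The modes with [d = 0] are controlled by the dissipation, as [B] is positive there. *)
Lemma twisted_coercive (d : Z -> bool -> R) (B : vec -> vec) (K delta kappa : R) :
  0 < K -> 0 < delta -> 0 < kappa -> damping K B ->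
  (forall k s, d k s = 0 \/ delta <= Rabs (d k s)) ->
  (forall x, l2 x -> (forall k s, d k s <> 0 -> x k s = 0) -> kappa * dot x x <= dot (B x) x) ->
  exists c, 0 < c /\ forall z, l2 z -> c * dot z z <= dot (twisted d (delta / K) B z) z.
Proof.
  intros HK Hdelta Hkappa HB Hd Hker. pose proof HB as [HB1 [HB2 HB3]].
  set (theta := delta / K). assert (Hth : 0 < theta) by now apply Rdiv_lt_0_compat.
  (* with a = sum |d| |x|^2 and b = |B x|, the form is at least theta a / 2 + b^2 / (2 K), and |z|^2 is
     at most a linear combination of a and b^2; 1/c is the sum of the two ratios *)
  set (c := / (2 * (1 + 1 / delta + 2 * K ^ 2 / (delta * kappa ^ 2)) / theta + 4 * K / kappa ^ 2)).
  assert (Hk2 : 0 < kappa ^ 2) by (apply pow_lt; lra).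
  assert (HA : 0 < 1 + 1 / delta + 2 * K ^ 2 / (delta * kappa ^ 2)).
  { assert (0 < 1 / delta) by (apply Rdiv_lt_0_compat; lra).
    assert (0 < 2 * K ^ 2 / (delta * kappa ^ 2)) by (apply Rdiv_lt_0_compat; nra). lra. }
  assert (Hc1 : 0 < 2 * (1 + 1 / delta + 2 * K ^ 2 / (delta * kappa ^ 2)) / theta)
    by (apply Rdiv_lt_0_compat; lra).
  assert (Hc2 : 0 < 4 * K / kappa ^ 2) by (apply Rdiv_lt_0_compat; lra).
  assert (Hc : 0 < c) by (apply Rinv_0_lt_compat; lra).
  exists c. split; [exact Hc|].
  intros z Hz. destruct (unweight_bound d z Hz) as [Hx _]. set (x := unweight d z) in *.
  set (px := fun k s => if Req_EM_T (d k s) 0 then RtoC 0 else x k s).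
  set (qx := vsub x px).
  set (sx := fun k s => (Ci * RtoC (sgn (d k s)) * x k s)%C).
  assert (Hpx : l2 px).
  { apply (l2_comparison px x 1); [lra| |exact Hx]. intros k s. unfold px.
    pose proof (Cmod_ge_0 (x k s)).
    destruct (Req_EM_T (d k s) 0); [rewrite Cmod_0; lra|lra]. }
  assert (Hqx : l2 qx) by now apply l2_lin.
  assert (Hsx : l2 sx /\ dot sx sx <= 1 ^ 2 * dot px px).
  { apply l2_comparison; [lra| |exact Hpx]. intros k s. unfold sx, px.
    rewrite !Cmod_mult, Cmod_Ci, Cmod_R. destruct (Req_EM_T (d k s) 0) as [E|E].
    - rewrite E, sgn_0, Rabs_R0, Cmod_0. lra.
    - pose proof (sgn_abs_le (d k s)). pose proof (Cmod_ge_0 (x k s)). nra. }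
  destruct Hsx as [Hsx Hsp].
  set (dx := fun k => Rabs (d k true) * Cmod (x k true) ^ 2 + Rabs (d k false) * Cmod (x k false) ^ 2).
  assert (Hzx : forall k, ip z z k = ip x x k + dx k).
  { intros k. rewrite !ip_self. unfold dx, x, unweight. rewrite !Cmod_mult, !Cmod_R.
    destruct (root_weight_spec d k true) as [W1 [W2 W3]].
    destruct (root_weight_spec d k false) as [W4 [W5 W6]].
    rewrite (Rabs_pos_eq (/ root_weight d k true)), (Rabs_pos_eq (/ root_weight d k false)) by lra.
    replace (Rabs (d k true)) with (root_weight d k true ^ 2 - 1) by lra.
    replace (Rabs (d k false)) with (root_weight d k false ^ 2 - 1) by lra. field. lra. }
  assert (Hdx : ex_Zseries dx).
  { apply ex_Zseries_ext with (fun k => ip z z k + -1 * ip x x k).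
    - intros k. rewrite Hzx. ring.
    - apply ex_Zseries_plus; [exact Hz|]. now apply ex_Zseries_scal. }
  set (a := Zseries dx).
  assert (Ez : dot z z = dot x x + a).
  { unfold dot. rewrite (Zseries_ext _ _ Hzx). now apply Zseries_plus. }
  pose proof (HB1 x Hx) as HBx.
  assert (ET : dot (twisted d theta B z) z = theta * a + dot (B x) x + theta * dot (B x) sx).
  { pose proof (ex_ip _ _ HBx Hx) as X1. pose proof (ex_ip _ _ HBx Hsx) as X2.
    unfold dot, a. rewrite <- (Zseries_scal theta dx Hdx).
    rewrite <- (Zseries_scal theta _ X2).
    rewrite <- (Zseries_plus _ _ (ex_Zseries_scal theta dx Hdx) X1).
    rewrite <- (Zseries_plus _ _ (ex_Zseries_plus _ _ (ex_Zseries_scal theta dx Hdx) X1)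
      (ex_Zseries_scal theta _ X2)).
    apply Zseries_ext. intros k.
    assert (Q : forall s, cdot (twisted d theta B z k s) (z k s) = theta * (Rabs (d k s) * Cmod (x k s) ^ 2)
      + cdot (B x k s) (x k s) + theta * cdot (B x k s) (sx k s)).
    { intros s. rewrite <- sgn_mult. rewrite Cmod2_alt.
      destruct (root_weight_spec d k s) as [_ [W1 _]].
      replace (z k s) with (RtoC (root_weight d k s) * x k s)%C.
      2:{ unfold x, unweight. rewrite Cmult_assoc, <- RtoC_mult, Rinv_r, Cmult_1_l by lra.
          reflexivity. }
      unfold twisted. fold x. unfold sx, twist, cdot, Re, Im. simpl. field. lra. }
    unfold ip at 1. rewrite !Q. unfold dx, ip. ring. }
  assert (Hp : delta * dot px px <= a).
  { unfold a, dot. rewrite <- Zseries_scal by exact Hpx.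
    apply Zseries_le; [|now apply ex_Zseries_scal|exact Hdx].
    intros k. rewrite ip_self. unfold dx.
    assert (Q : forall s, delta * Cmod (px k s) ^ 2 <= Rabs (d k s) * Cmod (x k s) ^ 2).
    { intros s. unfold px. pose proof (pow2_ge_0 (Cmod (x k s))).
      destruct (Req_EM_T (d k s) 0) as [E|E].
      - rewrite E, Rabs_R0, Cmod_0. simpl. lra.
      - destruct (Hd k s) as [E'|E']; [easy|]. nra. }
    pose proof (Q true); pose proof (Q false). lra. }
  pose proof (HB3 x Hx) as Hb. rewrite <- nrm_sq in Hb by exact HBx.
  rewrite <- nrm_sq in Hp, Hsp by assumption. rewrite <- (nrm_sq px) in Hsp by assumption.
  set (b := nrm (B x)) in *. set (p := nrm px) in *.
  assert (Pb : 0 <= b) by apply nrm_pos. assert (Pp : 0 <= p) by apply nrm_pos.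
  assert (Hss : nrm sx <= p) by (apply sq_le_le; lra).
  pose proof (cauchy_schwarz (B x) sx HBx Hsx) as CS. fold b in CS.
  assert (CS' : - (b * p) <= dot (B x) sx).
  { apply Rabs_le_between in CS. nra. }
  (* qx lives in the kernel of d, where B is positive, and B qx differs from B x by B px *)
  set (q := nrm qx). assert (Pq : 0 <= q) by apply nrm_pos.
  assert (Hq : kappa * q <= b + K * p).
  { assert (Hq0 : forall k s, d k s <> 0 -> qx k s = 0).
    { intros k s E. unfold qx, vsub, vlin, px. destruct (Req_EM_T (d k s) 0); [easy|].
      rewrite RtoC_m1. ring. }
    pose proof (Hker qx Hqx Hq0) as H1. pose proof (HB1 qx Hqx) as HBq.
    apply nrm_le_of_coercive in H1; [|assumption|assumption]. fold q in H1.
    assert (H4 : nrm (B qx) <= b + K * p).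
    { unfold qx, vsub. rewrite HB2 by assumption.
      eapply Rle_trans; [apply nrm_triangle; auto|].
      rewrite Rabs_left by lra. pose proof (damping_bound K B px HK HB Hpx) as H5.
      fold p in H5. fold b. lra. }
    lra. }
  assert (Hxx : dot x x = p ^ 2 + q ^ 2).
  { unfold p, q. rewrite !nrm_sq by assumption. unfold dot.
    rewrite <- Zseries_plus by assumption. apply Zseries_ext. intros k. rewrite !ip_self.
    assert (Q : forall s, Cmod (x k s) ^ 2 = Cmod (px k s) ^ 2 + Cmod (qx k s) ^ 2).
    { intros s. unfold qx, vsub, vlin, px. destruct (Req_EM_T (d k s) 0).
      - replace (x k s + RtoC (-1) * 0)%C with (x k s) by ring. rewrite Cmod_0. ring.
      - replace (x k s + RtoC (-1) * x k s)%C with (RtoC 0) by (rewrite RtoC_m1; ring).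
        rewrite Cmod_0. ring. }
    rewrite !Q. ring. }
  rewrite Ez, ET, Hxx.
  assert (Low : theta * a / 2 + b ^ 2 / (2 * K) <= theta * a + dot (B x) x + theta * dot (B x) sx).
  { assert (L1 : b ^ 2 / K <= dot (B x) x).
    { apply Rmult_le_reg_r with K; [exact HK|]. unfold Rdiv.
      rewrite Rmult_assoc, Rinv_l by lra. lra. }
    assert (L2 : theta * (b * p) <= b ^ 2 / (2 * K) + theta * a / 2).
    { apply Rle_trans with (b ^ 2 / (2 * K) + K * theta ^ 2 * p ^ 2 / 2).
      - assert (E : b ^ 2 / (2 * K) + K * theta ^ 2 * p ^ 2 / 2 - theta * (b * p)
          = (b - K * theta * p) ^ 2 / (2 * K)) by (field; lra).
        assert (0 <= (b - K * theta * p) ^ 2 / (2 * K)).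
        { apply Rdiv_le_0_compat; [apply pow2_ge_0|lra]. }
        lra.
      - assert (E : K * theta = delta) by (unfold theta; field; lra).
        assert (E2 : K * theta ^ 2 * p ^ 2 = theta * (delta * p ^ 2)) by (rewrite <- E; ring).
        rewrite E2. nra. }
    assert (E3 : b ^ 2 / K = 2 * (b ^ 2 / (2 * K))) by (field; lra).
    nra. }
  eapply Rle_trans; [|exact Low].
  assert (Up : p ^ 2 + q ^ 2 + a <= a * (1 + 1 / delta + 2 * K ^ 2 / (delta * kappa ^ 2)) + 2 * b ^ 2 / kappa ^ 2).
  { assert (U1 : p ^ 2 <= a * (1 / delta)).
    { apply Rmult_le_reg_l with delta; [lra|]. replace (delta * (a * (1 / delta))) with a by (field; lra). lra. }
    assert (U2 : kappa ^ 2 * q ^ 2 <= 2 * b ^ 2 + 2 * K ^ 2 * p ^ 2).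
    { rewrite <- Rpow_mult_distr.
      apply Rle_trans with ((b + K * p) ^ 2); [apply pow_incr; nra|].
      pose proof (pow2_ge_0 (b - K * p)). nra. }
    assert (U3 : q ^ 2 <= 2 * b ^ 2 / kappa ^ 2 + a * (2 * K ^ 2 / (delta * kappa ^ 2))).
    { apply Rmult_le_reg_l with (kappa ^ 2); [lra|].
      replace (kappa ^ 2 * (2 * b ^ 2 / kappa ^ 2 + a * (2 * K ^ 2 / (delta * kappa ^ 2))))
        with (2 * b ^ 2 + 2 * K ^ 2 * (a * (1 / delta))) by (field; lra).
      pose proof (pow2_ge_0 K). nra. }
    lra. }
  assert (Pa : 0 <= a) by nra.
  apply Rle_trans with (c * (a * (1 + 1 / delta + 2 * K ^ 2 / (delta * kappa ^ 2)) + 2 * b ^ 2 / kappa ^ 2)).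
  { apply Rmult_le_compat_l; lra. }
  set (A := 1 + 1 / delta + 2 * K ^ 2 / (delta * kappa ^ 2)) in *.
  assert (V1 : c * A <= theta / 2).
  { replace (theta / 2) with (/ (2 * A / theta) * A) by (field; lra).
    apply Rmult_le_compat_r; [lra|]. apply Rinv_le_contravar; lra. }
  assert (V2 : c * (2 / kappa ^ 2) <= 1 / (2 * K)).
  { replace (1 / (2 * K)) with (/ (4 * K / kappa ^ 2) * (2 / kappa ^ 2)) by (field; lra).
    apply Rmult_le_compat_r; [left; apply Rdiv_lt_0_compat; lra|]. apply Rinv_le_contravar; lra. }
  pose proof (pow2_ge_0 b).
  replace (c * (a * A + 2 * b ^ 2 / kappa ^ 2)) with (c * A * a + c * (2 / kappa ^ 2) * b ^ 2) by (field; lra).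
  replace (theta * a / 2 + b ^ 2 / (2 * K)) with (theta / 2 * a + 1 / (2 * K) * b ^ 2) by (field; lra).
  apply Rplus_le_compat; apply Rmult_le_compat_r; assumption.
Qed.

Lemma damped_diagonal_solvable (d : Z -> bool -> R) (B : vec -> vec) (K delta kappa : R) :
  0 < K -> 0 < delta -> 0 < kappa -> damping K B ->
  (forall k s, d k s = 0 \/ delta <= Rabs (d k s)) ->
  (forall x, l2 x -> (forall k s, d k s <> 0 -> x k s = 0) -> kappa * dot x x <= dot (B x) x) ->
  (forall y, l2 y -> exists x, l2 x /\ forall k s, (Ci * RtoC (d k s) * x k s + B x k s = y k s)%C) /\
  (exists M, 0 <= M /\ forall x y, l2 x -> l2 y ->
    (forall k s, (Ci * RtoC (d k s) * x k s + B x k s = y k s)%C) -> nrm x <= M * nrm y).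
Proof.
  intros HK Hdelta Hkappa HB Hd Hker. pose proof HB as [HB1 [HB2 HB3]].
  destruct (twisted_coercive d B K delta kappa HK Hdelta Hkappa HB Hd Hker) as [c [Hc Hco]].
  set (theta := delta / K) in *. assert (Hth : 0 < theta) by now apply Rdiv_lt_0_compat.
  set (T := twisted d theta B) in *. set (M := (1 + theta) * (1 + K)).
  assert (HM : 0 < M) by (unfold M; nra).
  assert (HT : forall z, l2 z -> l2 (T z) /\ nrm (T z) <= M * nrm z)
    by (intros z; now apply twisted_bounded).
  set (w := root_weight d) in *. set (j := twist d theta) in *.
  assert (Hj : forall k s, j k s <> 0).
  { intros k s E. apply (f_equal Re) in E. unfold j, twist in E. simpl in E. lra. }
  assert (Hw : forall k s, w k s <> 0).
  { intros k s E. destruct (root_weight_spec d k s) as [_ [W _]]. fold w in W. lra. }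
  assert (Hwc : forall k s, RtoC (w k s) <> 0).
  { intros k s E. injection E as E. now apply (Hw k s). }
  split.
  - intros y Hy.
    destruct (lax_milgram T c (M ^ 2)) with
      (y := fun k s => (RtoC (/ w k s) * (j k s * y k s))%C) as [z [Hz Ez]].
    + exact Hc.
    + now apply pow_lt.
    + intros x Hx. now apply HT.
    + intros r x y' Hx Hy'. unfold T, twisted.
      rewrite !unweight_lin, HB2 by now apply unweight_bound. vec_ring.
    + intros x Hx. destruct (HT x Hx) as [H1 H2]. rewrite <- !nrm_sq, <- Rpow_mult_distr by assumption.
      apply pow_incr. split; [apply nrm_pos|exact H2].
    + exact Hco.
    + apply (l2_comparison _ y (1 + theta)); [lra| |exact Hy]. intros k s.
      now apply Cmod_twist_unweight.
    + exists (unweight d z). split; [now apply unweight_bound|]. intros k s.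
      apply (f_equal (fun v => v k s)) in Ez. unfold T, twisted in Ez. fold w j in Ez.
      set (L := (Ci * RtoC (d k s) * unweight d z k s + B (unweight d z) k s)%C) in *.
      replace L with (RtoC (w k s) / j k s * (RtoC (/ w k s) * (j k s * L)))%C.
      2:{ rewrite RtoC_inv by apply Hw. field. split; [apply Hwc|apply Hj]. }
      rewrite Ez, RtoC_inv by apply Hw. field. split; [apply Hwc|apply Hj].
  - exists ((1 + theta) / c). split; [apply Rdiv_le_0_compat; lra|].
    intros x y Hx Hy E.
    set (z := fun k s => (RtoC (w k s) * x k s)%C).
    assert (EX : unweight d z = x).
    { unfold unweight, z. fold w. apply vec_ext; intros k s.
      rewrite RtoC_inv by apply Hw. field. apply Hwc. }
    (* (1 + |d|) |x|^2 <= 2 |x|^2 + |d x|^2, and d x is square summable by the equation *)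
    assert (Hz : l2 z).
    { set (v := vsub y (B x)). assert (Hv : l2 v) by (apply l2_lin; auto).
      apply l2_le with (fun k => 2 * ip x x k + ip v v k).
      - intros k. rewrite !ip_self.
        assert (Q : forall s, Cmod (z k s) ^ 2 <= 2 * Cmod (x k s) ^ 2 + Cmod (v k s) ^ 2).
        { intros s. unfold z, v, vsub, vlin. rewrite <- E.
          replace (Ci * RtoC (d k s) * x k s + B x k s + RtoC (-1) * B x k s)%C
            with (Ci * RtoC (d k s) * x k s)%C by (rewrite RtoC_m1; ring).
          destruct (root_weight_spec d k s) as [W _]. fold w in W.
          rewrite !Cmod_mult, Cmod_Ci, !Cmod_R, !Rpow_mult_distr, pow2_abs, W, pow1.
          pose proof (pow2_ge_0 (Cmod (x k s))).
          pose proof (pow2_ge_0 (Rabs (d k s) - 1)). pose proof (Rabs_pos (d k s)).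
          assert (1 + Rabs (d k s) <= 2 + Rabs (d k s) ^ 2) by nra. nra. }
        pose proof (Q true); pose proof (Q false). lra.
      - apply ex_Zseries_plus; [now apply ex_Zseries_scal|exact Hv]. }
    pose proof (Hco z Hz) as Co. destruct (HT z Hz) as [HTz _].
    apply nrm_le_of_coercive in Co; [|assumption|assumption].
    destruct (unweight_bound d z Hz) as [_ Nx]. rewrite EX in Nx.
    assert (Ny : nrm (T z) <= (1 + theta) * nrm y).
    { apply nrm_comparison; [lra| |exact Hy]. intros k s. unfold T, twisted. rewrite EX, E.
      now apply Cmod_twist_unweight. }
    apply Rmult_le_reg_l with c; [exact Hc|].
    replace (c * ((1 + theta) / c * nrm y)) with ((1 + theta) * nrm y) by (field; lra). nra.
Qed.

(** * Multiplication by a nonnegative function on the Fourier side *)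

Lemma distr_inhabited : inhabited distr.
Proof.
  destruct (distr_exists (fun _ => 0%C)) as [v _]; [|now constructor].
  exists 0%nat, 0. intros k. rewrite Cmod_0. lra.
Qed.

Definition synth (c : Z -> C) : distr :=
  epsilon distr_inhabited (fun v => forall k, fourier v k = c k).

Lemma fourier_synth c k : polygrowth c -> fourier (synth c) k = c k.
Proof. intros H. exact (epsilon_spec distr_inhabited _ (distr_exists c H) k). Qed.

Lemma polygrowth_l2 x s : l2 x -> polygrowth (fun k => x k s).
Proof.
  intros H. exists 0%nat, (nrm x). intros k. rewrite pow_O, Rmult_1_r. now apply Cmod_le_nrm.
Qed.

(** The convolution theorem. *)
Lemma fourier_dmul (q : test) (v : distr) k :
  Clim (CW (fun j => coef q (k - j) * fourier v j)%C) (fourier (dmul q v) k).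
Proof.
  pose proof (Clim_scal (/ RtoC (2 * PI))%C _ _ (pair_Clim v (tmul q (expi (- k))))) as H.
  unfold fourier at 2. simpl pair. unfold Cdiv. rewrite Cmult_comm.
  revert H. apply Clim_ext. intros n. cbn beta.
  rewrite Cmult_assoc, Cinv_l, Cmult_1_l by apply two_PI_C.
  rewrite <- CW_flip. apply CW_ext. intros j. rewrite Z.opp_involutive.
  f_equal. change (tfun (tmul q (expi (- k)))) with (fun x => q x * expi (- k) x)%C.
  rewrite coef_mul_expi. f_equal. lia.
Qed.

(** Parseval's identity against a trigonometric polynomial. *)
Lemma mean_conj_tsum (f : R -> C) c n : cc f ->
  mean (fun x => f x * Cconj (tsum c n x))%C = CW (fun k => coef f k * Cconj (c k))%C n.
Proof.
  intros Hf.
  assert (Q : forall a k, mean (fun x => f x * Cconj (a * expi k x))%C = (coef f k * Cconj a)%C).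
  { intros a k. rewrite Cmult_comm. unfold coef. rewrite <- mean_scal by now apply cc_coef.
    apply mean_ext. intros x _. rewrite Cmult_conj, expi_conj. ring. }
  assert (Qc : forall a k, cc (fun x => f x * Cconj (a * expi k x))%C).
  { intros a k. replace (fun x => f x * Cconj (a * expi k x))%C
      with (fun x => Cconj a * (f x * expi (- k) x))%C.
    - apply cc_mult; [apply cc_const|now apply cc_coef].
    - apply functional_extensionality. intros x. rewrite Cmult_conj, expi_conj. ring. }
  assert (K : cc (fun x => f x * Cconj (tsum c n x))%C /\
    mean (fun x => f x * Cconj (tsum c n x))%C = CW (fun k => coef f k * Cconj (c k))%C n).
  { induction n as [|n [IH1 IH2]].
    - split; [exact (Qc (c 0%Z) 0%Z)|]. rewrite CW_0. exact (Q (c 0%Z) 0%Z).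
    - set (k := Z.of_nat (S n)).
      replace (fun x => f x * Cconj (tsum c (S n) x))%C with
        (fun x => f x * Cconj (tsum c n x) + (f x * Cconj (c k * expi k x)
          + f x * Cconj (c (- k)%Z * expi (- k) x)))%C.
      + split.
        * apply cc_plus; [exact IH1|]. now apply cc_plus.
        * rewrite (mean_plus (fun x => f x * Cconj (tsum c n x))%C) by (try apply cc_plus; auto).
          rewrite mean_plus by auto. rewrite !Q, IH2, CW_S. reflexivity.
      + apply functional_extensionality. intros x. cbn [tsum tadd tmul tconst tfun].
        fold k. rewrite !Cplus_conj. ring. }
  apply K.
Qed.

Lemma coef_tmul_tsum (q : test) c n k :
  coef (tmul q (tsum c n)) k = CW (fun j => coef q (k - j) * c j)%C n.
Proof.
  assert (Q : forall (t : test) a j, coef (tmul q (tmul (tconst a) t)) j = (a * coef (tmul q t) j)%C).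
  { intros t a j. rewrite <- coef_scal by apply cc_test. apply coef_ext. intros x _.
    cbn [tmul tconst tfun]. ring. }
  assert (Q2 : forall j, coef (tmul q (expi j)) k = coef q (k - j)) by (intros j; apply coef_mul_expi).
  assert (Q3 : forall s t : test, coef (tmul q (tadd s t)) k = (coef (tmul q s) k + coef (tmul q t) k)%C).
  { intros s t. rewrite <- coef_plus by apply cc_test. apply coef_ext. intros x _.
    cbn [tmul tadd tfun]. ring. }
  induction n as [|n IH]; cbn [tsum].
  - rewrite CW_0, Q, Q2. ring.
  - rewrite CW_S, !Q3, IH, !Q, !Q2. ring.
Qed.

Definition trunc (n : nat) (x : vec) : vec :=
  fun k s => if Z_le_dec (Z.abs k) (Z.of_nat n) then x k s else 0%C.

Lemma Zseries_finite f n : (forall k, (Z.of_nat n < Z.abs k)%Z -> f k = 0) ->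
  ex_Zseries f /\ Zseries f = W f n.
Proof.
  intros H.
  assert (L : is_lim_seq (W f) (W f n)).
  { apply is_lim_seq_incr_n with n. apply is_lim_seq_ext with (fun _ => W f n).
    - intros m. induction m as [|m IH]; [reflexivity|].
      rewrite Nat.add_succ_l. cbn [W]. rewrite <- IH, !H by lia. ring.
    - apply is_lim_seq_const. }
  split; [now apply is_lim_W_ex with (W f n)|now apply Zseries_unique].
Qed.

Lemma l2_finite (x : vec) n : (forall k s, (Z.of_nat n < Z.abs k)%Z -> x k s = 0%C) -> l2 x.
Proof.
  intros H. apply (Zseries_finite (ip x x) n). intros k Hk.
  rewrite ip_self, !H, Cmod_0 by exact Hk. ring.
Qed.

Lemma trunc_out n x k s : (Z.of_nat n < Z.abs k)%Z -> trunc n x k s = 0%C.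
Proof. intros H. unfold trunc. destruct (Z_le_dec _ _); [lia|reflexivity]. Qed.

Lemma trunc_in n x k s : (Z.abs k <= Z.of_nat n)%Z -> trunc n x k s = x k s.
Proof. intros H. unfold trunc. destruct (Z_le_dec _ _); [reflexivity|lia]. Qed.

Lemma l2_trunc n x : l2 (trunc n x).
Proof. apply (l2_finite (trunc n x) n). intros k s. apply trunc_out. Qed.

Lemma dot_trunc_tail n x : l2 x ->
  dot (vsub x (trunc n x)) (vsub x (trunc n x)) = dot x x - W (ip x x) n.
Proof.
  intros Hx. unfold vsub. rewrite dot_lin_self by auto using l2_trunc.
  assert (E : forall y, (forall k, (Z.abs k <= Z.of_nat n)%Z -> ip y (trunc n x) k = ip x x k) ->
    dot y (trunc n x) = W (ip x x) n).
  { intros y Hy. destruct (Zseries_finite (ip y (trunc n x)) n) as [_ E].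
    - intros k Hk. unfold ip. rewrite !trunc_out by exact Hk. unfold cdot. simpl. ring.
    - unfold dot. rewrite E. apply W_ext_in. exact Hy. }
  rewrite !E; [ring| |]; intros k Hk; unfold ip; now rewrite !trunc_in.
Qed.

Lemma trunc_tail_lim x : l2 x -> is_lim_seq (fun n => nrm (vsub x (trunc n x))) 0.
Proof.
  intros Hx. unfold nrm. replace (Finite 0) with (Finite (sqrt 0)) by (now rewrite sqrt_0).
  apply (is_lim_seq_continuous sqrt (fun n => dot (vsub x (trunc n x)) (vsub x (trunc n x))) 0).
  - apply continuity_pt_sqrt. lra.
  - apply is_lim_seq_ext with (fun n => dot x x - W (ip x x) n).
    { intros n. now rewrite dot_trunc_tail. }
    replace 0 with (dot x x - dot x x) by ring.
    apply is_lim_seq_minus'; [apply is_lim_seq_const|]. now apply is_lim_W.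
Qed.

Lemma nrm_trunc n x : l2 x -> nrm (trunc n x) <= nrm x.
Proof.
  intros Hx. apply sq_le_le; [apply nrm_pos|]. rewrite !nrm_sq by auto using l2_trunc.
  rewrite <- (Rmult_1_l (dot x x)), <- (pow1 2).
  apply l2_comparison; [lra| |exact Hx]. intros k s. unfold trunc.
  pose proof (Cmod_ge_0 (x k s)). destruct (Z_le_dec _ _); [lra|]. rewrite Cmod_0. lra.
Qed.

(** The bi-infinite Toeplitz matrices with symbols [q true] and [q false]. *)
Definition laurent (q : bool -> test) (x : vec) : vec :=
  fun k s => fourier (dmul (q s) (synth (fun j => x j s))) k.

Definition tnonneg (q : test) : Prop := forall x, Im (q x) = 0 /\ 0 <= Re (q x).

Lemma laurent_Clim (q : bool -> test) (x : vec) k s : l2 x ->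
  Clim (CW (fun j => coef (q s) (k - j) * x j s)%C) (laurent q x k s).
Proof.
  intros Hx. eapply Clim_ext; [|apply fourier_dmul].
  intros n. apply CW_ext. intros j. now rewrite fourier_synth by now apply polygrowth_l2.
Qed.

Lemma laurent_lin (q : bool -> test) r x y : l2 x -> l2 y ->
  laurent q (vlin r x y) = vlin r (laurent q x) (laurent q y).
Proof.
  intros Hx Hy. apply vec_ext; intros k s.
  apply (Clim_unique _ _ _ (laurent_Clim q _ k s (l2_lin r x y Hx Hy))).
  eapply Clim_ext; [|apply Clim_plus; [apply (laurent_Clim q x k s Hx)|
    apply Clim_scal, (laurent_Clim q y k s Hy)]].
  intros n. cbn beta. rewrite <- CW_scal, <- CW_plus. apply CW_ext. intros j. unfold vlin. ring.
Qed.

Lemma laurent_finite (q : bool -> test) (x : vec) n k s : (forall k s, (Z.of_nat n < Z.abs k)%Z -> x k s = 0%C) ->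
  laurent q x k s = CW (fun j => coef (q s) (k - j) * x j s)%C n.
Proof.
  intros H. apply (Clim_unique _ _ _ (laurent_Clim q x k s (l2_finite x n H))).
  set (f := fun j => (coef (q s) (k - j) * x j s)%C).
  assert (F : forall j, (Z.of_nat n < Z.abs j)%Z -> f j = 0%C).
  { intros j Hj. unfold f. rewrite H by exact Hj. ring. }
  split.
  - change (is_lim_seq (W (fun j => Re (f j))) (W (fun j => Re (f j)) n)).
    destruct (Zseries_finite (fun j => Re (f j)) n) as [E1 E2]; [intros j Hj; now rewrite F|].
    rewrite <- E2. now apply is_lim_W.
  - change (is_lim_seq (W (fun j => Im (f j))) (W (fun j => Im (f j)) n)).
    destruct (Zseries_finite (fun j => Im (f j)) n) as [E1 E2]; [intros j Hj; now rewrite F|].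
    rewrite <- E2. now apply is_lim_W.
Qed.

Lemma laurent_trunc (q : bool -> test) (x : vec) n k s :
  laurent q (trunc n x) k s = CW (fun j => coef (q s) (k - j) * x j s)%C n.
Proof.
  rewrite (laurent_finite q (trunc n x) n) by (intros; now apply trunc_out).
  apply CW_ext_in. intros j Hj. now rewrite trunc_in.
Qed.

(** For a trigonometric polynomial [t], [sum |(q t)^|^2 <= mean |q t|^2 <= K mean (q |t|^2)]
    by Bessel's inequality, and the last mean is [K <q t, t>]. *)
Lemma laurent_trunc_damping (q : bool -> test) (K : R) (x : vec) n : (forall s, tnonneg (q s)) ->
  (forall s y, Re (q s y) <= K) ->
  l2 (laurent q (trunc n x)) /\
  dot (laurent q (trunc n x)) (laurent q (trunc n x)) <= K * dot (laurent q (trunc n x)) (trunc n x).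
Proof.
  intros Hq HK.
  set (t := fun s => tsum (fun j => x j s) n).
  set (L := laurent q (trunc n x)).
  assert (EL : forall k s, L k s = coef (tmul (q s) (t s)) k).
  { intros k s. unfold L, t. now rewrite laurent_trunc, coef_tmul_tsum. }
  assert (S1 : forall s N, W (fun k => Cmod (L k s) ^ 2) N <= K * W (fun k => cdot (L k s) (x k s)) n).
  { intros s N. rewrite (W_ext _ (fun k => Cmod (coef (tmul (q s) (t s)) k) ^ 2))
      by (intros k; now rewrite EL).
    eapply Rle_trans; [apply bessel, cc_test|].
    assert (E : W (fun k => cdot (L k s) (x k s)) n =
      Re (mean (fun y => tmul (q s) (t s) y * Cconj (t s y))%C)).
    { unfold t at 2. rewrite mean_conj_tsum by apply cc_test. simpl. apply W_ext. intros k.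
      rewrite EL. unfold cdot, Re, Im. simpl. ring. }
    rewrite E. change (Re (mean (fun y => tmul (q s) (t s) y * Cconj (t s y))%C)) with
      (rmean (fun y => Re (tmul (q s) (t s) y * Cconj (t s y))%C)).
    assert (Rt : rc (fun y => Re (tmul (q s) (t s) y * Cconj (t s y))%C)).
    { destruct (cc_test (q s)) as [Q1 _]. pose proof (rc_Cmod2 (t s) (cc_test _)) as Q2.
      replace (fun y => Re (tmul (q s) (t s) y * Cconj (t s y))%C) with
        (fun y => Re (q s y) * Cmod (t s y) ^ 2); [now apply rc_mult|].
      apply functional_extensionality. intros y. destruct (Hq s y) as [Hi _].
      rewrite Cmod2_alt. unfold Re, Im in *. simpl. rewrite Hi. ring. }
    rewrite <- rmean_scal by exact Rt.
    apply rmean_le; [apply rc_Cmod2, cc_test|apply rc_mult; [apply rc_const|exact Rt]|].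
    intros y. destruct (Hq s y) as [Hi Hp]. specialize (HK s y).
    rewrite Cmod2_alt. unfold Re, Im in *. simpl. rewrite Hi.
    set (a := fst (q s y)) in *. set (u := fst (t s y)). set (v := snd (t s y)).
    assert (a * a * (u * u + v * v) <= K * a * (u * u + v * v)).
    { apply Rmult_le_compat_r; nra. }
    nra. }
  assert (Ed : dot L (trunc n x) = W (fun k => cdot (L k true) (x k true)) n
    + W (fun k => cdot (L k false) (x k false)) n).
  { destruct (Zseries_finite (ip L (trunc n x)) n) as [_ E].
    - intros k Hk. unfold ip. rewrite !trunc_out by exact Hk. unfold cdot. simpl. ring.
    - unfold dot. rewrite E, <- W_plus. apply W_ext_in. intros k Hk. unfold ip.
      now rewrite !trunc_in. }
  assert (B : forall N, W (ip L L) N <= K * dot L (trunc n x)).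
  { intros N. rewrite Ed. pose proof (S1 true N). pose proof (S1 false N).
    rewrite (W_ext _ (fun k => Cmod (L k true) ^ 2 + Cmod (L k false) ^ 2)) by (intros; apply ip_self).
    rewrite W_plus. lra. }
  assert (HL : l2 L) by (apply ex_Zseries_bound with (1 := ip_pos L) (2 := B)).
  split; [exact HL|]. now apply Zseries_le_bound.
Qed.

(** Truncations are dense. The bound passes to the limit on every window, entry by entry; then the
    quadratic inequality passes to the limit by continuity. *)
Lemma laurent_damping (q : bool -> test) (K : R) : 0 < K -> (forall s, tnonneg (q s)) ->
  (forall s y, Re (q s y) <= K) -> damping K (laurent q).
Proof.
  intros HK Hq HqK.
  assert (Bt : forall n x, l2 x -> nrm (laurent q (trunc n x)) <= K * nrm x).
  { intros n x Hx. destruct (laurent_trunc_damping q K x n Hq HqK) as [H1 H2].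
    apply Rle_trans with (K * nrm (trunc n x)).
    - apply nrm_le_of_dissipation; auto using l2_trunc. lra.
    - apply Rmult_le_compat_l; [lra|now apply nrm_trunc]. }
  assert (BW : forall x N, l2 x -> W (ip (laurent q x) (laurent q x)) N <= (K * nrm x) ^ 2).
  { intros x N Hx.
    refine (is_lim_seq_le (fun n => W (ip (laurent q (trunc n x)) (laurent q (trunc n x))) N)
      (fun _ => (K * nrm x) ^ 2) (W _ N) ((K * nrm x) ^ 2) _ _ (is_lim_seq_const _)).
    - intros n. destruct (laurent_trunc_damping q K x n Hq HqK) as [H1 _].
      eapply Rle_trans; [apply W_le_Zseries; [apply ip_pos|exact H1]|].
      fold (dot (laurent q (trunc n x)) (laurent q (trunc n x))).
      rewrite <- nrm_sq by exact H1. apply pow_incr. split; [apply nrm_pos|now apply Bt].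
    - apply (is_lim_W_seq (fun n => ip (laurent q (trunc n x)) (laurent q (trunc n x)))).
      intros k.
      assert (L : forall s, is_lim_seq (fun n => Cmod (laurent q (trunc n x) k s) ^ 2)
        (Cmod (laurent q x k s) ^ 2)).
      { intros s. apply Clim_Cmod2. eapply Clim_ext; [|apply (laurent_Clim q x k s Hx)].
        intros n. now rewrite laurent_trunc. }
      apply is_lim_seq_ext with (fun n => Cmod (laurent q (trunc n x) k true) ^ 2
        + Cmod (laurent q (trunc n x) k false) ^ 2); [intros n; now rewrite ip_self|].
      rewrite ip_self. apply is_lim_seq_plus'; apply L. }
  assert (BL : forall x, l2 x -> l2 (laurent q x)).
  { intros x Hx. apply ex_Zseries_bound with ((K * nrm x) ^ 2); [apply ip_pos|].
    intros N. now apply BW. }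
  assert (BN : forall x, l2 x -> nrm (laurent q x) <= K * nrm x).
  { intros x Hx. pose proof (nrm_pos x). apply sq_le_le; [nra|].
    rewrite nrm_sq by now apply BL. apply Zseries_le_bound; [now apply BL|].
    intros N. now apply BW. }
  split; [exact BL|]. split; [intros; now apply laurent_lin|].
  intros x Hx. set (Mx := laurent q x).
  assert (D : forall n, let e := nrm (vsub x (trunc n x)) in
    dot Mx Mx - K * dot Mx x <= (4 * K ^ 2 * nrm x) * e + K ^ 2 * (e * e)).
  { intros n. cbv zeta. set (y := vsub x (trunc n x)).
    assert (Hy : l2 y) by (apply l2_lin; auto using l2_trunc).
    destruct (laurent_trunc_damping q K x n Hq HqK) as [_ H].
    replace (trunc n x) with (vlin (-1) x y) in H by (unfold y; vec_ring).
    rewrite laurent_lin in H by assumption. fold Mx in H.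
    pose proof (BL x Hx) as HMx. pose proof (BL y Hy) as HMy. fold Mx in HMx.
    set (My := laurent q y) in *.
    rewrite dot_lin_self, dot_lin_l, !dot_lin_r in H by auto using l2_lin.
    pose proof (BN x Hx) as Nx. pose proof (BN y Hy) as Ny. fold Mx in Nx. fold My in Ny.
    set (e := nrm y) in *. set (X := nrm x) in *.
    assert (Pe : 0 <= e) by apply nrm_pos. assert (PX : 0 <= X) by apply nrm_pos.
    assert (CS : forall u v a b, l2 u -> l2 v -> nrm u <= a -> nrm v <= b ->
      - (a * b) <= dot u v <= a * b).
    { intros u v a b Hu Hv Ha Hb. pose proof (cauchy_schwarz u v Hu Hv) as CS.
      apply Rabs_le_between in CS. pose proof (nrm_pos u). pose proof (nrm_pos v).
      assert (nrm u * nrm v <= a * b) by (apply Rmult_le_compat; assumption). lra. }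
    pose proof (CS Mx My _ _ HMx HMy Nx Ny) as C1.
    pose proof (CS Mx y _ _ HMx Hy Nx (Rle_refl _)) as C2.
    pose proof (CS My x _ _ HMy Hx Ny (Rle_refl _)) as C3.
    pose proof (CS My y _ _ HMy Hy Ny (Rle_refl _)) as C4.
    pose proof (dot_pos My HMy) as C5. fold e in C2, C4. fold X in C3.
    assert (K * dot My y <= K * (K * e * e)) by (apply Rmult_le_compat_l; lra).
    assert (- (K * (K * e * X)) <= K * dot My x).
    { rewrite <- Ropp_mult_distr_r_reverse. apply Rmult_le_compat_l; lra. }
    assert (- (K * (K * X * e)) <= K * dot Mx y).
    { rewrite <- Ropp_mult_distr_r_reverse. apply Rmult_le_compat_l; lra. }
    lra. }
  assert (Lim : is_lim_seq (fun n => (4 * K ^ 2 * nrm x) * nrm (vsub x (trunc n x))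
    + K ^ 2 * (nrm (vsub x (trunc n x)) * nrm (vsub x (trunc n x)))) 0).
  { pose proof (trunc_tail_lim x Hx) as L.
    replace 0 with ((4 * K ^ 2 * nrm x) * 0 + K ^ 2 * (0 * 0)) by ring.
    apply is_lim_seq_plus'; apply is_lim_seq_mult'; try apply is_lim_seq_const; try exact L.
    now apply is_lim_seq_mult'. }
  pose proof (is_lim_seq_le (fun _ => dot Mx Mx - K * dot Mx x) _ _ _ D (is_lim_seq_const _) Lim) as F.
  simpl in F. lra.
Qed.

Lemma laurent_rsquare_damping (q : bool -> rtest) :
  exists K, 0 < K /\ damping K (laurent (fun s => rsquare (q s))).
Proof.
  destruct (test_bounded (rsquare (q true))) as [K1 [HK1 H1]].
  destruct (test_bounded (rsquare (q false))) as [K2 [HK2 H2]].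
  exists (K1 + K2 + 1). split; [lra|]. apply laurent_damping; [lra| |].
  - intros s y. split; [reflexivity|apply pow2_ge_0].
  - intros s y. eapply Rle_trans; [apply Rle_abs|]. eapply Rle_trans; [apply re_le_Cmod|].
    destruct s; [specialize (H1 y)|specialize (H2 y)]; lra.
Qed.

(** * The dispersion relation *)

Lemma tanh_alt x : tanh x = 1 - 2 / (exp (2 * x) + 1).
Proof.
  unfold tanh, sinh, cosh. rewrite exp_Ropp. pose proof (exp_pos x).
  replace (exp (2 * x)) with (exp x * exp x) by (rewrite <- exp_plus; f_equal; ring).
  field. split; nra.
Qed.

Lemma tanh_incr x y : x < y -> tanh x < tanh y.
Proof.
  intros H. rewrite !tanh_alt. pose proof (exp_pos (2 * x)).
  assert (exp (2 * x) < exp (2 * y)) by (apply exp_increasing; lra).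
  assert (2 / (exp (2 * y) + 1) < 2 / (exp (2 * x) + 1)).
  { apply Rmult_lt_compat_l; [lra|]. apply Rinv_lt_contravar; nra. }
  lra.
Qed.

Lemma tanh_odd x : tanh (- x) = - tanh x.
Proof.
  unfold tanh, sinh, cosh. rewrite Ropp_involutive. pose proof (exp_pos x). pose proof (exp_pos (- x)).
  field. lra.
Qed.

Lemma tanh_0 : tanh 0 = 0.
Proof. rewrite tanh_alt, Rmult_0_r, exp_0. field. Qed.

Lemma tanh_pos x : 0 < x -> 0 < tanh x.
Proof. intros H. rewrite <- tanh_0. now apply tanh_incr. Qed.

Lemma tanh_lt_1 x : tanh x < 1.
Proof.
  rewrite tanh_alt. assert (0 < 2 / (exp (2 * x) + 1)); [|lra].
  apply Rdiv_lt_0_compat; [lra|]. pose proof (exp_pos (2 * x)). lra.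
Qed.

Lemma tanh_ge x : 0 < x -> 1 - / x <= tanh x.
Proof.
  intros H. rewrite tanh_alt.
  pose proof (exp_ineq1 (2 * x)).
  assert (2 / (exp (2 * x) + 1) <= / x); [|lra].
  replace (/ x) with (2 / (2 * x)) by (field; lra).
  apply Rmult_le_compat_l; [lra|]. apply Rinv_le_contravar; lra.
Qed.

Lemma tanh_le x : 0 <= x -> tanh x <= x.
Proof.
  intros H. set (f := fun t => t - (1 - 2 / (exp (2 * t) + 1))).
  set (df := fun t => (exp (2 * t) - 1) ^ 2 / (exp (2 * t) + 1) ^ 2).
  destruct (MVT_gen f 0 x df) as [c [_ E]].
  - intros t _. unfold f, df. pose proof (exp_pos (2 * t)). auto_derive; [lra|]. field. lra.
  - intros t _. unfold f. apply continuity_pt_filterlim.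
    apply (ex_derive_continuous (fun t => t - (1 - 2 / (exp (2 * t) + 1)))).
    pose proof (exp_pos (2 * t)). auto_derive. lra.
  - assert (0 <= df c).
    { unfold df. pose proof (exp_pos (2 * c)). apply Rdiv_le_0_compat; [apply pow2_ge_0|nra]. }
    assert (F0 : f 0 = 0) by (unfold f; rewrite Rmult_0_r, exp_0; field).
    rewrite tanh_alt. unfold f in E at 1. rewrite F0 in E. nra.
Qed.

(** [i freq] are the eigenvalues of the undamped generator:
    [freq beta k ^ 2 = k tanh (beta k) / beta], with the sign of [k]. *)
Definition freq (beta : R) (k : Z) : R := IZR k * sqrt (p_ beta k).

Lemma p_abs beta k : k <> 0%Z ->
  p_ beta k = tanh (beta * Rabs (IZR k)) / (beta * Rabs (IZR k)).
Proof.
  intros Hk. unfold p_. destruct (Z.eq_dec k 0) as [|_]; [easy|].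
  destruct (Rle_or_lt 0 (IZR k)) as [H|H]; [now rewrite Rabs_pos_eq|].
  rewrite Rabs_left by exact H.
  replace (beta * - IZR k) with (- (beta * IZR k)) by ring. rewrite tanh_odd.
  unfold Rdiv. rewrite Rinv_opp. ring.
Qed.

Lemma IZR_abs_ge_1 k : k <> 0%Z -> 1 <= Rabs (IZR k).
Proof. intros H. rewrite <- abs_IZR. apply IZR_le. lia. Qed.

Lemma p_pos beta k : 0 < beta -> 0 < p_ beta k <= 1.
Proof.
  intros Hb. destruct (Z.eq_dec k 0) as [->|Hk]; [unfold p_; simpl; lra|].
  rewrite p_abs by exact Hk. pose proof (IZR_abs_ge_1 k Hk).
  assert (P : 0 < beta * Rabs (IZR k)) by nra. split.
  - apply Rdiv_lt_0_compat; [now apply tanh_pos|exact P].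
  - apply Rmult_le_reg_r with (beta * Rabs (IZR k)); [exact P|]. unfold Rdiv.
    rewrite Rmult_assoc, Rinv_l by lra. pose proof (tanh_le (beta * Rabs (IZR k))). lra.
Qed.

Lemma p_even beta k : p_ beta (- k) = p_ beta k.
Proof.
  destruct (Z.eq_dec k 0) as [->|Hk]; [reflexivity|].
  rewrite !p_abs by lia. now rewrite opp_IZR, Rabs_Ropp.
Qed.

Lemma abs_p_le beta k : 0 < beta -> Rabs (IZR k) * p_ beta k <= 1 / beta.
Proof.
  intros Hb. destruct (Z.eq_dec k 0) as [->|Hk].
  - rewrite Rabs_R0, Rmult_0_l. apply Rdiv_le_0_compat; lra.
  - rewrite p_abs by exact Hk. pose proof (IZR_abs_ge_1 k Hk).
    replace (Rabs (IZR k) * (tanh (beta * Rabs (IZR k)) / (beta * Rabs (IZR k))))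
      with (tanh (beta * Rabs (IZR k)) / beta) by (field; lra).
    apply Rmult_le_compat_r; [left; now apply Rinv_0_lt_compat|].
    left. apply tanh_lt_1.
Qed.

Lemma abs_p_ge beta k : 0 < beta -> k <> 0%Z -> tanh beta / beta <= Rabs (IZR k) * p_ beta k.
Proof.
  intros Hb Hk. rewrite p_abs by exact Hk. pose proof (IZR_abs_ge_1 k Hk).
  replace (Rabs (IZR k) * (tanh (beta * Rabs (IZR k)) / (beta * Rabs (IZR k))))
    with (tanh (beta * Rabs (IZR k)) / beta) by (field; lra).
  apply Rmult_le_compat_r; [left; now apply Rinv_0_lt_compat|].
  destruct (Req_dec (Rabs (IZR k)) 1) as [E|E].
  - rewrite E, Rmult_1_r. apply Rle_refl.
  - left. apply tanh_incr. nra.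
Qed.

Lemma m_p beta k : 0 < beta -> m_ beta k = IZR k * p_ beta k.
Proof.
  intros Hb. unfold m_, p_. destruct (Z.eq_dec k 0) as [->|Hk].
  - rewrite Rmult_0_r, tanh_0. unfold Rdiv. ring.
  - assert (IZR k <> 0) by now apply not_0_IZR. field. lra.
Qed.

Lemma sqrt_p_sq beta k : 0 < beta -> sqrt (p_ beta k) ^ 2 = p_ beta k.
Proof. intros Hb. apply pow2_sqrt. pose proof (p_pos beta k Hb). lra. Qed.

Lemma sqrt_p_pos beta k : 0 < beta -> 0 < sqrt (p_ beta k) <= 1.
Proof.
  intros Hb. pose proof (p_pos beta k Hb). split; [now apply sqrt_lt_R0|].
  rewrite <- sqrt_1. apply sqrt_le_1_alt. lra.
Qed.

Lemma freq_odd beta k : freq beta (- k) = - freq beta k.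
Proof. unfold freq. rewrite p_even, opp_IZR. ring. Qed.

Lemma freq_sq beta k : 0 < beta -> freq beta k ^ 2 = IZR k ^ 2 * p_ beta k.
Proof. intros Hb. unfold freq. now rewrite Rpow_mult_distr, sqrt_p_sq. Qed.

Lemma freq_incr beta j k : 0 < beta -> (j < k)%Z -> freq beta j < freq beta k.
Proof.
  intros Hb.
  assert (Pos : forall k, (0 < k)%Z -> 0 < freq beta k).
  { intros i Hi. unfold freq. pose proof (sqrt_p_pos beta i Hb). pose proof (IZR_lt 0 i Hi). nra. }
  assert (Sq : forall i, (0 < i)%Z -> freq beta i ^ 2 = IZR i * tanh (beta * IZR i) / beta).
  { intros i Hi. pose proof (IZR_lt 0 i Hi). rewrite freq_sq by exact Hb. unfold p_.
    destruct (Z.eq_dec i 0); [lia|]. field. lra. }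
  assert (Inc : forall j k, (0 < j)%Z -> (j < k)%Z -> freq beta j < freq beta k).
  { clear j k. intros j k Hj Hjk. pose proof (Pos j Hj) as P1. pose proof (Pos k ltac:(lia)) as P2.
    apply Rnot_le_lt. intros L.
    assert (L2 : freq beta k ^ 2 <= freq beta j ^ 2) by (apply pow_incr; lra).
    rewrite !Sq in L2 by lia. pose proof (IZR_lt 0 j Hj). pose proof (IZR_lt j k Hjk).
    assert (T1 : tanh (beta * IZR j) < tanh (beta * IZR k)) by (apply tanh_incr; nra).
    assert (T0 : 0 < tanh (beta * IZR j)) by (apply tanh_pos; nra).
    unfold Rdiv in L2. apply Rmult_le_reg_r in L2; [|now apply Rinv_0_lt_compat]. nra. }
  assert (S0 : freq beta 0 = 0) by (unfold freq; ring).
  intros Hjk. destruct (Z_lt_le_dec 0 j) as [Hj|Hj]; [now apply Inc|].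
  destruct (Z_lt_le_dec k 0) as [Hk|Hk].
  - pose proof (Inc (- k)%Z (- j)%Z ltac:(lia) ltac:(lia)) as I. rewrite !freq_odd in I. lra.
  - assert (freq beta j <= 0).
    { destruct (Z.eq_dec j 0) as [->|]; [lra|].
      pose proof (Pos (- j)%Z ltac:(lia)) as Q. rewrite freq_odd in Q. lra. }
    assert (0 <= freq beta k).
    { destruct (Z.eq_dec k 0) as [->|]; [lra|]. left. apply Pos. lia. }
    destruct (Z.eq_dec j 0) as [->|]; [rewrite S0; apply Pos; lia|].
    pose proof (Pos (- j)%Z ltac:(lia)) as Q. rewrite freq_odd in Q. lra.
Qed.

Lemma omega_freq beta N : 0 < beta -> (1 <= N)%nat -> omega beta N = freq beta (Z.of_nat N).
Proof.
  intros Hb HN. unfold omega, freq. rewrite <- INR_IZR_INZ.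
  assert (HN' : 0 < INR N) by (apply lt_0_INR; lia).
  rewrite <- (sqrt_pow2 (INR N)) at 3 by lra. rewrite <- sqrt_mult.
  - f_equal. unfold p_. destruct (Z.eq_dec (Z.of_nat N) 0); [lia|].
    rewrite <- INR_IZR_INZ. field. lra.
  - apply pow2_ge_0.
  - pose proof (p_pos beta (Z.of_nat N) Hb). lra.
Qed.

(** As [freq] is increasing, only the two neighbouring frequencies matter. *)
Lemma freq_gap beta N : 0 < beta -> exists delta, 0 < delta /\
  forall k, k <> N -> delta <= Rabs (freq beta N - freq beta k).
Proof.
  intros Hb. exists (Rmin (freq beta N - freq beta (N - 1)) (freq beta (N + 1) - freq beta N)).
  pose proof (freq_incr beta (N - 1) N Hb ltac:(lia)) as I1.
  pose proof (freq_incr beta N (N + 1) Hb ltac:(lia)) as I2.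
  assert (W : forall j k, (j <= k)%Z -> freq beta j <= freq beta k).
  { intros j k H. destruct (Z.eq_dec j k) as [->|]; [lra|]. left. apply freq_incr; [exact Hb|lia]. }
  split; [apply Rmin_glb_lt; lra|]. intros k Hk.
  destruct (Z_lt_le_dec k N) as [L|L].
  - eapply Rle_trans; [apply Rmin_l|]. pose proof (W k (N - 1)%Z ltac:(lia)).
    rewrite Rabs_pos_eq; lra.
  - eapply Rle_trans; [apply Rmin_r|]. pose proof (W (N + 1)%Z k ltac:(lia)).
    rewrite Rabs_left; lra.
Qed.

Lemma bracket_bounds k : 1 <= bracket k /\ Rabs (IZR k) <= bracket k <= 1 + Rabs (IZR k).
Proof.
  unfold bracket. pose proof (Rabs_pos (IZR k)) as P. rewrite <- (pow2_abs (IZR k)).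
  set (t := Rabs (IZR k)) in *. pose proof (sqrt_pos (1 + t ^ 2)).
  assert (E : sqrt (1 + t ^ 2) ^ 2 = 1 + t ^ 2) by (apply pow2_sqrt; nra).
  split; [|split]; nra.
Qed.

Lemma p_bracket_le beta k : 0 < beta -> p_ beta k <= (1 + 1 / beta) * / bracket k.
Proof.
  intros Hb. destruct (bracket_bounds k) as [B1 [B2 B3]].
  apply Rmult_le_reg_r with (bracket k); [lra|]. rewrite Rmult_assoc, Rinv_l, Rmult_1_r by lra.
  pose proof (abs_p_le beta k Hb). pose proof (p_pos beta k Hb).
  assert (p_ beta k * bracket k <= p_ beta k * (1 + Rabs (IZR k))) by (apply Rmult_le_compat_l; lra).
  lra.
Qed.

Lemma p_bracket_ge beta k : 0 < beta -> / bracket k <= (1 + beta / tanh beta) * p_ beta k.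
Proof.
  intros Hb. destruct (bracket_bounds k) as [B1 [B2 B3]]. pose proof (tanh_pos beta Hb) as T.
  assert (Q : 0 < beta / tanh beta) by (apply Rdiv_lt_0_compat; lra).
  apply Rmult_le_reg_r with (bracket k); [lra|]. rewrite Rinv_l by lra.
  destruct (Z.eq_dec k 0) as [->|Hk].
  - unfold p_. simpl. nra.
  - pose proof (abs_p_ge beta k Hb Hk) as A. pose proof (p_pos beta k Hb).
    assert (E : beta / tanh beta * (tanh beta / beta) = 1) by (field; lra).
    assert (beta / tanh beta * (tanh beta / beta) <= beta / tanh beta * (Rabs (IZR k) * p_ beta k))
      by (apply Rmult_le_compat_l; lra).
    assert (p_ beta k * Rabs (IZR k) <= p_ beta k * bracket k) by (apply Rmult_le_compat_l; lra).
    assert (beta / tanh beta * (p_ beta k * Rabs (IZR k)) <= beta / tanh beta * (p_ beta k * bracket k))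
      by (apply Rmult_le_compat_l; lra).
    assert (0 < p_ beta k * bracket k) by (apply Rmult_lt_0_compat; lra).
    lra.
Qed.

Lemma Rpower_bracket k :
  Rpower (bracket k) (2 * 0) = 1 /\ Rpower (bracket k) (2 * (1 / 2)) = bracket k /\
  Rpower (bracket k) (2 * - (1 / 2)) = / bracket k.
Proof.
  destruct (bracket_bounds k) as [B1 _]. repeat split.
  - rewrite Rmult_0_r. apply Rpower_O. lra.
  - replace (2 * (1 / 2)) with 1 by field. apply Rpower_1. lra.
  - replace (2 * - (1 / 2)) with (Ropp 1) by field. rewrite Rpower_Ropp, Rpower_1; lra.
Qed.

(** * The damped generator on the Fourier side *)

Lemma fourier_dadd v w k : fourier (dadd v w) k = (fourier v k + fourier w k)%C.
Proof. unfold fourier. simpl. field. apply two_PI_C. Qed.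

Lemma fourier_dscal c v k : fourier (dscal c v) k = (c * fourier v k)%C.
Proof. unfold fourier. simpl. field. apply two_PI_C. Qed.

Lemma fourier_dsub v w k : fourier (dsub v w) k = (fourier v k - fourier w k)%C.
Proof. unfold dsub. rewrite fourier_dadd, fourier_dscal. rewrite RtoC_m1. ring. Qed.

Lemma fourier_dderiv v k : fourier (dderiv v) k = (Ci * RtoC (IZR k) * fourier v k)%C.
Proof.
  unfold fourier. simpl pair. rewrite tderiv_expi, pair_scal, opp_IZR, RtoC_opp.
  field. apply two_PI_C.
Qed.

(** The [j]-th derivative of [e^{ikx}] has size [|k|^j]. *)
Lemma fourier_polygrowth v : polygrowth (fourier v).
Proof.
  destruct (pair_cont v) as [m [M [HM H]]]. exists m, (M / (2 * PI)). intros k.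
  pose proof two_PI_pos as HP.
  unfold fourier. rewrite Cmod_div by apply two_PI_C. rewrite Cmod_R, Rabs_pos_eq by lra.
  unfold Rdiv. rewrite (Rmult_comm M), Rmult_assoc, (Rmult_comm (Cmod _)).
  apply Rmult_le_compat_l; [left; now apply Rinv_0_lt_compat|]. apply H.
  assert (E : forall j x, Cmod (Nat.iter j tderiv (expi (- k)) x) = Rabs (IZR k) ^ j).
  { intros j x.
    assert (E : exists c, Cmod c = Rabs (IZR k) ^ j /\
      Nat.iter j tderiv (expi (- k)) = tmul (tconst c) (expi (- k))).
    { induction j as [|j [c [Hc IH]]].
      - exists 1%C. split; [apply Cmod_1|]. apply test_ext. intros y. simpl Nat.iter.
        cbn [tmul tconst tfun]. ring.
      - exists (c * (Ci * RtoC (IZR (- k))))%C. split.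
        + rewrite !Cmod_mult, Hc, Cmod_Ci, Cmod_R, opp_IZR, Rabs_Ropp. simpl. ring.
        + rewrite Nat.iter_succ, IH, tderiv_mul, tderiv_const, tderiv_expi. apply test_ext.
          intros y. cbn [tmul tadd tconst tfun]. ring. }
    destruct E as [c [Hc ->]]. cbn [tmul tconst tfun].
    now rewrite Cmod_mult, Cmod_expi, Rmult_1_r. }
  intros j x Hj. rewrite E. pose proof (Rabs_pos (IZR k)).
  apply Rle_trans with ((1 + Rabs (IZR k)) ^ j).
  - apply pow_incr. lra.
  - apply Rle_pow; [lra|exact Hj].
Qed.

Lemma fourier_multiplier s v C0 k : (forall k, Cmod (s k) <= C0) ->
  fourier (multiplier s v) k = (s k * fourier v k)%C.
Proof.
  intros Hs.
  assert (P : polygrowth (fun k => s k * fourier v k)%C).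
  { destruct (fourier_polygrowth v) as [m [K H]]. exists m, (C0 * K). intros j.
    rewrite Cmod_mult, Rmult_assoc. apply Rmult_le_compat; auto using Cmod_ge_0. }
  exact (epsilon_spec (inhabits v) _ (distr_exists _ P) k).
Qed.

Lemma fourier_Top beta v k : 0 < beta ->
  fourier (Top beta v) k = (- (Ci * RtoC (m_ beta k)) * fourier v k)%C.
Proof.
  intros Hb. apply fourier_multiplier with (1 / beta). intros j.
  rewrite Cmod_opp, Cmod_mult, Cmod_Ci, Cmod_R, Rmult_1_l, m_p, Rabs_mult by exact Hb.
  pose proof (p_pos beta j Hb). rewrite (Rabs_pos_eq (p_ beta j)) by lra. now apply abs_p_le.
Qed.

Lemma fourier_Pop beta v k : 0 < beta ->
  fourier (Pop beta v) k = (RtoC (p_ beta k) * fourier v k)%C.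
Proof.
  intros Hb. apply fourier_multiplier with 1. intros j. rewrite Cmod_R.
  pose proof (p_pos beta j Hb). rewrite Rabs_pos_eq; lra.
Qed.

Lemma state_ext (x y : state) : (forall k, fourier (fst x) k = fourier (fst y) k) ->
  (forall k, fourier (snd x) k = fourier (snd y) k) -> x = y.
Proof. intros H1 H2. destruct x, y. f_equal; now apply distr_ext. Qed.

(** ** Energy coordinates *)

(** The factor [sqrt p] makes the energy norm an [l2] norm and the undamped generator a
    symmetric matrix times [- i]. *)
Definition ecoord (beta : R) (x : state) : vec := fun k s =>
  if s then fourier (fst x) k else (RtoC (sqrt (p_ beta k)) * fourier (snd x) k)%C.

Definition of_ecoord (beta : R) (y : vec) : state :=
  (synth (fun k => y k true), synth (fun k => / RtoC (sqrt (p_ beta k)) * y k false)%C).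

Lemma sqrt_p_C beta k : 0 < beta -> RtoC (sqrt (p_ beta k)) <> 0.
Proof. intros Hb E. injection E as E. pose proof (sqrt_p_pos beta k Hb). lra. Qed.

Lemma ecoord_of_ecoord beta y : 0 < beta -> l2 y -> ecoord beta (of_ecoord beta y) = y.
Proof.
  intros Hb Hy. apply vec_ext; intros k [].
  - unfold ecoord, of_ecoord. simpl. apply fourier_synth. exact (polygrowth_l2 y true Hy).
  - unfold ecoord, of_ecoord. simpl. rewrite fourier_synth.
    + rewrite Cmult_assoc, Cinv_r by now apply sqrt_p_C. ring.
    + pose proof (tanh_pos beta Hb) as T.
      set (C0 := 1 + beta / tanh beta).
      assert (HC : 1 <= C0).
      { unfold C0. assert (0 < beta / tanh beta) by (apply Rdiv_lt_0_compat; lra). lra. }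
      exists 1%nat, (C0 * nrm y). intros j. rewrite pow_1.
      assert (HS : RtoC (sqrt (p_ beta j)) <> 0) by now apply sqrt_p_C.
      rewrite Cmod_mult, Cmod_inv, Cmod_R by exact HS.
      destruct (sqrt_p_pos beta j Hb) as [S1 S2]. rewrite Rabs_pos_eq by lra.
      pose proof (Cmod_le_nrm y j false Hy) as Hn.
      assert (I : / sqrt (p_ beta j) <= C0 * (1 + Rabs (IZR j))).
      { pose proof (p_bracket_ge beta j Hb) as G. fold C0 in G.
        destruct (bracket_bounds j) as [B1 [B2 B3]].
        pose proof (sqrt_p_sq beta j Hb) as Q. set (r := sqrt (p_ beta j)) in *.
        rewrite <- Q in G.
        apply Rmult_le_reg_r with r; [exact S1|]. rewrite Rinv_l by lra.
        apply Rle_trans with (C0 * bracket j * r ^ 2).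
        - apply Rmult_le_reg_l with (/ bracket j); [apply Rinv_0_lt_compat; lra|].
          rewrite Rmult_1_r. eapply Rle_trans; [exact G|]. right. field. lra.
        - assert (0 <= C0 * bracket j * r) by (apply Rmult_le_pos; [apply Rmult_le_pos|]; lra).
          apply Rle_trans with (C0 * bracket j * r).
          + nra.
          + apply Rmult_le_compat_r; [lra|]. apply Rmult_le_compat_l; lra. }
      replace (C0 * nrm y * (1 + Rabs (IZR j))) with (C0 * (1 + Rabs (IZR j)) * nrm y) by ring.
      apply Rmult_le_compat; [left; now apply Rinv_0_lt_compat|apply Cmod_ge_0|exact I|exact Hn].
Qed.

Lemma ecoord_inj beta x y : 0 < beta -> ecoord beta x = ecoord beta y -> x = y.
Proof.
  intros Hb E. apply state_ext; intros k.
  - exact (f_equal (fun v => v k true) E).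
  - apply (f_equal (fun v => v k false)) in E. unfold ecoord in E.
    pose proof (sqrt_p_C beta k Hb) as S.
    replace (fourier (snd x) k) with
      (/ RtoC (sqrt (p_ beta k)) * (RtoC (sqrt (p_ beta k)) * fourier (snd x) k))%C by (field; exact S).
    rewrite E. field. exact S.
Qed.

Lemma ip_ecoord beta x k : 0 < beta -> ip (ecoord beta x) (ecoord beta x) k =
  Cmod (fourier (fst x) k) ^ 2 + p_ beta k * Cmod (fourier (snd x) k) ^ 2.
Proof.
  intros Hb. rewrite ip_self. unfold ecoord. rewrite Cmod_mult, Cmod_R.
  rewrite Rabs_pos_eq, Rpow_mult_distr, sqrt_p_sq; [reflexivity|exact Hb|apply sqrt_pos].
Qed.

Lemma ex_Zseries_pos_le f g c : (forall k, 0 <= f k <= c * g k) -> ex_Zseries g -> ex_Zseries f.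
Proof.
  intros H Hg. apply ex_Zseries_le with (fun k => c * g k); [|now apply ex_Zseries_scal].
  intros k. rewrite Rabs_pos_eq; apply H.
Qed.

Lemma energy_l2 beta x : 0 < beta -> energy x <-> l2 (ecoord beta x).
Proof.
  intros Hb. unfold energy, Sobolev. split.
  - intros [H1 H2].
    apply l2_le with (fun k => Rpower (bracket k) (2 * 0) * Cmod (fourier (fst x) k) ^ 2
      + (1 + 1 / beta) * (Rpower (bracket k) (2 * - (1 / 2)) * Cmod (fourier (snd x) k) ^ 2)).
    + intros k. rewrite ip_ecoord by exact Hb. destruct (Rpower_bracket k) as [-> [_ ->]].
      pose proof (p_bracket_le beta k Hb). pose proof (pow2_ge_0 (Cmod (fourier (snd x) k))). nra.
    + apply ex_Zseries_plus; [exact H1|now apply ex_Zseries_scal].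
  - intros H. split.
    + apply ex_Zseries_pos_le with (c := 1) (2 := H). intros k. rewrite ip_ecoord by exact Hb.
      destruct (Rpower_bracket k) as [-> _]. pose proof (p_pos beta k Hb).
      pose proof (pow2_ge_0 (Cmod (fourier (snd x) k))).
      pose proof (pow2_ge_0 (Cmod (fourier (fst x) k))). nra.
    + pose proof (tanh_pos beta Hb). assert (0 < beta / tanh beta) by (apply Rdiv_lt_0_compat; lra).
      apply ex_Zseries_pos_le with (c := 1 + beta / tanh beta) (2 := H).
      intros k. rewrite ip_ecoord by exact Hb.
      destruct (Rpower_bracket k) as [_ [_ ->]]. pose proof (p_bracket_ge beta k Hb).
      destruct (bracket_bounds k) as [B _]. assert (0 < / bracket k) by (apply Rinv_0_lt_compat; lra).
      pose proof (pow2_ge_0 (Cmod (fourier (snd x) k))).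
      pose proof (pow2_ge_0 (Cmod (fourier (fst x) k))). split; [nra|].
      rewrite Rmult_plus_distr_l. nra.
Qed.

Lemma Re_Cmul_conj z : Re (z * Cconj z)%C = Cmod z ^ 2.
Proof. now rewrite <- Cmod2_conj. Qed.

Lemma energy_norm_nrm beta x : 0 < beta -> energy x ->
  energy_norm beta x = sqrt (2 * PI) * nrm (ecoord beta x).
Proof.
  intros Hb H. assert (H' : l2 (ecoord beta x)) by now apply (energy_l2 beta).
  unfold energy_norm, nrm. rewrite <- sqrt_mult by (try apply dot_pos; auto; pose proof PI_RGT_0; lra).
  f_equal. unfold energy_inner.
  set (f := fun k => (fourier (fst x) k * Cconj (fourier (fst x) k))%C).
  set (g := fun k => (RtoC (p_ beta k) * (fourier (snd x) k * Cconj (fourier (snd x) k)))%C).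
  assert (E : Re (RtoC (2 * PI) * CZseries f + RtoC (2 * PI) * CZseries g)%C =
    2 * PI * (Zseries (fun k => Re (f k)) + Zseries (fun k => Re (g k)))).
  { unfold CZseries. simpl. ring. }
  rewrite E. f_equal.
  assert (Ef : forall k, Re (f k) = Cmod (fourier (fst x) k) ^ 2) by (intros k; apply Re_Cmul_conj).
  assert (Eg : forall k, Re (g k) = p_ beta k * Cmod (fourier (snd x) k) ^ 2).
  { intros k. rewrite <- Re_Cmul_conj. unfold g. simpl. ring. }
  rewrite (Zseries_ext _ _ Ef), (Zseries_ext _ _ Eg), <- Zseries_plus.
  - apply Zseries_ext. intros k. now rewrite ip_ecoord.
  - apply ex_Zseries_pos_le with (c := 1) (2 := H'). intros k. rewrite ip_ecoord by exact Hb.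
    pose proof (p_pos beta k Hb). pose proof (pow2_ge_0 (Cmod (fourier (snd x) k))).
    pose proof (pow2_ge_0 (Cmod (fourier (fst x) k))). nra.
  - apply ex_Zseries_pos_le with (c := 1) (2 := H'). intros k. rewrite ip_ecoord by exact Hb.
    pose proof (p_pos beta k Hb). pose proof (pow2_ge_0 (Cmod (fourier (snd x) k))).
    pose proof (pow2_ge_0 (Cmod (fourier (fst x) k))). nra.
Qed.

(** ** The damping in energy coordinates *)

Definition weight (beta : R) (x : vec) : vec :=
  fun k s => if s then x k s else (RtoC (sqrt (p_ beta k)) * x k s)%C.

Definition coeffs (a b : rtest) (s : bool) : test := rsquare (if s then a else b).

Definition edamp (beta : R) (a b : rtest) (x : vec) : vec :=
  weight beta (laurent (coeffs a b) (weight beta x)).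

Lemma l2_weight beta x : 0 < beta -> l2 x -> l2 (weight beta x) /\ dot (weight beta x) (weight beta x) <= dot x x.
Proof.
  intros Hb Hx. rewrite <- (Rmult_1_l (dot x x)), <- (pow1 2). apply l2_comparison; [lra| |exact Hx].
  intros k s. unfold weight. pose proof (Cmod_ge_0 (x k s)). destruct s; [lra|].
  rewrite Cmod_mult, Cmod_R. pose proof (sqrt_p_pos beta k Hb). rewrite Rabs_pos_eq by lra. nra.
Qed.

Lemma dot_weight beta x y : dot (weight beta x) y = dot x (weight beta y).
Proof.
  apply Zseries_ext. intros k. unfold ip, weight, cdot, Re, Im. simpl. ring.
Qed.

Lemma weight_lin beta r x y : weight beta (vlin r x y) = vlin r (weight beta x) (weight beta y).
Proof.
  apply vec_ext; intros k [];
    unfold weight, vlin; ring.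
Qed.

Lemma edamp_damping beta a b : 0 < beta -> exists K, 0 < K /\ damping K (edamp beta a b).
Proof.
  intros Hb. destruct (laurent_rsquare_damping (fun s => if s then a else b)) as [K [HK D]].
  change (damping K (laurent (coeffs a b))) in D.
  exists K. split; [exact HK|]. destruct D as [D1 [D2 D3]]. split; [|split].
  - intros x Hx. apply l2_weight; [exact Hb|]. apply D1. now apply l2_weight.
  - intros r x y Hx Hy. unfold edamp. rewrite weight_lin, D2 by now apply l2_weight.
    apply weight_lin.
  - intros x Hx. destruct (l2_weight beta x Hb Hx) as [Hw _]. unfold edamp at 3.
    rewrite dot_weight. eapply Rle_trans; [|now apply D3]. apply l2_weight; auto.
Qed.

(** The shifted generator [i om - A_d] on the Fourier side. The coupling is symmetric: the symbols
    of [T_beta] and of [d/dx] both become [freq] once [u] is weighted by [sqrt p]. *)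
Definition efun (beta om : R) (a b : rtest) (x : vec) : vec := fun k s =>
  (Ci * RtoC om * x k s + Ci * RtoC (freq beta k) * x k (negb s) + edamp beta a b x k s)%C.

Lemma ecoord_shifted beta om a b x : 0 < beta -> l2 (ecoord beta x) ->
  ecoord beta (ssub (sscal (Ci * RtoC om) x) (Ad beta a b x)) = efun beta om a b (ecoord beta x).
Proof.
  intros Hb Hx. destruct (l2_weight beta _ Hb Hx) as [Hw _]. destruct x as [h u].
  set (X := ecoord beta (h, u)) in *.
  assert (Eh : synth (fun j => weight beta X j true) = h).
  { apply distr_ext. intros k. rewrite fourier_synth by exact (polygrowth_l2 _ true Hw). reflexivity. }
  assert (Eu : synth (fun j => weight beta X j false) = Pop beta u).
  { apply distr_ext. intros k. rewrite fourier_synth by exact (polygrowth_l2 _ false Hw).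
    rewrite fourier_Pop by exact Hb. unfold weight, X, ecoord. simpl snd.
    rewrite Cmult_assoc, <- RtoC_mult. f_equal. f_equal. rewrite <- (sqrt_p_sq beta k Hb) at 3. ring. }
  apply vec_ext; intros k [].
  - unfold efun, edamp, weight at 1, laurent, coeffs. rewrite Eh.
    unfold X, ecoord, ssub, sscal, Ad. simpl fst. simpl snd. simpl negb. cbv iota.
    rewrite !fourier_dsub, fourier_dscal, fourier_Top by exact Hb.
    replace (RtoC (m_ beta k)) with (RtoC (freq beta k) * RtoC (sqrt (p_ beta k)))%C.
    + ring.
    + rewrite <- RtoC_mult, m_p by exact Hb. f_equal. unfold freq.
      rewrite <- (sqrt_p_sq beta k Hb) at 3. ring.
  - unfold efun, edamp, weight at 1, laurent, coeffs. rewrite Eu.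
    unfold X, ecoord, ssub, sscal, Ad. simpl fst. simpl snd. simpl negb. cbv iota.
    rewrite !fourier_dsub, !fourier_dscal, fourier_dderiv.
    unfold freq. rewrite RtoC_mult, RtoC_m1. ring.
Qed.


(** For [k <> 0], [freq beta k ^ 2] is comparable to [|k|] and [p_ beta k] to [1 / |k|]. *)
Lemma dom_l2 beta x : 0 < beta -> l2 (ecoord beta x) ->
  Ad_dom x <-> l2 (fun k s => RtoC (freq beta k) * ecoord beta x k s)%C.
Proof.
  intros Hb Hx. set (X := ecoord beta x) in *.
  set (SX := fun k s => (RtoC (freq beta k) * X k s)%C).
  assert (E : forall k, ip SX SX k = Rabs (IZR k) * (Rabs (IZR k) * p_ beta k) * Cmod (fourier (fst x) k) ^ 2
    + (Rabs (IZR k) * p_ beta k) ^ 2 * Cmod (fourier (snd x) k) ^ 2).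
  { intros k. rewrite ip_self. unfold SX, X, ecoord. rewrite !Cmod_mult, !Cmod_R.
    rewrite (Rabs_pos_eq (sqrt _)) by apply sqrt_pos.
    rewrite !Rpow_mult_distr, !pow2_abs, freq_sq, sqrt_p_sq, <- (pow2_abs (IZR k)) by exact Hb. ring. }
  pose proof (tanh_pos beta Hb) as T.
  set (t := tanh beta / beta). assert (Ht : 0 < t) by (apply Rdiv_lt_0_compat; lra).
  unfold Ad_dom, Sobolev. split.
  - intros [H1 H2]. apply l2_le with (fun k =>
      1 / beta * (Rpower (bracket k) (2 * (1 / 2)) * Cmod (fourier (fst x) k) ^ 2)
      + (1 / beta) ^ 2 * (Rpower (bracket k) (2 * 0) * Cmod (fourier (snd x) k) ^ 2)).
    + intros k. rewrite E. destruct (Rpower_bracket k) as [-> [-> _]].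
      destruct (bracket_bounds k) as [_ [B2 _]]. pose proof (abs_p_le beta k Hb) as P.
      pose proof (Rabs_pos (IZR k)). pose proof (p_pos beta k Hb).
      assert (0 <= Rabs (IZR k) * p_ beta k) by nra.
      pose proof (pow2_ge_0 (Cmod (fourier (fst x) k))). pose proof (pow2_ge_0 (Cmod (fourier (snd x) k))).
      apply Rplus_le_compat.
      * rewrite <- (Rmult_assoc (1 / beta)). apply Rmult_le_compat_r; [lra|].
        rewrite (Rmult_comm (1 / beta)). apply Rmult_le_compat; lra.
      * rewrite Rmult_1_l. apply Rmult_le_compat_r; [lra|]. apply pow_incr. lra.
    + apply ex_Zseries_plus; now apply ex_Zseries_scal.
  - intros H. change (l2 SX) in H. split.
    + apply ex_Zseries_pos_le with (c := 1 + 1 / t) (g := fun k => ip X X k + ip SX SX k);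
        [|now apply ex_Zseries_plus].
      intros k. rewrite E. destruct (Rpower_bracket k) as [_ [-> _]]. unfold X. rewrite ip_ecoord by exact Hb.
      destruct (bracket_bounds k) as [B1 [B2 B3]].
      pose proof (Rabs_pos (IZR k)) as Pk. pose proof (p_pos beta k Hb) as Pp.
      set (F := Cmod (fourier (fst x) k) ^ 2). set (G := Cmod (fourier (snd x) k) ^ 2).
      assert (PF : 0 <= F) by apply pow2_ge_0. assert (PG : 0 <= G) by apply pow2_ge_0.
      split; [nra|].
      assert (Hkt : Rabs (IZR k) <= 1 / t * (Rabs (IZR k) * (Rabs (IZR k) * p_ beta k))).
      { destruct (Z.eq_dec k 0) as [->|Hk]; [rewrite Rabs_R0; lra|].
        pose proof (abs_p_ge beta k Hb Hk) as A. fold t in A.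
        apply Rmult_le_reg_l with t; [exact Ht|].
        replace (t * (1 / t * (Rabs (IZR k) * (Rabs (IZR k) * p_ beta k))))
          with (Rabs (IZR k) * (Rabs (IZR k) * p_ beta k)) by (field; lra). nra. }
      assert (P1t : 0 < 1 / t) by (apply Rdiv_lt_0_compat; lra).
      set (Q := Rabs (IZR k) * (Rabs (IZR k) * p_ beta k)) in *.
      assert (PQ : 0 <= Q) by (unfold Q; apply Rmult_le_pos; nra).
      assert (0 <= p_ beta k * G) by nra.
      assert (0 <= (Rabs (IZR k) * p_ beta k) ^ 2 * G) by (apply Rmult_le_pos; [apply pow2_ge_0|lra]).
      apply Rle_trans with ((1 + 1 / t * Q) * F); [apply Rmult_le_compat_r; lra|].
      apply Rle_trans with ((1 + 1 / t) * (F + Q * F)); [nra|].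
      apply Rmult_le_compat_l; lra.
    + apply ex_Zseries_pos_le with (c := 1 + (1 / t) ^ 2) (g := fun k => ip X X k + ip SX SX k);
        [|now apply ex_Zseries_plus].
      intros k. rewrite E. destruct (Rpower_bracket k) as [-> _]. unfold X. rewrite ip_ecoord by exact Hb.
      pose proof (Rabs_pos (IZR k)) as Pk. pose proof (p_pos beta k Hb) as Pp.
      set (F := Cmod (fourier (fst x) k) ^ 2). set (G := Cmod (fourier (snd x) k) ^ 2).
      assert (PF : 0 <= F) by apply pow2_ge_0. assert (PG : 0 <= G) by apply pow2_ge_0.
      split; [nra|].
      assert (PkF : 0 <= Rabs (IZR k) * (Rabs (IZR k) * p_ beta k) * F).
      { apply Rmult_le_pos; [apply Rmult_le_pos; nra|lra]. }
      assert (Pt : 0 <= (1 / t) ^ 2) by apply pow2_ge_0.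
      destruct (Z.eq_dec k 0) as [->|Hk].
      * unfold p_ in *. simpl Z.eq_dec in *. cbv iota in *. rewrite Rabs_R0 in *. nra.
      * pose proof (abs_p_ge beta k Hb Hk) as A. fold t in A.
        set (r := Rabs (IZR k) * p_ beta k) in *.
        assert (t ^ 2 <= r ^ 2) by (apply pow_incr; lra).
        assert (Et : (1 / t) ^ 2 * t ^ 2 = 1) by (field; lra).
        assert (1 <= (1 / t) ^ 2 * r ^ 2) by (apply Rle_trans with ((1 / t) ^ 2 * t ^ 2); [lra|apply Rmult_le_compat_l; lra]).
        assert (G <= (1 / t) ^ 2 * r ^ 2 * G) by nra.
        assert (0 <= r ^ 2 * G) by (apply Rmult_le_pos; [apply pow2_ge_0|lra]).
        assert (0 <= p_ beta k * G) by nra.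
        rewrite Rmult_1_l.
        apply Rle_trans with ((1 / t) ^ 2 * (r ^ 2 * G)); [lra|].
        apply Rle_trans with ((1 + (1 / t) ^ 2) * (r ^ 2 * G)); [lra|].
        apply Rmult_le_compat_l; lra.
Qed.

Lemma dom_energy x : Ad_dom x -> energy x.
Proof.
  intros [H1 H2]. unfold energy, Sobolev in *. split.
  - apply ex_Zseries_pos_le with (c := 1) (2 := H1). intros k.
    destruct (Rpower_bracket k) as [-> [-> _]]. destruct (bracket_bounds k) as [B _].
    pose proof (pow2_ge_0 (Cmod (fourier (fst x) k))). nra.
  - apply ex_Zseries_pos_le with (c := 1) (2 := H2). intros k.
    destruct (Rpower_bracket k) as [-> [_ ->]]. destruct (bracket_bounds k) as [B _].
    pose proof (pow2_ge_0 (Cmod (fourier (snd x) k))).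
    assert (0 < / bracket k <= 1).
    { split; [apply Rinv_0_lt_compat; lra|]. rewrite <- Rinv_1. apply Rinv_le_contravar; lra. }
    nra.
Qed.

(** * Existence of the resolvent *)

(** The eigenvectors of the symmetric coupling of the two components are their sum and their
    difference. *)
Definition rot (x : vec) : vec := fun k s =>
  (RtoC (/ sqrt 2) * (x k true + (if s then x k false else - x k false)))%C.

Lemma inv_sqrt2_sq : / sqrt 2 * / sqrt 2 = / 2.
Proof. rewrite <- Rinv_mult, sqrt_sqrt; lra. Qed.

Lemma rot_rot x : rot (rot x) = x.
Proof.
  assert (E : (RtoC (/ sqrt 2) * RtoC (/ sqrt 2))%C = RtoC (/ 2)).
  { now rewrite <- RtoC_mult, inv_sqrt2_sq. }
  assert (E2 : (RtoC (/ 2) + RtoC (/ 2))%C = 1%C) by (rewrite <- RtoC_plus; f_equal; field).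
  apply vec_ext; intros k [];
    unfold rot; set (r := RtoC (/ sqrt 2)) in *; set (h := RtoC (/ 2)) in *.
  - transitivity (r * r * (x k true + x k true))%C; [ring|]. rewrite E.
    transitivity ((h + h) * x k true)%C; [ring|]. rewrite E2. ring.
  - transitivity (r * r * (x k false + x k false))%C; [ring|]. rewrite E.
    transitivity ((h + h) * x k false)%C; [ring|]. rewrite E2. ring.
Qed.

Lemma ip_rot x y k : ip (rot x) (rot y) k = ip x y k.
Proof.
  unfold ip, rot, cdot, Re, Im. simpl. pose proof inv_sqrt2_sq as E. set (r := / sqrt 2) in *.
  transitivity (2 * (r * r) * (fst (x k true) * fst (y k true) + snd (x k true) * snd (y k true) +
    (fst (x k false) * fst (y k false) + snd (x k false) * snd (y k false)))); [ring|].
  rewrite E. field.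
Qed.

Lemma dot_rot x y : dot (rot x) (rot y) = dot x y.
Proof. apply Zseries_ext. apply ip_rot. Qed.

Lemma dot_rot_l x y : dot (rot x) y = dot x (rot y).
Proof. rewrite <- (rot_rot y) at 1. apply dot_rot. Qed.

Lemma l2_rot x : l2 x -> l2 (rot x).
Proof. apply ex_Zseries_ext. intros k. now rewrite ip_rot. Qed.

Lemma nrm_rot x : nrm (rot x) = nrm x.
Proof. unfold nrm. now rewrite dot_rot. Qed.

Lemma rot_lin r x y : rot (vlin r x y) = vlin r (rot x) (rot y).
Proof.
  apply vec_ext; intros k [];
    unfold rot, vlin; ring.
Qed.

Definition rdamp (beta : R) (a b : rtest) (x : vec) : vec := rot (edamp beta a b (rot x)).

Lemma rdamp_damping beta a b K : damping K (edamp beta a b) -> damping K (rdamp beta a b).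
Proof.
  intros [H1 [H2 H3]]. unfold rdamp. split; [|split].
  - intros x Hx. now apply l2_rot, H1, l2_rot.
  - intros r x y Hx Hy. rewrite rot_lin, H2 by now apply l2_rot. apply rot_lin.
  - intros x Hx. rewrite dot_rot, dot_rot_l. now apply H3, l2_rot.
Qed.

(** The distances of [om] from the eigenvalues of the undamped generator. *)
Definition detuning (beta om : R) (k : Z) (s : bool) : R :=
  if s then om + freq beta k else om - freq beta k.

Lemma rot_efun beta om a b x k s :
  rot (efun beta om a b x) k s =
  (Ci * RtoC (detuning beta om k s) * rot x k s + rdamp beta a b (rot x) k s)%C.
Proof.
  unfold rdamp. rewrite rot_rot. unfold efun, detuning.
  destruct s; unfold rot; cbn [negb]; rewrite ?RtoC_plus, ?RtoC_minus; ring.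
Qed.

Lemma W_ends f n : (1 <= n)%nat -> (forall k, (Z.abs k < Z.of_nat n)%Z -> f k = 0) ->
  W f n = f (Z.of_nat n) + f (- Z.of_nat n)%Z.
Proof.
  intros Hn H. destruct n as [|n]; [lia|]. cbn [W].
  rewrite (W_ext_in f (fun _ => 0 * 0)) by (intros k Hk; rewrite H by lia; ring).
  rewrite (W_scal 0 (fun _ => 0)). ring.
Qed.

Lemma CW_ends f n : (1 <= n)%nat -> (forall k, (Z.abs k < Z.of_nat n)%Z -> f k = RtoC 0) ->
  CW f n = (f (Z.of_nat n) + f (- Z.of_nat n)%Z)%C.
Proof.
  intros Hn H. apply Ceq; simpl.
  - apply (W_ends (fun k => Re (f k))); [exact Hn|]. intros k Hk. now rewrite H.
  - apply (W_ends (fun k => Im (f k))); [exact Hn|]. intros k Hk. now rewrite H.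
Qed.

(** On the modes [e^{iNx}], [e^{-iNx}] the damping [a^2] is the matrix with diagonal [(a^2)^(0)] and
    off-diagonal entries [(a^2)^(2N)] and [(a^2)^(-2N)], hence positive when the latter are small; the
    other component of the damping only helps. *)
Lemma rdamp_kernel beta a b N (x : vec) : 0 < beta -> (1 <= N)%nat ->
  (forall k s, x k s <> RtoC 0 -> k = (if s then - Z.of_nat N else Z.of_nat N)%Z) ->
  Cmod (coef (rsquare a) (2 * Z.of_nat N)) <= Re (coef (rsquare a) 0) / 2 ->
  Cmod (coef (rsquare a) (- (2 * Z.of_nat N))) <= Re (coef (rsquare a) 0) / 2 ->
  Re (coef (rsquare a) 0) / 4 * dot x x <= dot (rdamp beta a b x) x.
Proof.
  intros Hb HN Hsupp Hp Hm. set (q := rsquare a) in *. set (n := Z.of_nat N) in *.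
  assert (Hn : (1 <= n)%Z) by (unfold n; lia).
  assert (X0 : forall (k : Z) (s : bool), k <> (if s then - n else n)%Z -> x k s = RtoC 0).
  { intros k s Hk. destruct (Ceq_dec (x k s) 0) as [E|E]; [exact E|]. now apply Hsupp in E. }
  assert (Hx : l2 x).
  { apply (l2_finite x N). intros k s Hk. apply X0. destruct s; lia. }
  set (y := weight beta (rot x)).
  assert (Hy : l2 y) by (apply l2_weight; [exact Hb|now apply l2_rot]).
  assert (E1 : dot (rdamp beta a b x) x = dot (laurent (coeffs a b) y) y).
  { unfold rdamp, edamp. now rewrite dot_rot_l, dot_weight. }
  rewrite E1. set (L := laurent (coeffs a b)).
  destruct (laurent_rsquare_damping (fun s => if s then a else b)) as [K [HK D]].
  change (damping K L) in D.
  destruct D as [D1 [D2 D3]].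
  set (et := (fun k s => if s then y k s else RtoC 0) : vec).
  set (ef := (fun k s => if s then RtoC 0 else y k s) : vec).
  assert (Y0 : forall (k : Z) (s : bool), (Z.abs k <> n)%Z -> y k s = RtoC 0).
  { intros k s Hk. unfold y, weight, rot. rewrite !X0 by lia. destruct s; ring. }
  assert (Het : l2 et).
  { apply (l2_finite et N). intros k s Hk. unfold et. destruct s; [apply Y0; lia|reflexivity]. }
  assert (Hef : l2 ef).
  { apply (l2_finite ef N). intros k s Hk. unfold ef. destruct s; [reflexivity|apply Y0; lia]. }
  assert (E2 : dot (L y) y = dot (L et) et + dot (L ef) ef).
  { unfold dot. rewrite <- Zseries_plus by (apply ex_ip; auto). apply Zseries_ext. intros k.
    assert (Et : L et k true = L y k true) by reflexivity.
    assert (Ef : L ef k false = L y k false) by reflexivity.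
    unfold ip. rewrite Et, Ef. unfold et, ef, cdot. simpl. ring. }
  assert (Pf : 0 <= dot (L ef) ef).
  { pose proof (D3 ef Hef) as P. pose proof (dot_pos _ (D1 ef Hef)). nra. }
  rewrite E2. apply Rle_trans with (dot (L et) et); [|lra].
  set (u := y n true). set (v := y (- n)%Z true).
  assert (Eu : u = (RtoC (/ sqrt 2) * x n false)%C).
  { unfold u, y, weight, rot. rewrite (X0 n true) by lia. ring. }
  assert (Ev : v = (RtoC (/ sqrt 2) * x (- n)%Z true)%C).
  { unfold v, y, weight, rot. rewrite (X0 (- n)%Z false) by lia. ring. }
  assert (EL : forall k, L et k true = (coef q (k - n) * u + coef q (k + n) * v)%C).
  { intros k. unfold L. rewrite (laurent_finite (coeffs a b) et N).
    - rewrite CW_ends.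
      + fold n. unfold et, coeffs. fold q. fold u. fold v.
        now replace (k - - n)%Z with (k + n)%Z by lia.
      + exact HN.
      + intros j Hj. fold n in Hj. unfold et. rewrite Y0 by lia. ring.
    - intros j s Hj. fold n in Hj. unfold et. destruct s; [apply Y0; lia|reflexivity]. }
  assert (Ed : dot (L et) et = cdot (L et n true) u + cdot (L et (- n)%Z true) v).
  { destruct (Zseries_finite (ip (L et) et) N) as [_ E].
    - intros k Hk. unfold ip, et. rewrite Y0 by lia. unfold cdot. simpl. ring.
    - unfold dot. rewrite E, W_ends.
      + fold n. unfold ip, et. fold u. fold v. unfold cdot. simpl. ring.
      + exact HN.
      + intros k Hk. fold n in Hk. unfold ip, et. rewrite Y0 by lia. unfold cdot. simpl. ring. }
  assert (Exx : dot x x = Cmod (x n false) ^ 2 + Cmod (x (- n)%Z true) ^ 2).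
  { destruct (Zseries_finite (ip x x) N) as [_ E].
    - intros k Hk. rewrite ip_self, !X0, Cmod_0 by lia. ring.
    - unfold dot. rewrite E, W_ends.
      + fold n. rewrite !ip_self, (X0 n true), (X0 (- n)%Z false), Cmod_0 by lia. ring.
      + exact HN.
      + intros k Hk. fold n in Hk. rewrite ip_self, !X0, Cmod_0 by lia. ring. }
  rewrite Ed, !EL, Exx.
  replace (n - n)%Z with 0%Z by lia. replace (n + n)%Z with (2 * n)%Z by lia.
  replace (- n - n)%Z with (- (2 * n))%Z by lia. replace (- n + n)%Z with 0%Z by lia.
  assert (I0 : Im (coef q 0) = 0).
  { unfold coef, mean. simpl. rewrite (rmean_ext _ (fun _ => 0)); [apply rmean_const|].
    intros z _. simpl. rewrite Rmult_0_l, sin_0. ring. }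
  assert (Mu : Cmod u ^ 2 = / 2 * Cmod (x n false) ^ 2).
  { rewrite Eu, Cmod_mult, Cmod_R, Rpow_mult_distr, pow2_abs. f_equal.
    rewrite <- inv_sqrt2_sq. ring. }
  assert (Mv : Cmod v ^ 2 = / 2 * Cmod (x (- n)%Z true) ^ 2).
  { rewrite Ev, Cmod_mult, Cmod_R, Rpow_mult_distr, pow2_abs. f_equal.
    rewrite <- inv_sqrt2_sq. ring. }
  set (q0 := Re (coef q 0)) in *.
  assert (Cr : forall c z w, Cmod c <= q0 / 2 -> - (q0 / 4 * (Cmod z ^ 2 + Cmod w ^ 2)) <= cdot (c * z)%C w).
  { intros c z w Hc.
    assert (A : Rabs (cdot (c * z)%C w) <= Cmod c * Cmod z * Cmod w).
    { replace (cdot (c * z)%C w) with (Re (c * z * Cconj w)%C) by (unfold cdot, Re, Im; simpl; ring).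
      eapply Rle_trans; [apply re_le_Cmod|]. rewrite !Cmod_mult, Cmod_conj. lra. }
    apply Rabs_le_between in A. pose proof (Cmod_ge_0 z). pose proof (Cmod_ge_0 w). pose proof (Cmod_ge_0 c).
    assert (Cmod c * (Cmod z * Cmod w) <= q0 / 2 * (Cmod z * Cmod w)) by (apply Rmult_le_compat_r; nra).
    assert (Cmod z * Cmod w <= (Cmod z ^ 2 + Cmod w ^ 2) / 2).
    { pose proof (pow2_ge_0 (Cmod z - Cmod w)). nra. }
    nra. }
  pose proof (Cr _ v u Hp) as C1. pose proof (Cr _ u v Hm) as C2.
  assert (Dg : forall z, cdot (coef q 0 * z)%C z = q0 * Cmod z ^ 2).
  { intros z. rewrite Cmod2_alt. unfold q0. revert I0. generalize (coef q 0). intros c I0.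
    unfold cdot, Re, Im in *. simpl. rewrite I0. ring. }
  assert (Sp : forall z w t, cdot (z + w)%C t = cdot z t + cdot w t).
  { intros z w t. unfold cdot, Re, Im. simpl. ring. }
  rewrite !Sp, !Dg. rewrite Mu, Mv in C1, C2 |- *. lra.
Qed.

(** At [omega_N] the undamped generator is resonant on the modes [e^{iNx}] and [e^{-iNx}] only, and
    these feel the damping [a^2]. *)
Lemma resolvent_exists beta a b N : 0 < beta -> (1 <= N)%nat ->
  0 < Re (coef (rsquare a) 0) ->
  Cmod (coef (rsquare a) (2 * Z.of_nat N)) <= Re (coef (rsquare a) 0) / 2 ->
  Cmod (coef (rsquare a) (- (2 * Z.of_nat N))) <= Re (coef (rsquare a) 0) / 2 ->
  exists Rz, is_resolvent beta Ad_dom (Ad beta a b) (Ci * RtoC (omega beta N))%C Rz.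
Proof.
  intros Hb HN Hq0 Hp Hm. set (om := omega beta N). set (n := Z.of_nat N) in *.
  assert (Eom : om = freq beta n) by now apply omega_freq.
  destruct (edamp_damping beta a b Hb) as [K [HK HD]].
  pose proof (rdamp_damping beta a b K HD) as HR.
  destruct (freq_gap beta n Hb) as [delta [Hdelta Hgap]].
  assert (Hdk : forall (k : Z) (s : bool), k <> (if s then - n else n)%Z -> delta <= Rabs (detuning beta om k s)).
  { intros k s Hk. unfold detuning. rewrite Eom. destruct s.
    - replace (freq beta n + freq beta k) with (freq beta n - freq beta (- k))
        by (rewrite freq_odd; ring). apply Hgap. lia.
    - now apply Hgap. }
  destruct (damped_diagonal_solvable (detuning beta om) (rdamp beta a b) K delta
    (Re (coef (rsquare a) 0) / 4)) as [Sol [M [HM Bound]]].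
  - exact HK.
  - exact Hdelta.
  - lra.
  - exact HR.
  - intros k s. destruct (Z.eq_dec k (if s then - n else n)%Z) as [->|Hk]; [left|right; now apply Hdk].
    unfold detuning. rewrite Eom. destruct s; [rewrite freq_odd|]; ring.
  - intros x Hx H0. apply (rdamp_kernel beta a b N x Hb HN); [|exact Hp|exact Hm].
    intros k s Hxk. destruct (Z.eq_dec k (if s then - n else n)%Z) as [E|E]; [exact E|].
    exfalso. apply Hxk. apply H0. intros E0. pose proof (Hdk k s E) as P.
    rewrite E0, Rabs_R0 in P. lra.
  - set (E := fun x => ssub (sscal (Ci * RtoC om) x) (Ad beta a b x)).
    destruct HR as [HR1 [HR2 _]].
    assert (Eq : forall x k s, l2 (ecoord beta x) ->
      (Ci * RtoC (detuning beta om k s) * rot (ecoord beta x) k s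
        + rdamp beta a b (rot (ecoord beta x)) k s)%C = rot (ecoord beta (E x)) k s).
    { intros x k s Hx. unfold E. rewrite ecoord_shifted by assumption. now rewrite rot_efun. }
    assert (Hex : forall y, energy y -> exists x, Ad_dom x /\ E x = y).
    { intros y Hy. apply (energy_l2 beta) in Hy; [|exact Hb].
      destruct (Sol (rot (ecoord beta y)) (l2_rot _ Hy)) as [x [Hx Ex]].
      set (X := rot x). assert (HX : l2 X) by now apply l2_rot.
      exists (of_ecoord beta X). set (xs := of_ecoord beta X).
      assert (Exs : ecoord beta xs = X) by now apply ecoord_of_ecoord.
      assert (HXs : l2 (ecoord beta xs)) by now rewrite Exs.
      split.
      - apply (dom_l2 beta xs Hb HXs). rewrite Exs.
        set (v := vsub (rot (ecoord beta y)) (rdamp beta a b x)).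
        assert (Hv : l2 v) by (apply l2_lin; [now apply l2_rot|now apply HR1]).
        set (dx := (fun k s => RtoC (detuning beta om k s) * x k s)%C : vec).
        assert (Hdx : l2 dx).
        { apply (l2_comparison dx v 1); [lra| |exact Hv]. intros k s. unfold v, vsub, vlin.
          rewrite <- Ex.
          replace (Ci * RtoC (detuning beta om k s) * x k s + rdamp beta a b x k s
            + RtoC (-1) * rdamp beta a b x k s)%C with (Ci * dx k s)%C
            by (unfold dx; rewrite RtoC_m1; ring).
          rewrite Cmod_mult, Cmod_Ci. lra. }
        set (fx := (fun k s => RtoC (freq beta k) * x k s)%C : vec).
        assert (Hfx : l2 fx).
        { apply (l2_comparison fx (vlin (- om) dx x) 1); [lra| |now apply l2_lin].
          intros k s. unfold fx, vlin, dx, detuning.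
          destruct s; [right; rewrite Rmult_1_l; f_equal|
            right; rewrite Rmult_1_l, <- Cmod_opp; f_equal];
            rewrite ?RtoC_plus, ?RtoC_minus, ?RtoC_opp; ring. }
        replace (fun k s => RtoC (freq beta k) * X k s)%C with (rot fx); [now apply l2_rot|].
        apply vec_ext; intros k [];
          unfold X, rot, fx; ring.
      - apply (ecoord_inj beta _ _ Hb). rewrite <- (rot_rot (ecoord beta (E xs))),
          <- (rot_rot (ecoord beta y)). f_equal.
        apply vec_ext; intros k s.
        rewrite <- Eq by exact HXs. rewrite Exs. unfold X. rewrite rot_rot. apply Ex. }
    assert (Hl2 : forall x, Ad_dom x -> l2 (ecoord beta x)).
    { intros x Hx. apply (energy_l2 beta x Hb). now apply dom_energy. }
    assert (HE : forall x, Ad_dom x -> l2 (ecoord beta (E x))).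
    { intros x Hx. pose proof (Hl2 x Hx) as HX. pose proof (proj1 (dom_l2 beta x Hb HX) Hx) as HS.
      unfold E. rewrite ecoord_shifted by assumption.
      destruct HD as [HD1 _]. pose proof (HD1 _ HX) as HXD.
      set (X := ecoord beta x) in *.
      set (u := (fun k s => Ci * RtoC om * X k s)%C : vec).
      set (v := (fun k s => Ci * RtoC (freq beta k) * X k (negb s))%C : vec).
      replace (efun beta om a b X) with (vlin 1 (vlin 1 u v) (edamp beta a b X)).
      2:{ unfold efun, u, v. vec_ring. }
      apply l2_lin; [|exact HXD]. apply l2_lin.
      - apply (l2_comparison u X (Rabs om)); [apply Rabs_pos| |exact HX]. intros k s. unfold u.
        rewrite !Cmod_mult, Cmod_Ci, Cmod_R. lra.
      - revert HS. apply ex_Zseries_ext. intros k. rewrite !ip_self. unfold v.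
        rewrite !Cmod_mult, Cmod_Ci. simpl negb. ring. }
    assert (Hinj : forall x x', Ad_dom x -> Ad_dom x' -> E x = E x' -> x = x').
    { intros x x' Hx Hx' He. pose proof (Hl2 x Hx) as HX. pose proof (Hl2 x' Hx') as HX'.
      set (u := rot (ecoord beta x)). set (u' := rot (ecoord beta x')).
      assert (Hu : l2 u) by now apply l2_rot. assert (Hu' : l2 u') by now apply l2_rot.
      assert (Hd : nrm (vsub u u') <= M * nrm vzero).
      { apply Bound; [now apply l2_lin|apply l2_zero|]. intros k s. unfold vsub.
        rewrite HR2 by assumption.
        pose proof (Eq x k s HX) as E1. pose proof (Eq x' k s HX') as E2. fold u in E1. fold u' in E2.
        rewrite <- He, <- E1 in E2. unfold vlin, vzero.
        transitivity ((Ci * RtoC (detuning beta om k s) * u k s + rdamp beta a b u k s)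
          - (Ci * RtoC (detuning beta om k s) * u' k s + rdamp beta a b u' k s))%C.
        - rewrite RtoC_m1. ring.
        - rewrite E2. ring. }
      assert (Huu : l2 (vsub u u')) by now apply l2_lin.
      assert (Hz : vsub u u' = vzero).
      { apply dot_def; [exact Huu|]. rewrite <- nrm_sq by exact Huu.
        pose proof (nrm_pos (vsub u u')). rewrite nrm_zero in Hd. nra. }
      apply (ecoord_inj beta _ _ Hb). rewrite <- (rot_rot (ecoord beta x)), <- (rot_rot (ecoord beta x')).
      fold u u'. f_equal. apply vec_ext; intros k s. apply (f_equal (fun v => v k s)) in Hz.
      unfold vsub, vlin, vzero in Hz. rewrite RtoC_m1 in Hz.
      transitivity (u k s + - RtoC 1 * u' k s + u' k s)%C; [ring|]. rewrite Hz. ring. }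
    set (Rz := fun y => epsilon (inhabits y) (fun x => Ad_dom x /\ E x = y)).
    assert (HRz : forall y, energy y -> Ad_dom (Rz y) /\ E (Rz y) = y).
    { intros y Hy. apply (epsilon_spec (inhabits y) _ (Hex y Hy)). }
    exists Rz. split; [exact HRz|]. split.
    + intros x Hx. pose proof (proj2 (energy_l2 beta (E x) Hb) (HE x Hx)) as He.
      split; [exact He|]. destruct (HRz (E x) He) as [H1 H2]. now apply Hinj.
    + exists M. intros y Hy. destruct (HRz y Hy) as [H1 H2].
      pose proof (Hl2 _ H1) as HX. pose proof (proj1 (energy_l2 beta y Hb) Hy) as HY.
      rewrite !energy_norm_nrm by (try exact Hb; try exact Hy; now apply (energy_l2 beta)).
      rewrite <- (nrm_rot (ecoord beta (Rz y))), <- (nrm_rot (ecoord beta y)).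
      pose proof (sqrt_pos (2 * PI)).
      assert (nrm (rot (ecoord beta (Rz y))) <= M * nrm (rot (ecoord beta y))).
      { apply Bound; [now apply l2_rot|now apply l2_rot|]. intros k s.
        rewrite Eq by exact HX. now rewrite H2. }
      nra.
Qed.

(** * A bump function off the support of the damping *)

Definition flat (m : nat) (t : R) : R :=
  if Rlt_dec 0 t then (/ t) ^ m * exp (- / t) else 0.

Lemma exp_ge_pow n y : 0 <= y -> (1 <= n)%nat -> (y / INR n) ^ n <= exp y.
Proof.
  intros Hy Hn. assert (HN : 0 < INR n) by (apply lt_0_INR; lia).
  assert (E : forall k z, exp (INR k * z) = exp z ^ k).
  { induction k as [|k IH]; intros z; [simpl; now rewrite Rmult_0_l, exp_0|].
    rewrite S_INR, Rmult_plus_distr_r, exp_plus, IH, Rmult_1_l. simpl. ring. }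
  replace y with (INR n * (y / INR n)) at 2 by (field; lra). rewrite E.
  apply pow_incr. split; [apply Rdiv_le_0_compat; lra|].
  destruct (Req_dec (y / INR n) 0) as [->|H]; [rewrite exp_0; lra|].
  pose proof (exp_ineq1 (y / INR n) H). lra.
Qed.

Lemma flat_square m t : Rabs (flat m t) <= INR (m + 2) ^ (m + 2) * t ^ 2.
Proof.
  unfold flat. destruct (Rlt_dec 0 t) as [H|H].
  - assert (HN : 0 < INR (m + 2)) by (apply lt_0_INR; lia).
    assert (Hi : 0 < / t) by now apply Rinv_0_lt_compat.
    assert (Hp : 0 < INR (m + 2) ^ (m + 2)) by now apply pow_lt.
    assert (Hm : 0 < (/ t) ^ m) by now apply pow_lt.
    pose proof (exp_pos (/ t)) as He.
    rewrite Rabs_pos_eq by (pose proof (exp_pos (- / t)); nra).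
    pose proof (exp_ge_pow (m + 2) (/ t) (Rlt_le _ _ Hi) ltac:(lia)) as G.
    unfold Rdiv in G. rewrite Rpow_mult_distr, (pow_inv (INR (m + 2))), (pow_add (/ t)) in G.
    rewrite exp_Ropp. apply Rmult_le_reg_r with (exp (/ t)); [exact He|].
    rewrite Rmult_assoc, Rinv_l, Rmult_1_r by lra.
    apply Rle_trans with (INR (m + 2) ^ (m + 2) * t ^ 2 *
      ((/ t) ^ m * (/ t) ^ 2 * / INR (m + 2) ^ (m + 2))).
    + right. set (z := (/ t) ^ m). field. lra.
    + apply Rmult_le_compat_l; [|exact G]. apply Rmult_le_pos; [lra|apply pow2_ge_0].
  - rewrite Rabs_R0. apply Rmult_le_pos; [apply pow_le, pos_INR|apply pow2_ge_0].
Qed.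

(** The family [t^{-m} e^{-1/t}] is closed under differentiation up to linear combinations, so
    smoothness follows by induction from this one derivative. *)
Lemma flat_derive m t : is_derive (flat m) t (- INR m * flat (S m) t + flat (S (S m)) t).
Proof.
  destruct (Rtotal_order t 0) as [H|[->|H]].
  - apply (is_derive_ext_loc (fun _ => 0)).
    + exists (mkposreal (- t) ltac:(lra)). intros y Hy. unfold flat.
      destruct (Rlt_dec 0 y) as [L|]; [|reflexivity]. exfalso.
      change (Rabs (y - t) < - t) in Hy. apply Rabs_def2 in Hy. lra.
    + unfold flat. destruct (Rlt_dec 0 t); [lra|].
      replace (- INR m * 0 + 0) with 0 by ring.
      exact (@is_derive_const R_AbsRing R_NormedModule 0 t).
  - assert (Z : forall k, flat k 0 = 0).
    { intros k. unfold flat. destruct (Rlt_dec 0 0); lra. }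
    rewrite !Z. replace (- INR m * 0 + 0) with 0 by ring.
    apply is_derive_Reals. intros eps Heps.
    set (C0 := INR (m + 2) ^ (m + 2)).
    assert (HC : 0 <= C0) by apply pow_le, pos_INR.
    assert (Hd : 0 < eps / (C0 + 1)) by (apply Rdiv_lt_0_compat; lra).
    exists (mkposreal _ Hd). intros h Hh Hlt. simpl in Hlt.
    rewrite Rplus_0_l, Z, !Rminus_0_r. unfold Rdiv. rewrite Rabs_mult, Rabs_inv.
    assert (Hh0 : 0 < Rabs h) by now apply Rabs_pos_lt.
    apply Rmult_lt_reg_r with (Rabs h); [exact Hh0|].
    rewrite Rmult_assoc, Rinv_l, Rmult_1_r by lra.
    eapply Rle_lt_trans; [apply flat_square|]. fold C0. rewrite <- (pow2_abs h).
    assert (Rabs h * (C0 + 1) < eps).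
    { apply Rmult_lt_reg_r with (/ (C0 + 1)); [apply Rinv_0_lt_compat; lra|].
      rewrite Rmult_assoc, Rinv_r, Rmult_1_r by lra. exact Hlt. }
    nra.
  - apply (is_derive_ext_loc (fun y => (/ y) ^ m * exp (- / y))).
    + exists (mkposreal t H). intros y Hy. unfold flat.
      destruct (Rlt_dec 0 y) as [L|L]; [reflexivity|]. exfalso.
      change (Rabs (y - t) < t) in Hy. apply Rabs_def2 in Hy. lra.
    + unfold flat. destruct (Rlt_dec 0 t) as [_|]; [|lra].
      auto_derive; [lra|]. destruct m as [|m].
      * simpl. field. lra.
      * rewrite S_INR. simpl. field. lra.
Qed.

Lemma flat_smooth m : smooth (flat m).
Proof.
  intros n. revert m.
  assert (K : forall n m k, (k <= n)%nat -> forall x, ex_derive_n (flat m) k x).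
  { clear. induction n as [|n IH]; intros m k Hk.
    - replace k with 0%nat by lia. intros x. exact I.
    - destruct k as [|k]; [intros x; exact I|]. apply ex_derive_n_S.
      + intros x. eexists. apply flat_derive.
      + intros x. apply (ex_derive_n_ext (fun x => - INR m * flat (S m) x + flat (S (S m)) x)).
        { intros t. symmetry. apply is_derive_unique, flat_derive. }
        apply ex_derive_n_plus; apply filter_forall; intros y j Hj.
        * apply ex_derive_n_scal_l. apply IH. lia.
        * apply IH. lia. }
  intros m. now apply (K n).
Qed.

(** The functions [f(g(x)) h(x)] are closed under differentiation up to sums. *)
Lemma smooth_comp f g : smooth f -> smooth g -> smooth (fun x => f (g x)).
Proof.
  assert (K : forall n f g h, smooth f -> smooth g -> smooth h -> forall k, (k <= n)%nat ->
    forall x, ex_derive_n (fun x => f (g x) * h x) k x).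
  { clear. induction n as [|n IH]; intros f g h Hf Hg Hh k Hk.
    - replace k with 0%nat by lia. intros x. exact I.
    - destruct k as [|k]; [intros x; exact I|].
      assert (D : forall x, is_derive (fun x => f (g x) * h x) x
        (Derive f (g x) * (Derive g x * h x) + f (g x) * Derive h x)).
      { intros x. auto_derive.
        - repeat split; now apply smooth_ex_derive.
        - change (fun x0 : R => g x0) with g. change (fun x0 : R => f x0) with f.
          change (fun x0 : R => h x0) with h. ring. }
      apply ex_derive_n_S.
      + intros x. eexists. apply D.
      + intros x. apply (ex_derive_n_ext (fun x =>
          Derive f (g x) * (Derive g x * h x) + f (g x) * Derive h x)).
        { intros t. symmetry. apply is_derive_unique, D. }
        apply ex_derive_n_plus; apply filter_forall; intros y j Hj.
        * apply (IH (Derive f) g (fun x => Derive g x * h x));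
            auto using smooth_Derive, smooth_mult. lia.
        * apply (IH f g (Derive h)); auto using smooth_Derive. lia. }
  intros Hf Hg n x. apply (ex_derive_n_ext (fun x => f (g x) * 1)); [intros t; ring|].
  apply (K n f g (fun _ => 1)); auto using smooth_const.
Qed.

Lemma periodic_all (P : R -> Prop) c : (forall x, P (x + 2 * PI) <-> P x) ->
  (forall x, c - PI <= x <= c + PI -> P x) -> forall x, P x.
Proof.
  intros Hp H x.
  assert (Hn : forall n x, P (x + 2 * PI * INR n) <-> P x).
  { induction n as [|n IH]; intros y.
    - replace (y + 2 * PI * INR 0) with y by (simpl; ring). tauto.
    - rewrite S_INR. replace (y + 2 * PI * (INR n + 1)) with (y + 2 * PI * INR n + 2 * PI) by ring.
      now rewrite Hp. }
  pose proof PI_RGT_0 as HP.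
  destruct (archimed ((x - c + PI) / (2 * PI))) as [H1 H2].
  set (r := (x - c + PI) / (2 * PI)) in *. set (k := (up r - 1)%Z).
  assert (Hk : IZR k = IZR (up r) - 1) by apply minus_IZR.
  assert (Hx : x = c - PI + 2 * PI * r) by (unfold r; field; lra).
  assert (Q : P (x - 2 * PI * IZR k)).
  { apply H. rewrite Hk, Hx at 1 2. split; nra. }
  destruct (Z_le_dec 0 k) as [L|L].
  - rewrite <- (Hn (Z.to_nat k)) in Q. rewrite INR_IZR_INZ, Z2Nat.id in Q by lia.
    now replace (x - 2 * PI * IZR k + 2 * PI * IZR k) with x in Q by ring.
  - apply (Hn (Z.to_nat (- k))). rewrite INR_IZR_INZ, Z2Nat.id, opp_IZR by lia.
    now replace (x + 2 * PI * - IZR k) with (x - 2 * PI * IZR k) by ring.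
Qed.

(** [e^{-1/t}] composed with [cos (x - x0) - cos r] is a bump that is periodic by construction. *)
Lemma bump_exists (a : rtest) (O : R -> Prop) : open_off_supp a O ->
  exists chi : test, (forall x, tmul (rsquare a) chi x = RtoC 0) /\
    (forall x, Im (chi x) = 0 /\ 0 <= Re (chi x)) /\ exists x, chi x <> RtoC 0.
Proof.
  intros [Hper [Hop [[x0 Hx0] Hsupp]]].
  destruct (Hop x0 Hx0) as [[r0 Hr0] Hball].
  pose proof PI_RGT_0 as HP.
  set (r := Rmin (r0 / 2) (PI / 2)).
  assert (Hr1 : r <= r0 / 2) by apply Rmin_l.
  assert (Hr2 : r <= PI / 2) by apply Rmin_r.
  assert (Hr : 0 < r) by (apply Rmin_glb_lt; lra).
  set (f := fun x => flat 0 (cos (x - x0) - cos r)).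
  assert (Hcos : smooth (fun x => cos (x - x0))).
  { intros n x. apply (ex_derive_n_ext (fun x => cos x0 * cos (1 * x) + sin x0 * sin (1 * x))).
    { intros t. rewrite Rmult_1_l, cos_minus. ring. }
    exact (smooth_plus _ _ (smooth_mult _ _ (smooth_const (cos x0)) (proj1 (smooth_trig 1)))
      (smooth_mult _ _ (smooth_const (sin x0)) (proj2 (smooth_trig 1))) n x). }
  assert (Hf : smooth f).
  { apply (smooth_comp (flat 0) (fun x => cos (x - x0) - cos r)); [apply flat_smooth|].
    apply smooth_minus; [exact Hcos|apply smooth_const]. }
  assert (Hfp : periodic f).
  { intros x. unfold f. replace (x + 2 * PI - x0) with (x - x0 + 2 * PI) by ring.
    replace (x - x0 + 2 * PI) with (x - x0 + 2 * INR 1 * PI) by (simpl; ring).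
    now rewrite cos_period. }
  assert (Hfpos : forall x, 0 <= f x).
  { intros x. unfold f, flat. destruct (Rlt_dec 0 _) as [L|]; [|lra].
    rewrite pow_O, Rmult_1_l. left. apply exp_pos. }
  assert (Hp : periodic (fun x => RtoC (f x))) by (intros x; now rewrite Hfp).
  exists (mkTest (fun x => RtoC (f x)) Hp Hf (smooth_const 0)). split; [|split].
  - intros x. cbn [tmul rsquare tfun]. rewrite <- RtoC_mult. f_equal.
    enough (Z : a x = 0 \/ f x = 0) by (destruct Z as [-> | ->]; ring).
    revert x. apply (periodic_all (fun x => a x = 0 \/ f x = 0) x0).
    { intros x. now rewrite rtest_per, Hfp. }
    intros x Hx. unfold f, flat. destruct (Rlt_dec 0 (cos (x - x0) - cos r)) as [L|L]; [left|now right].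
    assert (Hxr : Rabs (x - x0) < r).
    { assert (Ec : cos (Rabs (x - x0)) = cos (x - x0)).
      { destruct (Rle_or_lt 0 (x - x0)); [now rewrite Rabs_pos_eq|].
        now rewrite Rabs_left, cos_neg. }
      apply cos_decreasing_0; try lra; try apply Rabs_pos. apply Rabs_le. lra. }
    assert (HO : O x).
    { apply Hball. unfold disc. simpl. lra. }
    destruct (Req_dec (a x) 0) as [E|E]; [exact E|]. exfalso.
    apply (Hsupp x); [now apply adherence_P1|]. now apply (adherence_P1 (fun y => a y <> 0)).
  - intros x. split; [reflexivity|]. apply Hfpos.
  - exists x0. intros E. injection E as E. unfold f, flat in E.
    rewrite Rminus_diag, cos_0 in E.
    assert (C1 : cos r < 1).
    { rewrite <- cos_0. apply cos_decreasing_1; lra. }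
    destruct (Rlt_dec 0 (1 - cos r)) as [_|]; [|lra]. rewrite pow_O, Rmult_1_l in E.
    pose proof (exp_pos (- / (1 - cos r))). lra.
Qed.

(** A nonnegative function with zero mean has only zero coefficients, hence vanishes. *)
Lemma coef_0_pos (q : test) : tnonneg q -> (exists x, q x <> RtoC 0) -> 0 < Re (coef q 0).
Proof.
  intros Hq [x Hx].
  assert (E : Re (coef q 0) = rmean (fun y => Re (q y))).
  { change (Re (coef q 0)) with (rmean (fun y => Re (q y * expi 0 y)%C)).
    apply rmean_ext. intros y _. now rewrite (expi_0 y), Cmult_1_r. }
  assert (Rq : rc (fun y => Re (q y))) by apply cc_test.
  assert (P : 0 <= Re (coef q 0)) by (rewrite E; apply rmean_pos; [exact Rq|apply Hq]).
  destruct P as [P|P]; [exact P|]. exfalso. apply Hx.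
  assert (Z : forall k, coef q k = RtoC 0).
  { intros k. apply Cmod_eq_0. apply Rle_antisym; [|apply Cmod_ge_0].
    rewrite P, E. apply Cmod_mean_le; [apply cc_coef, cc_test|exact Rq|].
    intros y. rewrite Cmod_mult, Cmod_expi, Rmult_1_r. destruct (Hq y) as [Hi Hp].
    replace (q y) with (RtoC (Re (q y))) at 1 by (apply Ceq; [reflexivity|now rewrite Hi]).
    rewrite Cmod_R, Rabs_pos_eq by exact Hp. apply Rle_refl. }
  apply (Clim_unique _ _ _ (fourier_inversion q x)).
  apply Clim_ext with (fun _ => RtoC 0); [|apply Clim_const].
  intros n. rewrite (CW_ext _ (fun _ => RtoC 0 * RtoC 0)%C) by (intros k; rewrite Z; ring).
  rewrite (CW_scal 0 (fun _ => RtoC 0)). ring.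
Qed.

(** * Quasimodes *)

Definition of_test (g : test) : distr := synth (coef g).

Lemma fourier_of_test g k : fourier (of_test g) k = coef g k.
Proof.
  apply fourier_synth. destruct (test_bounded g) as [B [_ H]].
  exists 0%nat, B. intros j. rewrite pow_O, Rmult_1_r. apply Cmod_coef_le; [apply cc_test|exact H].
Qed.

Lemma fourier_dmul_of_test (q g : test) k :
  fourier (dmul q (of_test g)) k = coef (tmul q g) k.
Proof.
  apply (Clim_unique _ _ _ (fourier_dmul q (of_test g) k)).
  apply Clim_ext with (fun n => coef (tmul q (tpartial g n)) k).
  { intros n. unfold tpartial. rewrite coef_tmul_tsum. apply CW_ext. intros j.
    now rewrite fourier_of_test. }
  destruct (test_bounded q) as [Kq [HKq Hq]]. destruct (tpartial_rate g) as [K [HK H]].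
  apply Clim_of_dist with (fun n => (Kq * K) / (INR n + 1)); [|apply is_lim_inv_succ].
  intros n. set (r := tmul q (tsub (tpartial g n) g)).
  replace (coef (tmul q (tpartial g n)) k - coef (tmul q g) k)%C with (coef r k).
  - apply Cmod_coef_le; [apply cc_test|]. intros x. unfold r. cbn [tmul tfun].
    rewrite Cmod_mult. unfold Rdiv. rewrite Rmult_assoc.
    apply Rmult_le_compat; [apply Cmod_ge_0|apply Cmod_ge_0|apply Hq|].
    eapply Rle_trans; [|apply (H n x)]. right. f_equal.
    cbn [tsub tadd tmul tconst tfun]. rewrite RtoC_m1. ring.
  - replace (coef (tmul q (tpartial g n)) k - coef (tmul q g) k)%C
      with (coef (tmul q (tpartial g n)) k + (- (1)) * coef (tmul q g) k)%C by ring.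
    rewrite <- coef_scal by apply cc_test. rewrite <- coef_plus.
    + apply coef_ext. intros x _. unfold r. cbn [tsub tadd tmul tconst tfun]. rewrite RtoC_m1. ring.
    + apply cc_test.
    + apply cc_mult; [apply cc_const|apply cc_test].
Qed.

(** A shift by one moves a single term into each window, and a single one out of it. *)
Lemma Zseries_shift_le f N : (forall k, 0 <= f k) -> ex_Zseries f ->
  ex_Zseries (fun k => f (k - Z.of_nat N)%Z) /\ Zseries (fun k => f (k - Z.of_nat N)%Z) <= Zseries f.
Proof.
  revert f. assert (One : forall f, (forall k, 0 <= f k) -> ex_Zseries f ->
    ex_Zseries (fun k => f (k - 1)%Z) /\ Zseries (fun k => f (k - 1)%Z) <= Zseries f).
  { intros f H He.
    assert (E : forall n, W (fun k => f (k - 1)%Z) n =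
      W f n - f (Z.of_nat n) + f (- Z.of_nat n - 1)%Z).
    { induction n as [|n IH]; [cbn [W]; simpl; ring|]. cbn [W]. rewrite IH.
      replace (Z.of_nat (S n) - 1)%Z with (Z.of_nat n) by lia.
      replace (- Z.of_nat n - 1)%Z with (- Z.of_nat (S n))%Z by lia. ring. }
    assert (B : forall n, W (fun k => f (k - 1)%Z) n <= Zseries f).
    { intros n. rewrite E. pose proof (W_le_Zseries f (S n) H He) as P. cbn [W] in P.
      replace (- Z.of_nat n - 1)%Z with (- Z.of_nat (S n))%Z by lia.
      pose proof (H (Z.of_nat (S n))). pose proof (H (Z.of_nat n)). lra. }
    assert (Hx : ex_Zseries (fun k => f (k - 1)%Z)) by (apply ex_Zseries_bound with (2 := B); auto).
    split; [exact Hx|]. now apply Zseries_le_bound. }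
  induction N as [|N IH]; intros f H He.
  - rewrite (Zseries_ext _ f) by (intros k; f_equal; lia). split; [|lra].
    revert He. apply ex_Zseries_ext. intros k. f_equal. lia.
  - destruct (IH f H He) as [I1 I2]. destruct (One (fun k => f (k - Z.of_nat N)%Z)) as [O1 O2]; auto.
    rewrite (Zseries_ext _ (fun k => f (k - 1 - Z.of_nat N)%Z)) by (intros k; f_equal; lia).
    split; [|lra]. revert O1. apply ex_Zseries_ext. intros k. f_equal. lia.
Qed.

(** Near [N] both symbols are within [O(1/N)] of the limit [1 / beta]; far from [N] the factor
    [|k - N| / N] on the right is bounded below. *)
Lemma m_slow beta N k : 0 < beta -> (1 <= N)%nat ->
  Rabs (m_ beta (Z.of_nat N) - m_ beta k) <=
  (4 / beta + 2 / beta ^ 2) * (1 + Rabs (IZR (k - Z.of_nat N))) / INR N.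
Proof.
  intros Hb HN. assert (HN' : 1 <= INR N) by (apply (le_INR 1); lia).
  set (j := (k - Z.of_nat N)%Z). pose proof (Rabs_pos (IZR j)) as Pj.
  assert (Hk : IZR k = INR N + IZR j) by (unfold j; rewrite minus_IZR, <- INR_IZR_INZ; ring).
  assert (A1 : 0 < 1 / beta) by (apply Rdiv_lt_0_compat; lra).
  assert (E4 : 4 / beta = 4 * (1 / beta)) by (unfold Rdiv; ring).
  assert (A2 : 0 < 2 / beta ^ 2) by (apply Rdiv_lt_0_compat; nra).
  assert (Bm : forall i, Rabs (m_ beta i) <= 1 / beta).
  { intros i. rewrite m_p, Rabs_mult by exact Hb. pose proof (p_pos beta i Hb).
    rewrite (Rabs_pos_eq (p_ beta i)) by lra. now apply abs_p_le. }
  apply -> Rle_div_r; [|lra].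
  destruct (Rle_or_lt (Rabs (IZR j)) (INR N / 2)) as [L|L].
  - apply Rabs_le_between in L.
    assert (Bt : forall i, INR N / 2 <= IZR i -> 1 / beta - 2 / beta ^ 2 / INR N <= m_ beta i <= 1 / beta).
    { intros i Hi. unfold m_.
      assert (Pi : 0 < beta * IZR i) by (apply Rmult_lt_0_compat; lra).
      pose proof (tanh_ge (beta * IZR i) Pi) as G. pose proof (tanh_lt_1 (beta * IZR i)) as G1.
      assert (I : / (beta * IZR i) <= 2 / (beta * INR N)).
      { replace (2 / (beta * INR N)) with (/ (beta * (INR N / 2))) by (field; lra).
        apply Rinv_le_contravar; [apply Rmult_lt_0_compat; lra|]. apply Rmult_le_compat_l; lra. }
      split.
      - replace (1 / beta - 2 / beta ^ 2 / INR N) with ((1 - 2 / (beta * INR N)) / beta) by (field; lra).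
        apply Rmult_le_compat_r; [left; now apply Rinv_0_lt_compat|]. lra.
      - apply Rmult_le_compat_r; [left; now apply Rinv_0_lt_compat|]. lra. }
    pose proof (Bt k ltac:(lra)) as B1.
    pose proof (Bt (Z.of_nat N)) as B2. rewrite <- INR_IZR_INZ in B2. specialize (B2 ltac:(lra)).
    assert (D : Rabs (m_ beta (Z.of_nat N) - m_ beta k) <= 2 / beta ^ 2 / INR N) by (apply Rabs_le; lra).
    apply Rle_trans with (2 / beta ^ 2 / INR N * INR N); [apply Rmult_le_compat_r; lra|].
    unfold Rdiv at 1. rewrite Rmult_assoc, Rinv_l, Rmult_1_r by lra.
    rewrite E4. nra.
  - pose proof (Bm k) as B1. pose proof (Bm (Z.of_nat N)) as B2.
    assert (D : Rabs (m_ beta (Z.of_nat N) - m_ beta k) <= 2 * (1 / beta)).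
    { apply Rabs_le_between in B1, B2. apply Rabs_le. lra. }
    apply Rle_trans with (2 * (1 / beta) * (2 * Rabs (IZR j))).
    + apply Rmult_le_compat; try lra; apply Rabs_pos.
    + rewrite E4. nra.
Qed.

Lemma p_slow beta N k : 0 < beta -> (1 <= N)%nat ->
  p_ beta k <= (2 + 2 / beta) * (1 + Rabs (IZR (k - Z.of_nat N))) / INR N.
Proof.
  intros Hb HN. assert (HN' : 1 <= INR N) by (apply (le_INR 1); lia).
  set (j := (k - Z.of_nat N)%Z). pose proof (Rabs_pos (IZR j)) as Pj.
  assert (Hk : IZR k = INR N + IZR j) by (unfold j; rewrite minus_IZR, <- INR_IZR_INZ; ring).
  assert (A1 : 0 < 1 / beta) by (apply Rdiv_lt_0_compat; lra).
  assert (E2 : 2 / beta = 2 * (1 / beta)) by (unfold Rdiv; ring).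
  pose proof (p_pos beta k Hb) as Pp.
  apply -> Rle_div_r; [|lra]. rewrite E2.
  destruct (Rle_or_lt (Rabs (IZR j)) (INR N / 2)) as [L|L].
  - apply Rabs_le_between in L. pose proof (abs_p_le beta k Hb) as A.
    rewrite Rabs_pos_eq in A by lra. nra.
  - nra.
Qed.

(** A bump [chi] where [a = 0] carries the approximate wave [h = chi e^{iNx}],
    [u = - (N / omega_N) chi e^{iNx}]. It does not see [a]; its residual comes from the
    variation of the symbols over the frequencies of [chi] and from [b^2 P u], and is [O(N^{-1/2})]. *)
Lemma quasimodes beta (a b : rtest) (chi : test) : 0 < beta ->
  (forall x, tmul (rsquare a) chi x = RtoC 0) -> coef chi 0 <> RtoC 0 ->
  exists c, 0 < c /\ forall N, (1 <= N)%nat -> exists x, Ad_dom x /\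
    energy (ssub (sscal (Ci * RtoC (omega beta N)) x) (Ad beta a b x)) /\
    energy_norm beta (ssub (sscal (Ci * RtoC (omega beta N)) x) (Ad beta a b x)) <= 1 /\
    c * sqrt (INR N) <= energy_norm beta x.
Proof.
  intros Hb Ha Hchi. pose proof PI_RGT_0 as HPI.
  destruct (tbound_exists 3 chi) as [B0 [HB0 HB]].
  set (B := 2 ^ 3 * B0). assert (HBp : 0 <= B) by (unfold B; simpl; lra).
  assert (Hc : forall j, Cmod (coef chi j) <= B / (1 + Rabs (IZR j)) ^ 3)
    by (intros j; now apply coef_decay).
  set (F := fun j : Z => / (1 + Rabs (IZR j)) ^ 2).
  assert (P1 : forall j : Z, 1 <= 1 + Rabs (IZR j)) by (intros j; pose proof (Rabs_pos (IZR j)); lra).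
  assert (HF : forall j, 0 <= F j).
  { intros j. left. apply Rinv_0_lt_compat, pow_lt. specialize (P1 j). lra. }
  (* |chi^|^2 decays like the sixth power: four powers may be spent on the symbols, and the rest is
     still summable *)
  assert (Hcj : forall i j, (i <= 4)%nat -> (1 + Rabs (IZR j)) ^ i * Cmod (coef chi j) ^ 2 <= B ^ 2 * F j).
  { intros i j Hi. specialize (P1 j). set (w := 1 + Rabs (IZR j)) in *.
    assert (Pw : forall n, 0 < w ^ n) by (intros n; apply pow_lt; lra).
    apply Rle_trans with (w ^ 4 * (B / w ^ 3) ^ 2).
    - apply Rmult_le_compat; [left; apply Pw|apply pow2_ge_0|now apply Rle_pow|].
      apply pow_incr. split; [apply Cmod_ge_0|apply Hc].
    - right. unfold F. fold w. field. lra. }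
  set (S := Zseries F). assert (HS : 0 <= S) by (apply Zseries_pos; [exact HF|apply ex_Zseries_inv_square]).
  destruct (laurent_rsquare_damping (fun _ => b)) as [K [HK HL]].
  pose proof (tanh_pos beta Hb) as HT.
  set (t := tanh beta / beta). assert (Ht : 0 < t) by (apply Rdiv_lt_0_compat; lra).
  set (C1 := 4 / beta + 2 / beta ^ 2). set (C2 := 2 + 2 / beta).
  assert (HC1 : 0 < C1).
  { assert (0 < 4 / beta) by (apply Rdiv_lt_0_compat; lra).
    assert (0 < 2 / beta ^ 2) by (apply Rdiv_lt_0_compat; nra). unfold C1. lra. }
  assert (HC2 : 0 < C2).
  { assert (0 < 2 / beta) by (apply Rdiv_lt_0_compat; lra). unfold C2. lra. }
  set (V := (C1 ^ 2 / t + 2 * C2) * (B ^ 2 * S) + 2 * (K ^ 2 * (2 * (C2 ^ 2 / t * (B ^ 2 * S))))).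
  assert (HBS : 0 <= B ^ 2 * S) by (apply Rmult_le_pos; [apply pow2_ge_0|exact HS]).
  assert (HC12 : 0 <= C1 ^ 2 / t) by (apply Rdiv_le_0_compat; [apply pow2_ge_0|lra]).
  assert (HC22 : 0 <= C2 ^ 2 / t) by (apply Rdiv_le_0_compat; [apply pow2_ge_0|lra]).
  assert (HV : 0 <= V).
  { unfold V. apply Rplus_le_le_0_compat; [apply Rmult_le_pos; lra|].
    apply Rmult_le_pos; [lra|]. apply Rmult_le_pos; [apply pow2_ge_0|].
    apply Rmult_le_pos; [lra|]. now apply Rmult_le_pos. }
  (* eps^2 V bounds the squared l2 norm of the residual, and the energy norm carries a factor
     sqrt (2 PI) *)
  set (eps := / (2 * PI * (V + 1))).
  assert (Hpv : 1 < 2 * PI * (V + 1)) by (pose proof PI_4; pose proof PI2_1; nra).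
  assert (Heps : 0 < eps < 1).
  { unfold eps. split; [apply Rinv_0_lt_compat; lra|]. rewrite <- Rinv_1. apply Rinv_lt_contravar; lra. }
  assert (HepsV : eps ^ 2 * (2 * PI * V) <= 1).
  { assert (E : eps * (2 * PI * (V + 1)) = 1) by (unfold eps; field; nra). nra. }
  assert (Hc0 : 0 < Cmod (coef chi 0)) by now apply Cmod_gt_0.
  exists (sqrt (2 * PI) * (eps * Cmod (coef chi 0))).
  split; [apply Rmult_lt_0_compat; [apply sqrt_lt_R0; lra|nra]|].
  intros N HN. set (n := Z.of_nat N).
  assert (HN' : 1 <= INR N) by (apply (le_INR 1); lia).
  set (om := omega beta N).
  assert (Eom : om = freq beta n) by now apply omega_freq.
  assert (Hom2 : om ^ 2 = INR N * m_ beta n).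
  { rewrite Eom, freq_sq, m_p by exact Hb. unfold n. rewrite <- INR_IZR_INZ. ring. }
  assert (Hmt : t <= m_ beta n).
  { rewrite m_p by exact Hb. pose proof (abs_p_ge beta n Hb ltac:(unfold n; lia)) as A.
    rewrite Rabs_pos_eq in A by (unfold n; rewrite <- INR_IZR_INZ; lra). exact A. }
  assert (Hom0 : 0 < om).
  { assert (0 < om ^ 2) by (rewrite Hom2; nra). assert (0 <= om) by apply sqrt_pos. nra. }
  set (s := eps * sqrt (INR N)).
  assert (Hs2 : s ^ 2 = eps ^ 2 * INR N).
  { unfold s. rewrite Rpow_mult_distr, pow2_sqrt by lra. reflexivity. }
  set (g := INR N / om).
  assert (Hg2 : g ^ 2 <= INR N / t).
  { unfold g. unfold Rdiv. rewrite Rpow_mult_distr, pow_inv, Hom2.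
    replace (INR N ^ 2 * / (INR N * m_ beta n)) with (INR N * / m_ beta n) by (field; nra).
    apply Rmult_le_compat_l; [lra|]. apply Rinv_le_contravar; lra. }
  assert (Hgo : om = g * m_ beta n).
  { unfold g. apply Rmult_eq_reg_r with om; [|lra]. replace (om * om) with (om ^ 2) by ring.
    rewrite Hom2. field. lra. }
  assert (Hgn : g * om = IZR n).
  { unfold g, n. rewrite <- INR_IZR_INZ. field. lra. }
  set (wave := tmul chi (expi n)).
  set (h := dscal (RtoC s) (of_test wave)).
  set (u := dscal (RtoC (- (s * g))) (of_test wave)).
  set (x := (h, u)). set (c := fun k => coef chi (k - n)).
  assert (Fw : forall k, fourier (of_test wave) k = c k).
  { intros k. rewrite fourier_of_test. apply coef_mul_expi. }
  assert (Fh : forall k, fourier h k = (RtoC s * c k)%C).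
  { intros k. unfold h. now rewrite fourier_dscal, Fw. }
  assert (Fu : forall k, fourier u k = (- RtoC s * RtoC g * c k)%C).
  { intros k. unfold u. rewrite fourier_dscal, Fw, RtoC_opp, RtoC_mult. ring. }
  assert (Fah : forall k, fourier (dmul (rsquare a) h) k = RtoC 0).
  { intros k. replace (fourier (dmul (rsquare a) h) k) with
      (RtoC s * fourier (dmul (rsquare a) (of_test wave)) k)%C
      by (unfold fourier, h; simpl pair; field; apply two_PI_C).
    rewrite fourier_dmul_of_test, (coef_ext _ (fun _ => RtoC 0 * RtoC 0)%C).
    - rewrite (coef_scal 0 (fun _ => RtoC 0)) by apply cc_const. ring.
    - intros y _. unfold wave. specialize (Ha y). cbn [tmul tfun] in *.
      rewrite Cmult_assoc, Ha. ring. }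
  destruct (Zseries_shift_le F N HF ex_Zseries_inv_square) as [HFs1 HFs2]. fold n S in HFs1, HFs2.
  (* the frequencies of the wave are within O(1) of N *)
  assert (Hkn : forall k, 1 + Rabs (IZR k) <= (1 + INR N) * (1 + Rabs (IZR (k - n)))).
  { intros k. assert (Rabs (IZR k) <= INR N + Rabs (IZR (k - n))).
    { replace (IZR k) with (INR N + IZR (k - n)) by (unfold n; rewrite minus_IZR, <- INR_IZR_INZ; ring).
      eapply Rle_trans; [apply Rabs_triang|]. rewrite Rabs_pos_eq; lra. }
    pose proof (Rabs_pos (IZR (k - n))). nra. }
  assert (Hdom : Ad_dom x).
  { unfold Ad_dom, Sobolev, x. simpl fst. simpl snd. split.
    - apply ex_Zseries_pos_le with (c := s ^ 2 * (1 + INR N) * B ^ 2) (2 := HFs1). intros k.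
      destruct (Rpower_bracket k) as [_ [-> _]]. destruct (bracket_bounds k) as [Q1 [_ Q3]].
      rewrite Fh, Cmod_mult, Cmod_R, Rpow_mult_distr, pow2_abs.
      pose proof (Hcj 1%nat (k - n)%Z ltac:(lia)) as Q. rewrite pow_1 in Q. fold (c k) in Q.
      pose proof (pow2_ge_0 (Cmod (c k))) as Q4. pose proof (pow2_ge_0 s) as Q5. specialize (Hkn k).
      split; [apply Rmult_le_pos; nra|].
      apply Rle_trans with ((1 + INR N) * (1 + Rabs (IZR (k - n))) * (s ^ 2 * Cmod (c k) ^ 2)).
      + apply Rmult_le_compat_r; nra.
      + replace ((1 + INR N) * (1 + Rabs (IZR (k - n))) * (s ^ 2 * Cmod (c k) ^ 2))
          with (s ^ 2 * (1 + INR N) * ((1 + Rabs (IZR (k - n))) * Cmod (c k) ^ 2)) by ring.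
        rewrite (Rmult_assoc (s ^ 2 * (1 + INR N))). apply Rmult_le_compat_l; [nra|exact Q].
    - apply ex_Zseries_pos_le with (c := s ^ 2 * g ^ 2 * B ^ 2) (2 := HFs1). intros k.
      destruct (Rpower_bracket k) as [-> _].
      rewrite Fu, !Cmod_mult, Cmod_opp, !Cmod_R, !Rpow_mult_distr, !pow2_abs.
      pose proof (Hcj 0%nat (k - n)%Z ltac:(lia)) as Q. rewrite pow_O in Q. fold (c k) in Q.
      pose proof (pow2_ge_0 (Cmod (c k))). pose proof (pow2_ge_0 s). pose proof (pow2_ge_0 g).
      assert (0 <= s ^ 2 * g ^ 2) by nra. rewrite Rmult_1_l. split; [nra|].
      rewrite (Rmult_assoc (s ^ 2 * g ^ 2)). apply Rmult_le_compat_l; lra. }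
  set (y := ssub (sscal (Ci * RtoC om) x) (Ad beta a b x)).
  (* p_k u_k is O(N^{-1/2}) in l2, and multiplication by b^2 is bounded *)
  set (pu := (fun k _ => RtoC (p_ beta k) * fourier u k)%C : vec).
  (* g^2 grows like N, and p_k is O(1/N) near N *)
  assert (Hp2 : forall k, p_ beta k ^ 2 * g ^ 2 * Cmod (c k) ^ 2 <= C2 ^ 2 / t / INR N * (B ^ 2 * F (k - n)%Z)).
  { intros k. pose proof (p_slow beta N k Hb HN) as Q. fold n C2 in Q.
    pose proof (p_pos beta k Hb). pose proof (P1 (k - n)%Z) as Pw.
    set (w := 1 + Rabs (IZR (k - n))) in *.
    pose proof (Hcj 2%nat (k - n)%Z ltac:(lia)) as Q2. fold w in Q2. fold (c k) in Q2.
    assert (Q3 : p_ beta k ^ 2 <= (C2 * w / INR N) ^ 2) by (apply pow_incr; lra).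
    pose proof (pow2_ge_0 (p_ beta k)). pose proof (pow2_ge_0 g). pose proof (pow2_ge_0 (Cmod (c k))).
    apply Rle_trans with ((C2 * w / INR N) ^ 2 * (INR N / t) * Cmod (c k) ^ 2).
    - apply Rmult_le_compat_r; [lra|]. apply Rmult_le_compat; lra.
    - replace ((C2 * w / INR N) ^ 2 * (INR N / t) * Cmod (c k) ^ 2) with
        (C2 ^ 2 / t / INR N * (w ^ 2 * Cmod (c k) ^ 2)) by (field; lra).
      apply Rmult_le_compat_l; [apply Rdiv_le_0_compat; lra|exact Q2]. }
  assert (Hpu : l2 pu /\ dot pu pu <= eps ^ 2 * (2 * (C2 ^ 2 / t * (B ^ 2 * S)))).
  { assert (Q : forall k, ip pu pu k <= 2 * (eps ^ 2 * (C2 ^ 2 / t) * B ^ 2) * F (k - n)%Z).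
    { intros k. rewrite ip_self. unfold pu. rewrite Fu, !Cmod_mult, Cmod_opp, !Cmod_R.
      rewrite !Rpow_mult_distr, !pow2_abs, Hs2. specialize (Hp2 k).
      assert (eps ^ 2 * INR N * (p_ beta k ^ 2 * g ^ 2 * Cmod (c k) ^ 2) <=
        eps ^ 2 * INR N * (C2 ^ 2 / t / INR N * (B ^ 2 * F (k - n)%Z))).
      { apply Rmult_le_compat_l; [nra|exact Hp2]. }
      replace (eps ^ 2 * INR N * (C2 ^ 2 / t / INR N * (B ^ 2 * F (k - n)%Z))) with
        (eps ^ 2 * (C2 ^ 2 / t) * B ^ 2 * F (k - n)%Z) in H by (field; lra). lra. }
    assert (Hx2 : ex_Zseries (fun k => 2 * (eps ^ 2 * (C2 ^ 2 / t) * B ^ 2) * F (k - n)%Z))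
      by now apply ex_Zseries_scal.
    assert (Hl : l2 pu) by now apply l2_le with (1 := Q).
    split; [exact Hl|]. eapply Rle_trans; [apply (Zseries_le _ _ Q); assumption|].
    rewrite Zseries_scal by exact HFs1.
    replace (eps ^ 2 * (2 * (C2 ^ 2 / t * (B ^ 2 * S)))) with
      (2 * (eps ^ 2 * (C2 ^ 2 / t) * B ^ 2) * S) by ring.
    apply Rmult_le_compat_l; [|exact HFs2]. pose proof (pow2_ge_0 eps). pose proof (pow2_ge_0 B).
    apply Rmult_le_pos; [lra|]. apply Rmult_le_pos; [now apply Rmult_le_pos|lra]. }
  destruct Hpu as [Hpu Hpu2].
  set (L := laurent (fun _ => rsquare b) pu).
  assert (HLl : l2 L) by now apply HL.
  assert (HLd : dot L L <= K ^ 2 * (eps ^ 2 * (2 * (C2 ^ 2 / t * (B ^ 2 * S))))).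
  { rewrite <- nrm_sq by exact HLl. pose proof (damping_bound K _ pu HK HL Hpu) as D. fold L in D.
    apply Rle_trans with ((K * nrm pu) ^ 2); [apply pow_incr; split; [apply nrm_pos|exact D]|].
    rewrite Rpow_mult_distr, nrm_sq by exact Hpu. apply Rmult_le_compat_l; [apply pow2_ge_0|exact Hpu2]. }
  assert (FL : forall k, fourier (dmul (rsquare b) (Pop beta u)) k = L k false).
  { intros k. unfold L, laurent. do 2 f_equal. apply distr_ext. intros j.
    rewrite fourier_synth by exact (polygrowth_l2 pu false Hpu). now rewrite fourier_Pop. }
  assert (Fy1 : forall k, fourier (fst y) k = (Ci * RtoC (s * g * (m_ beta n - m_ beta k)) * c k)%C).
  { intros k. unfold y, ssub, sscal, Ad, x. simpl fst.
    rewrite !fourier_dsub, fourier_dscal, fourier_Top, Fah, Fh, Fu by exact Hb.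
    rewrite Hgo at 1. rewrite !RtoC_mult, RtoC_minus. ring. }
  assert (Fy2 : forall k, fourier (snd y) k = (Ci * RtoC (s * IZR (k - n)) * c k + L k false)%C).
  { intros k. unfold y, ssub, sscal, Ad, x. simpl snd.
    rewrite !fourier_dsub, !fourier_dscal, fourier_dderiv, FL, Fh, Fu.
    rewrite minus_IZR, <- Hgn, RtoC_m1, RtoC_mult, RtoC_minus, RtoC_mult. ring. }
  set (Y := ecoord beta y).
  assert (HY : forall k, ip Y Y k <= eps ^ 2 * (C1 ^ 2 / t + 2 * C2) * B ^ 2 * F (k - n)%Z + 2 * ip L L k).
  { intros k. unfold Y. rewrite ip_ecoord, Fy1, Fy2 by exact Hb.
    pose proof (P1 (k - n)%Z) as Pw. pose proof (p_pos beta k Hb) as Pp.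
    pose proof (m_slow beta N k Hb HN) as Qm. pose proof (p_slow beta N k Hb HN) as Qp.
    fold n C1 in Qm. fold n C2 in Qp.
    pose proof (Hcj 2%nat (k - n)%Z ltac:(lia)) as Q2. pose proof (Hcj 3%nat (k - n)%Z ltac:(lia)) as Q3.
    fold (c k) in Q2, Q3. set (w := 1 + Rabs (IZR (k - n))) in *.
    set (G := Cmod (c k) ^ 2) in *. assert (HG : 0 <= G) by apply pow2_ge_0.
    assert (T1 : Cmod (Ci * RtoC (s * g * (m_ beta n - m_ beta k)) * c k) ^ 2
      <= eps ^ 2 * (C1 ^ 2 / t) * (B ^ 2 * F (k - n)%Z)).
    { rewrite !Cmod_mult, Cmod_Ci, Cmod_R, !Rpow_mult_distr, pow1, Rmult_1_l, pow2_abs.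
      rewrite !Rpow_mult_distr, Hs2. fold G.
      assert (M2 : (m_ beta n - m_ beta k) ^ 2 <= (C1 * w / INR N) ^ 2).
      { rewrite <- (pow2_abs (_ - _)). apply pow_incr. split; [apply Rabs_pos|exact Qm]. }
      apply Rle_trans with (eps ^ 2 * INR N * (INR N / t) * (C1 * w / INR N) ^ 2 * G).
      - apply Rmult_le_compat_r; [exact HG|].
        apply Rmult_le_compat; [|apply pow2_ge_0| |exact M2].
        + apply Rmult_le_pos; [nra|apply pow2_ge_0].
        + apply Rmult_le_compat_l; [nra|exact Hg2].
      - replace (eps ^ 2 * INR N * (INR N / t) * (C1 * w / INR N) ^ 2 * G) with
          (eps ^ 2 * (C1 ^ 2 / t) * (w ^ 2 * G)) by (field; lra).
        apply Rmult_le_compat_l; [|exact Q2]. apply Rmult_le_pos; [apply pow2_ge_0|exact HC12]. }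
    set (z := (Ci * RtoC (s * IZR (k - n)) * c k)%C).
    assert (T2 : p_ beta k * Cmod z ^ 2 <= eps ^ 2 * C2 * (B ^ 2 * F (k - n)%Z)).
    { unfold z. rewrite !Cmod_mult, Cmod_Ci, Cmod_R, !Rpow_mult_distr, pow1, Rmult_1_l, pow2_abs.
      rewrite Rpow_mult_distr, Hs2, <- (pow2_abs (IZR (k - n))). fold G.
      assert (W2 : Rabs (IZR (k - n)) ^ 2 <= w ^ 2).
      { apply pow_incr. split; [apply Rabs_pos|unfold w; lra]. }
      apply Rle_trans with (C2 * w / INR N * (eps ^ 2 * INR N * w ^ 2 * G)).
      - apply Rmult_le_compat; [lra| |exact Qp|].
        + apply Rmult_le_pos; [|exact HG]. apply Rmult_le_pos; [nra|apply pow2_ge_0].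
        + apply Rmult_le_compat_r; [exact HG|]. apply Rmult_le_compat_l; [nra|exact W2].
      - replace (C2 * w / INR N * (eps ^ 2 * INR N * w ^ 2 * G)) with
          (eps ^ 2 * C2 * (w ^ 3 * G)) by (field; lra).
        apply Rmult_le_compat_l; [|exact Q3]. apply Rmult_le_pos; [apply pow2_ge_0|lra]. }
    assert (T3 : Cmod (z + L k false) ^ 2 <= 2 * Cmod z ^ 2 + 2 * Cmod (L k false) ^ 2).
    { apply Rle_trans with ((Cmod z + Cmod (L k false)) ^ 2).
      - apply pow_incr. split; [apply Cmod_ge_0|apply Cmod_triangle].
      - pose proof (pow2_ge_0 (Cmod z - Cmod (L k false))). nra. }
    assert (T4 : Cmod (L k false) ^ 2 <= ip L L k).
    { rewrite ip_self. pose proof (pow2_ge_0 (Cmod (L k true))). lra. }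
    pose proof (pow2_ge_0 (Cmod (L k false))).
    apply Rle_trans with (eps ^ 2 * (C1 ^ 2 / t) * (B ^ 2 * F (k - n)%Z)
      + (2 * (p_ beta k * Cmod z ^ 2) + 2 * Cmod (L k false) ^ 2)).
    - apply Rplus_le_compat; [exact T1|].
      apply Rle_trans with (p_ beta k * (2 * Cmod z ^ 2 + 2 * Cmod (L k false) ^ 2)).
      + apply Rmult_le_compat_l; [lra|exact T3].
      + nra.
    - lra. }
  assert (HYg : ex_Zseries (fun k => eps ^ 2 * (C1 ^ 2 / t + 2 * C2) * B ^ 2 * F (k - n)%Z + 2 * ip L L k)).
  { apply ex_Zseries_plus; [|now apply ex_Zseries_scal].
    exact (ex_Zseries_scal (eps ^ 2 * (C1 ^ 2 / t + 2 * C2) * B ^ 2) _ HFs1). }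
  assert (HYl : l2 Y) by now apply l2_le with (1 := HY).
  assert (HYd : dot Y Y <= eps ^ 2 * V).
  { eapply Rle_trans; [apply (Zseries_le _ _ HY); assumption|].
    rewrite Zseries_plus;
      [|exact (ex_Zseries_scal (eps ^ 2 * (C1 ^ 2 / t + 2 * C2) * B ^ 2) _ HFs1)|now apply ex_Zseries_scal].
    rewrite (Zseries_scal _ _ HFs1), (Zseries_scal _ _ HLl). fold (dot L L).
    apply Rle_trans with (eps ^ 2 * (C1 ^ 2 / t + 2 * C2) * B ^ 2 * S +
      2 * (K ^ 2 * (eps ^ 2 * (2 * (C2 ^ 2 / t * (B ^ 2 * S)))))).
    - apply Rplus_le_compat; [|lra]. apply Rmult_le_compat_l; [|exact HFs2].
      apply Rmult_le_pos; [|apply pow2_ge_0]. apply Rmult_le_pos; [apply pow2_ge_0|lra].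
    - right. unfold V. ring. }
  assert (Hey : energy y) by now apply (energy_l2 beta).
  exists x. split; [exact Hdom|]. split; [exact Hey|]. split.
  - fold y. rewrite energy_norm_nrm by assumption. fold Y. unfold nrm.
    rewrite <- sqrt_mult by (try apply dot_pos; try exact HYl; lra).
    rewrite <- sqrt_1. apply sqrt_le_1_alt.
    apply Rle_trans with (2 * PI * (eps ^ 2 * V)); [apply Rmult_le_compat_l; lra|lra].
  - pose proof (dom_energy x Hdom) as Hex.
    rewrite energy_norm_nrm by assumption. rewrite Rmult_assoc.
    apply Rmult_le_compat_l; [apply sqrt_pos|].
    pose proof (Cmod_le_nrm (ecoord beta x) n true (proj1 (energy_l2 beta x Hb) Hex)) as Q.
    unfold ecoord at 1 in Q. simpl fst in Q. rewrite Fh, Cmod_mult, Cmod_R in Q. unfold c in Q.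
    rewrite Z.sub_diag in Q.
    assert (0 <= s) by (unfold s; apply Rmult_le_pos; [lra|apply sqrt_pos]).
    rewrite Rabs_pos_eq in Q by assumption. unfold s in Q at 1. lra.
Qed.

(** * The lower bound on the resolvent *)

Lemma op_norm_ge beta Rz y : energy y -> energy_norm beta y <= 1 ->
  Rbar_le (energy_norm beta (Rz y)) (op_norm beta Rz).
Proof.
  intros H1 H2. unfold op_norm. apply (Lub_Rbar_correct _). now exists y.
Qed.

Lemma omega_ratio beta N : 0 < beta -> (1 <= N)%nat ->
  omega beta N = 1 / sqrt beta * sqrt (INR N) * sqrt (tanh (beta * INR N)).
Proof.
  intros Hb HN. assert (HN' : 0 < INR N) by (apply lt_0_INR; lia).
  pose proof (tanh_pos (beta * INR N)) as T. specialize (T ltac:(nra)).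
  unfold omega, Rdiv. rewrite Rmult_1_l, <- sqrt_inv.
  rewrite <- !sqrt_mult; try lra; try (left; now apply Rinv_0_lt_compat).
  - f_equal. ring.
  - apply Rmult_le_pos; [left; now apply Rinv_0_lt_compat|lra].
Qed.

Lemma omega_asymptotics beta : 0 < beta ->
  is_lim_seq (fun N => omega beta N / (1 / sqrt beta * sqrt (INR N))) 1.
Proof.
  intros Hb. apply is_lim_seq_ext_loc with (fun N => sqrt (tanh (beta * INR N))).
  - exists 1%nat. intros N HN. rewrite omega_ratio by assumption.
    assert (0 < sqrt (INR N)) by (apply sqrt_lt_R0, lt_0_INR; lia).
    assert (0 < sqrt beta) by now apply sqrt_lt_R0. field. lra.
  - rewrite <- sqrt_1.
    apply (is_lim_seq_continuous sqrt (fun N => tanh (beta * INR N)) 1).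
    { apply continuity_pt_sqrt. lra. }
    apply is_lim_seq_le_le_loc with (fun N => 1 - / (beta * INR N)) (fun _ => 1).
    + exists 1%nat. intros N HN. assert (HN' : 0 < INR N) by (apply lt_0_INR; lia).
      split; [apply tanh_ge; nra|]. left. apply tanh_lt_1.
    + replace (Finite 1) with (Finite (1 - 0)) by (f_equal; ring).
      apply is_lim_seq_minus'; [apply is_lim_seq_const|].
      apply (is_lim_seq_inv (fun N => beta * INR N) p_infty); [|discriminate].
      replace p_infty with (Rbar_mult beta p_infty).
      * apply is_lim_seq_scal_l, is_lim_seq_INR.
      * apply is_Rbar_mult_unique, is_Rbar_mult_sym. now apply is_Rbar_mult_p_infty_pos.
    + apply is_lim_seq_const.
Qed.

(** The quasimode is the image under the resolvent of its own residual, which lies in the unit ball. *)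
Lemma res_norm_lower_bound beta (a b : rtest) :
  0 < beta -> (exists x, a x <> 0) -> (exists O, open_off_supp a O) ->
  exists c, 0 < c /\ eventually (fun N =>
    Rbar_le (c * sqrt (INR N)) (res_norm beta a b (omega beta N))).
Proof.
  intros Hb [x0 Hx0] [O HO].
  destruct (bump_exists a O HO) as [chi [Hchi1 [Hchi2 Hchi3]]].
  pose proof (coef_0_pos chi Hchi2 Hchi3) as Hchi0.
  assert (Hchi0' : coef chi 0 <> RtoC 0).
  { intros E. rewrite E in Hchi0. simpl in Hchi0. lra. }
  destruct (quasimodes beta a b chi Hb Hchi1 Hchi0') as [c [Hc Hq]].
  set (q := rsquare a).
  assert (Hq0 : 0 < Re (coef q 0)).
  { apply coef_0_pos.
    - intros x. simpl. split; [reflexivity|apply pow2_ge_0].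
    - exists x0. intros E. injection E as E. nra. }
  destruct (riemann_lebesgue q (cc_test q) (Re (coef q 0) / 2)) as [N0 HN0]; [lra|].
  exists c. split; [exact Hc|]. exists (S N0). intros N HN.
  assert (HN1 : (1 <= N)%nat) by lia.
  destruct (resolvent_exists beta a b N Hb HN1 Hq0) as [Rz0 HRz0].
  { left. apply HN0. lia. }
  { left. apply HN0. lia. }
  pose proof (epsilon_spec (inhabits (fun y : state => y))
    (is_resolvent beta Ad_dom (Ad beta a b) (Ci * RtoC (omega beta N))%C)
    (ex_intro _ Rz0 HRz0)) as HR.
  fold (resolvent beta Ad_dom (Ad beta a b) (Ci * RtoC (omega beta N))%C) in HR.
  destruct HR as [_ [HR _]].
  destruct (Hq N HN1) as [x [Hx [He [Hn Hl]]]].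
  destruct (HR x Hx) as [_ Ex].
  apply Rbar_le_trans with (Finite (energy_norm beta x)); [exact Hl|].
  rewrite <- Ex. now apply op_norm_ge.
Qed.

Theorem theorem5p4 (beta : R) (a b : rtest)
    (beta_pos : 0 < beta)
    (a_ge0 : forall x, 0 <= a x) (b_ge0 : forall x, 0 <= b x)
    (a_neq0 : exists x, a x <> 0) (b_neq0 : exists x, b x <> 0)
    (off_supp : exists O : R -> Prop, open_off_supp a O) :
  (exists c, 0 < c /\ eventually (fun N =>
     Rbar_le (c * sqrt (INR N)) (res_norm beta a b (omega beta N)))) /\
  is_lim_seq (fun N => omega beta N / (1 / sqrt beta * sqrt (INR N))) 1 /\
  (exists c_beta, 0 < c_beta /\ eventually (fun N =>
     Rbar_le (c_beta * omega beta N) (res_norm beta a b (omega beta N)))) /\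
  Rbar_lub (fun r => exists tau : R, r = res_norm beta a b tau) = p_infty.
Proof.
  pose proof (res_norm_lower_bound beta a b beta_pos a_neq0 off_supp) as Main.
  assert (Hsb : 0 < sqrt beta) by now apply sqrt_lt_R0.
  split; [exact Main|]. split; [now apply omega_asymptotics|].
  destruct Main as [c [Hc [N0 HN0]]]. split.
  - exists (c * sqrt beta). split; [now apply Rmult_lt_0_compat|].
    exists (S N0). intros N HN. eapply Rbar_le_trans; [|apply HN0; lia].
    rewrite omega_ratio by (try exact beta_pos; lia). simpl.
    replace (c * sqrt beta * (1 / sqrt beta * sqrt (INR N) * sqrt (tanh (beta * INR N))))
      with (c * sqrt (INR N) * sqrt (tanh (beta * INR N))) by (field; lra).
    assert (sqrt (tanh (beta * INR N)) <= 1).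
    { rewrite <- sqrt_1. apply sqrt_le_1_alt. left. apply tanh_lt_1. }
    pose proof (sqrt_pos (INR N)). assert (0 <= c * sqrt (INR N)) by nra. nra.
  - apply Rbar_is_lub_unique. split.
    + intros r _. now destruct r.
    + intros M HM.
      assert (HB : forall N, (N0 <= N)%nat -> Rbar_le (c * sqrt (INR N)) M).
      { intros N HN. eapply Rbar_le_trans; [now apply HN0|]. apply HM. now exists (omega beta N). }
      destruct M as [M| |]; [exfalso|exact I|exact (HB N0 (le_n _))].
      (* take N larger than (M / c)^2 *)
      destruct (INR_unbounded ((M / c) ^ 2)) as [k Hk].
      pose proof (HB (N0 + k)%nat ltac:(lia)) as H. simpl in H.
      assert (HNk : (M / c) ^ 2 < INR (N0 + k)).
      { rewrite plus_INR. pose proof (pos_INR N0). lra. }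
      assert (HM2 : sqrt (INR (N0 + k)) <= M / c).
      { apply Rle_div_r; [exact Hc|]. lra. }
      pose proof (sqrt_pos (INR (N0 + k))) as Ps.
      assert (E : sqrt (INR (N0 + k)) ^ 2 = INR (N0 + k)) by (apply pow2_sqrt, pos_INR).
      assert (sqrt (INR (N0 + k)) ^ 2 <= (M / c) ^ 2) by (apply pow_incr; lra). lra.
Qed.
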